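(* Let Assumptions 1, 2 and 3 (stated in the context) hold. Let $c>0$, $\kappa>0$, $\gamma>0$ satisfy $\kappa>-\mu$, $\gamma>3L$, and let $$0\le \eta_k\le \bar\eta:=\sqrt{\frac{\kappa+2c+\gamma-3L}{2(\gamma-\mu+3L)}}\quad\text{for all }k\ge0 .$$ Then, for $0<\alpha\le c$ and $\beta>0$ both sufficiently small, SPPDM finds an $\epsilon$-stationary solution in expectation. Precisely: there exist $\tau>0$ and $\bar\alpha\in(0,c]$ (depending only on $L,\mu,\kappa,\gamma,c$ and the graph) such that for every $\alpha\in(0,\bar\alpha]$ there is $\bar\beta\in(0,1]$ (depending only on $L,\mu,\kappa,\gamma,c,\alpha$, the graph and the matrices $S_{x,i},S_{y,i}$) such that for every $\beta\in(0,\bar\beta)$ there are constants $C_0,C_1>0$ depending only on these problem parameters and on $\alpha,\beta$ (not on $\epsilon$, $K$, $|\mathcal I|$, $\sigma$ or the iterates) such that the following holds: for every $\epsilon>0$, if the batch size and the number of iterations satisfy $$|\mathcal I|\ge\frac{2NC_0C_1\sigma^2}{\epsilon}\quad\text{and}\quad K\ge\frac{2C_0(\phi^0-\underline f)}{\epsilon},$$ with $|\mathcal I|\ge1$, $K\ge1$ integers, then every sequence $\{\mathbf x^k,\mathbf z^k,\boldsymbol\lambda^k\}$ generated by SPPDM satisfies $$\min_{k=0,\dots,K-1}\mathbb E\big[Q(\mathbf x^k,\boldsymbol\lambda^{k+1})\big]\le\epsilon .$$ Here $\phi^0$ is the initial potential value (with this $\tau$) defined in the context.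
   Context: Problem. $\mathcal G$ is an undirected connected graph on $\{1,\dots,N\}$ with edge set $\mathcal E$ and degrees $d_i\ge 1$. For each $i$, $f_i:\mathbb R^n\to\mathbb R$ is smooth (possibly nonconvex) and $r_i:\mathbb R^n\to\mathbb R\cup\{+\infty\}$ is proper closed convex. For $\mathbf x=(x_1,\dots,x_N)\in\mathbb R^{Nn}$ put $f(\mathbf x)=\sum_i f_i(x_i)$, $r(\mathbf x)=\sum_i r_i(x_i)$. The incidence matrix $\tilde{\mathbf A}\in\mathbb R^{|\mathcal E|\times N}$ has, in the row of edge $(i,j)$ with $j>i$, entry $1$ in column $i$, $-1$ in column $j$ and zeros elsewhere; $\mathbf A=\tilde{\mathbf A}\otimes I_n$, $\mathbf B=|\mathbf A|$ (entrywise absolute value), $\mathbf D=\mathrm{diag}(d_1,\dots,d_N)\otimes I_n$, so $\mathbf A^\top\mathbf A+\mathbf B^\top\mathbf B=2\mathbf D$. The problem is $\min_{\mathbf x} f(\mathbf x)+r(\mathbf x)$ subject to $\mathbf A\mathbf x=0$, assumed feasible (some $\mathbf x$ has $\mathbf A\mathbf x=0$, $r(\mathbf x)<\infty$). Assumption 1. (i) $f$ is continuously differentiable with $\|\nabla f(\mathbf x)-\nabla f(\mathbf y)\|\le L\|\mathbf x-\mathbf y\|$ for all $\mathbf x,\mathbf y$, $L>0$; and there is $\mu\ge -L$ (possibly negative) with $f(\mathbf x)-f(\mathbf y)-\langle\nabla f(\mathbf y),\mathbf x-\mathbf y\rangle\ge\frac{\mu}{2}\|\mathbf x-\mathbf y\|^2$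 for all $\mathbf x,\mathbf y$. (ii) There is a constant $\underline f>-\infty$ with $f(\mathbf x)+r(\mathbf x)>\underline f$ whenever $\mathbf A\mathbf x=0$. Assumption 2. For each $i$ the epigraph $\{(x_i,y_i): r_i(x_i)\le y_i\}$ is a polyhedral set $\{(x_i,y_i): S_{x,i}x_i+S_{y,i}y_i\ge\zeta_i\}$ with $S_{x,i}\in\mathbb R^{q_i\times n}$, $S_{y,i},\zeta_i\in\mathbb R^{q_i}$. Assumption 3. For each agent $i$, with $\xi\sim\mathcal B_i$ and all $x\in\mathbb R^n$: $\mathbb E[G_i(x,\xi)]=\nabla f_i(x)$ and $\mathbb E\|G_i(x,\xi)-\nabla f_i(x)\|^2\le\sigma^2$, $\sigma>0$. SPPDM algorithm. Parameters: dual step size $\alpha>0$, $\beta>0$, $\gamma>0$, $c>0$, $\kappa>0$, $\eta_k\geq 0$, batch size $|\mathcal I|$. Start from deterministic $\mathbf x^0$ with $r(\mathbf x^0)<\infty$, $\mathbf x^{-1}=\mathbf x^0$, $\mathbf z^0=\mathbf x^0$, $\boldsymbol\lambda^0=-\alpha\mathbf A\mathbf x^0$ (so $\boldsymbol\lambda^1=0$). For $k=0,1,2,\dots$: $\boldsymbol\lambda^{k+1}=\boldsymbol\lambda^k+\alpha\mathbf A\mathbf x^k$; $\mathbf s^k=\mathbf x^k+\eta_k(\mathbf x^k-\mathbf x^{k-1})$; $\mathbf x^{k+1}=\arg\min_{\mathbf x}\big\{f(\mathbf s^k)+\langle\bar G(\mathbf s^k,\boldsymbol\xi^k),\mathbf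 x-\mathbf s^k\rangle+\frac\gamma2\|\mathbf x-\mathbf s^k\|^2+r(\mathbf x)+\langle\boldsymbol\lambda^{k+1},\mathbf A\mathbf x\rangle+\frac c2\|\mathbf A\mathbf x\|^2+\frac c2\|\mathbf B(\mathbf x-\mathbf x^k)\|^2+\frac\kappa2\|\mathbf x-\mathbf z^k\|^2\big\}$; $\mathbf z^{k+1}=\mathbf z^k+\beta(\mathbf x^{k+1}-\mathbf z^k)$. Here the $i$-th block of $\bar G(\mathbf s^k,\boldsymbol\xi^k)$ is $\frac1{|\mathcal I|}\sum_{j=1}^{|\mathcal I|}G_i(s_i^k,\xi_{ij}^k)$ with samples $\xi_{ij}^k\sim\mathcal B_i$ independent across $j$ (and $i$) and independent of the past iterations. Optimality gap. With $\mathrm{prox}_r^1(\mathbf v)=\arg\min_{\mathbf u}\frac12\|\mathbf v-\mathbf u\|^2+r(\mathbf u)$, $$Q(\mathbf x,\boldsymbol\lambda)=\|\mathbf x-\mathrm{prox}_r^1(\mathbf x-\nabla f(\mathbf x)-\mathbf A^\top\boldsymbol\lambda)\|^2+\|\mathbf A\mathbf x\|^2 .$$ Potential. $L_c(\mathbf x,\mathbf z;\boldsymbol\lambda)=f(\mathbf x)+r(\mathbf x)+\langle\boldsymbol\lambda,\mathbf A\mathbf x\rangle+\frac c2\|\mathbf A\mathbf x\|^2+\frac\kappa2\|\mathbf x-\mathbf z\|^2$, $d(\mathbf z;\boldsymbol\lambda)=\min_{\mathbf x}L_c(\mathbf x,\mathbf z;\boldsymbol\lambda)$, $P(\mathbf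 z)=\min_{\mathbf A\mathbf x=0}\{f(\mathbf x)+r(\mathbf x)+\frac\kappa2\|\mathbf x-\mathbf z\|^2\}$, and $$\phi^k=L_c(\mathbf x^k,\mathbf z^k;\boldsymbol\lambda^k)+\tau\|\mathbf x^k-\mathbf x^{k-1}\|^2+2P(\mathbf z^k)-2d(\mathbf z^k;\boldsymbol\lambda^k).$$ *)

(* Defs.v *)
From HB Require Import structures.
From mathcomp Require Import all_boot all_order all_algebra.
From mathcomp Require Export mxtens.
From mathcomp Require Import all_classical all_reals all_analysis.

Set Implicit Arguments.
Unset Strict Implicit.
Unset Printing Implicit Defensive.

Import Order.TTheory GRing.Theory Num.Theory.
Import numFieldNormedType.Exports.

Local Open Scope classical_set_scope.
Local Open Scope ring_scope.

Section Euclidean.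
Context {R : realType} {p : nat}.
Implicit Types x y : 'cV[R]_p.

Definition dot x y : R := \sum_k x k 0 * y k 0.

(* The library norm `|x| of a matrix is the sup norm, hence this definition. *)
Definition enorm x : R := Num.sqrt (dot x x).

Definition grad (f : 'cV[R]_p -> R) x : 'cV[R]_p :=
  \col_k 'D_(delta_mx k 0) f x.

Definition proper_function (r : 'cV[R]_p -> \bar R) : Prop :=
  (forall x, r x != -oo%E) /\ (exists x, (r x < +oo)%E).

Definition epigraph (r : 'cV[R]_p -> \bar R) : set ('cV[R]_p * R) :=
  [set xy | (r xy.1 <= xy.2%:E)%E].

Definition closed_function (r : 'cV[R]_p -> \bar R) : Prop :=
  closed (epigraph r).

Definition econvex (r : 'cV[R]_p -> \bar R) : Prop :=
  forall (t : R) x y, 0 <= t <= 1 ->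
    (r (t *: x + (1 - t) *: y)%R <= t%:E * r x + (1 - t)%:E * r y)%E.

Definition argmin (F : 'cV[R]_p -> \bar R) : set 'cV[R]_p :=
  [set x | forall y, (F x <= F y)%E].

(* The minimizer exists and is unique when r is proper, closed and convex; the
   value 0 is a default that is never used in that case. *)
Definition prox (r : 'cV[R]_p -> \bar R) (v : 'cV[R]_p) : 'cV[R]_p :=
  xget 0 (argmin (fun u => ((2^-1 * enorm (v - u) ^+ 2)%:E + r u)%E)).

End Euclidean.

Section Graph.
Context {N : nat}.
Implicit Type e : rel 'I_N.

Definition connected_graph e : Prop :=
  [/\ symmetric e, irreflexive e & forall i j, connect e i j].

Definition degree e (i : 'I_N) : nat := #|[set j | e i j]%SET|.

Definition edges e : {set 'I_N * 'I_N} :=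
  [set ij | e ij.1 ij.2 & (ij.1 < ij.2)%N]%SET.

Definition incidence (R : realType) e : 'M[R]_(#|edges e|, N) :=
  \matrix_(l, i) (((enum_val l).1 == i)%:R - ((enum_val l).2 == i)%:R).

End Graph.

(* R^{Nn} is 'cV[R]_(N * n): its coordinate mxtens_index (i, k) is the k-th
   coordinate of the i-th block, the ordering for which *t is the Kronecker
   product. *)
Section Consensus.
Context {R : realType} {N n : nat}.

Definition block (x : 'cV[R]_(N * n)) (i : 'I_N) : 'cV[R]_n :=
  \col_k x (mxtens_index (i, k)) 0.

Definition stack (x_ : 'I_N -> 'cV[R]_n) : 'cV[R]_(N * n) :=
  \col_l x_ (mxtens_unindex l).1 (mxtens_unindex l).2 0.

Definition Amx (e : rel 'I_N) : 'M[R]_(#|edges e| * n, N * n) :=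
  incidence R e *t (1%:M : 'M[R]_n).

Definition Bmx (e : rel 'I_N) : 'M[R]_(#|edges e| * n, N * n) :=
  map_mx Num.norm (Amx e).

Definition fsum (f_ : 'I_N -> 'cV[R]_n -> R) (x : 'cV[R]_(N * n)) : R :=
  \sum_i f_ i (block x i).

Definition rsum (r_ : 'I_N -> 'cV[R]_n -> \bar R) (x : 'cV[R]_(N * n)) : \bar R :=
  (\sum_i r_ i (block x i))%E.

(* minimize f + r subject to A x = 0; "smooth" f_i means differentiable here, the
   continuity and Lipschitz properties of the gradient being assumption1 *)
Record consensus_problem (e : rel 'I_N) (f_ : 'I_N -> 'cV[R]_n -> R)
    (r_ : 'I_N -> 'cV[R]_n -> \bar R) : Prop := {
  cp_smooth : forall i x, differentiable (f_ i) x;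
  cp_proper : forall i, proper_function (r_ i);
  cp_closed : forall i, closed_function (r_ i);
  cp_convex : forall i, econvex (r_ i);
  cp_feasible : exists x, Amx e *m x = 0 /\ (rsum r_ x < +oo)%E }.

Record assumption1 (e : rel 'I_N) (L mu flow : R)
    (f_ : 'I_N -> 'cV[R]_n -> R) (r_ : 'I_N -> 'cV[R]_n -> \bar R) : Prop := {
  a1_differentiable : forall x, differentiable (fsum f_) x;
  a1_continuous : continuous (grad (fsum f_));
  a1_lipschitz : forall x y,
    enorm (grad (fsum f_) x - grad (fsum f_) y) <= L * enorm (x - y);
  a1_lower_curvature : forall x y,
    mu / 2 * enorm (x - y) ^+ 2 <=
    fsum f_ x - fsum f_ y - dot (grad (fsum f_) y) (x - y);
  a1_lower_bound : forall x, Amx e *m x = 0 ->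
    (flow%:E < (fsum f_ x)%:E + rsum r_ x)%E }.

Definition assumption2 (q : 'I_N -> nat) (Sx : forall i, 'M[R]_(q i, n))
    (Sy zeta : forall i, 'cV[R]_(q i)) (r_ : 'I_N -> 'cV[R]_n -> \bar R) : Prop :=
  forall i, epigraph (r_ i) =
    [set xy | forall l, zeta i l 0 <= (Sx i *m xy.1 + xy.2 *: Sy i) l 0].

Definition Qgap (e : rel 'I_N) (f_ : 'I_N -> 'cV[R]_n -> R)
    (r_ : 'I_N -> 'cV[R]_n -> \bar R)
    (x : 'cV[R]_(N * n)) (lambda : 'cV[R]_(#|edges e| * n)) : R :=
  enorm (x - prox (rsum r_) (x - grad (fsum f_) x - (Amx e)^T *m lambda)) ^+ 2
  + enorm (Amx e *m x) ^+ 2.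

Definition Lc (e : rel 'I_N) (f_ : 'I_N -> 'cV[R]_n -> R)
    (r_ : 'I_N -> 'cV[R]_n -> \bar R) (kappa c : R)
    (x z : 'cV[R]_(N * n)) (lambda : 'cV[R]_(#|edges e| * n)) : \bar R :=
  ((fsum f_ x + dot lambda (Amx e *m x) + c / 2 * enorm (Amx e *m x) ^+ 2
    + kappa / 2 * enorm (x - z) ^+ 2)%:E + rsum r_ x)%E.

(* The minimum values of L_c(., z; lambda) and of the constrained proximal
   problem; both are attained when kappa > - mu, so the infimum is the minimum. *)
Definition dual_value (e : rel 'I_N) (f_ : 'I_N -> 'cV[R]_n -> R)
    (r_ : 'I_N -> 'cV[R]_n -> \bar R) (kappa c : R)
    (z : 'cV[R]_(N * n)) (lambda : 'cV[R]_(#|edges e| * n)) : \bar R :=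
  ereal_inf [set Lc f_ r_ kappa c x z lambda | x in setT].

Definition primal_value (e : rel 'I_N) (f_ : 'I_N -> 'cV[R]_n -> R)
    (r_ : 'I_N -> 'cV[R]_n -> \bar R) (kappa : R)
    (z : 'cV[R]_(N * n)) : \bar R :=
  ereal_inf [set ((fsum f_ x + kappa / 2 * enorm (x - z) ^+ 2)%:E + rsum r_ x)%E
            | x in [set x | Amx e *m x = 0]].

(* xprev is the iterate preceding x *)
Definition potential (e : rel 'I_N) (f_ : 'I_N -> 'cV[R]_n -> R)
    (r_ : 'I_N -> 'cV[R]_n -> \bar R) (kappa c tau : R)
    (x xprev z : 'cV[R]_(N * n)) (lambda : 'cV[R]_(#|edges e| * n)) : \bar R :=
  (Lc f_ r_ kappa c x z lambda + (tau * enorm (x - xprev) ^+ 2)%:E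
   + 2%:E * primal_value e f_ r_ kappa z
   - 2%:E * dual_value f_ r_ kappa c z lambda)%E.

Definition initial_potential (e : rel 'I_N) (f_ : 'I_N -> 'cV[R]_n -> R)
    (r_ : 'I_N -> 'cV[R]_n -> \bar R) (kappa c tau alpha : R)
    (x0 : 'cV[R]_(N * n)) : \bar R :=
  potential f_ r_ kappa c tau x0 x0 x0 (- alpha *: (Amx e *m x0)).

Definition sppdm_objective (e : rel 'I_N) (f_ : 'I_N -> 'cV[R]_n -> R)
    (r_ : 'I_N -> 'cV[R]_n -> \bar R) (gamma c kappa : R)
    (g s xk zk : 'cV[R]_(N * n)) (lambda : 'cV[R]_(#|edges e| * n))
    (x : 'cV[R]_(N * n)) : \bar R :=
  ((fsum f_ s + dot g (x - s) + gamma / 2 * enorm (x - s) ^+ 2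
    + dot lambda (Amx e *m x) + c / 2 * enorm (Amx e *m x) ^+ 2
    + c / 2 * enorm (Bmx e *m (x - xk)) ^+ 2
    + kappa / 2 * enorm (x - zk) ^+ 2)%:E + rsum r_ x)%E.

End Consensus.

Notation borel_cV R p := (g_sigma_algebraType (@open 'cV[R]_p)).

(* Joint measurability is what makes G_i(s, xi) a random vector when the point s
   is itself random. *)
Record assumption3 (R : realType) (N n : nat) (f_ : 'I_N -> 'cV[R]_n -> R)
    (dX : 'I_N -> measure_display) (X : forall i, measurableType (dX i))
    (D : forall i, probability (X i) R)
    (G : forall i, 'cV[R]_n -> X i -> 'cV[R]_n) (sigma : R) : Prop := {
  a3_measurable : forall i k,
    measurable_fun setT (fun v : borel_cV R n * X i => G i v.1 v.2 k 0);
  a3_unbiased : forall i x k,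
    'E_(D i)[fun y => (G i x y k 0)%R]%E = (grad (f_ i) x k 0)%:E;
  a3_variance : forall i x,
    ('E_(D i)[fun y => (enorm (G i x y - grad (f_ i) x) ^+ 2)%R]
     <= (sigma ^+ 2)%:E)%E }.

Section Independence.
Context {R : realType} {d : measure_display} {T : measurableType d}.

Definition mutually_independent (P : probability T R) (I : choiceType)
    (F : I -> set (set T)) : Prop :=
  forall (J : seq I) (E : I -> set T), uniq J ->
    (forall i, i \in J -> F i (E i)) ->
    P (\bigcap_(i in [set` J]) E i) = (\prod_(i <- J) fine (P (E i)))%:E.

(* sigma-algebra generated by x^0, ..., x^k; the SPPDM iterates z^t and
   lambda^t, t <= k, are deterministic affine functions of these. *)
Definition past (p : nat) (x : nat -> T -> 'cV[R]_p) (k : nat) : set (set T) :=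
  <<s [set E | exists t U, [/\ (t <= k)%N, open U & E = x t @^-1` U]] >>.

End Independence.

Section SPPDM.
Context {R : realType} {N n : nat} (e : rel 'I_N).
Context (f_ : 'I_N -> 'cV[R]_n -> R) (r_ : 'I_N -> 'cV[R]_n -> \bar R).
Context {dX : 'I_N -> measure_display} {X : forall i, measurableType (dX i)}.
Context (D : forall i, probability (X i) R).
Context (G : forall i, 'cV[R]_n -> X i -> 'cV[R]_n).
Context (alpha beta gamma c kappa : R) (eta : nat -> R) (m : nat).
Context {d : measure_display} {T : measurableType d} (P : probability T R).
Context (xi : nat -> forall i, 'I_m -> {RV P >-> X i}).

Definition minibatch (k : nat) (s : 'cV[R]_(N * n)) (w : T) : 'cV[R]_(N * n) :=
  stack (fun i => m%:R^-1 *: \sum_(j < m) G (block s i) (xi k i j w)).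

(* s^k; the natural number 0.-1 = 0 encodes the convention x^{-1} = x^0. *)
Definition extrapolation (x : nat -> T -> 'cV[R]_(N * n)) (k : nat) (w : T)
    : 'cV[R]_(N * n) :=
  x k w + eta k *: (x k w - x k.-1 w).

Definition sampling_systems (x : nat -> T -> 'cV[R]_(N * n)) (k : nat)
    (o : option ('I_N * 'I_m)) : set (set T) :=
  if o is Some ij then
    preimage_set_system setT (xi k ij.1 ij.2 : T -> X ij.1) measurable
  else past x k.

Record sppdm (x0 : 'cV[R]_(N * n)) (x z : nat -> T -> 'cV[R]_(N * n))
    (lambda : nat -> T -> 'cV[R]_(#|edges e| * n)) : Prop := {
  sppdm_x0_dom : (rsum r_ x0 < +oo)%E;
  sppdm_x0 : forall w, x 0%N w = x0;
  sppdm_z0 : forall w, z 0%N w = x0;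
  sppdm_lambda0 : forall w, lambda 0%N w = - alpha *: (Amx e *m x0);
  sppdm_lambda : forall k w,
    lambda k.+1 w = lambda k w + alpha *: (Amx e *m x k w);
  sppdm_x : forall k w,
    argmin (sppdm_objective f_ r_ gamma c kappa
              (minibatch k (extrapolation x k w) w) (extrapolation x k w)
              (x k w) (z k w) (lambda k.+1 w)) (x k.+1 w);
  sppdm_z : forall k w,
    z k.+1 w = z k w + beta *: (x k.+1 w - z k w);
  sppdm_distribution : forall k i (j : 'I_m) U, measurable U ->
    distribution P (xi k i j) U = D i U;
  sppdm_independent : forall k, mutually_independent P (sampling_systems x k) }.

End SPPDM.

(* Main.v *)
Require Import Defs.
From mathcomp Require Import all_boot all_order all_algebra.
From mathcomp Require Import all_classical all_reals all_analysis.
From mathcomp Require Import measurable_realfun.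
From mathcomp Require Import ring lra.

Set Implicit Arguments.
Unset Strict Implicit.
Unset Printing Implicit Defensive.

Import Order.TTheory GRing.Theory Num.Theory.
Import numFieldNormedType.Exports.

Local Open Scope classical_set_scope.
Local Open Scope ring_scope.

(** The potential decreases along every realization of the algorithm, except for
    a multiple of the squared error of the stochastic gradient, and its decrease
    dominates the optimality gap:
      gap_k <= C0 (phi_k - phi_(k+1) + C1 |error_k|^2)          ([gap_descent]).
    The potential is bounded below by [flow] (weak duality, [lyapunov_ge]), so the
    gaps of the first K iterations sum to at most C0 (phi_0 - flow) plus
    C0 C1 times the sum of the squared errors ([path_gap_sum]). A minibatch of
    size m has a mean squared error of at most N sigma^2 / m
    ([minibatch_variance]). The conditions on m and K make each of the two
    contributions at most K eps / 2, so the mean of the K expected gaps, hence the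
    smallest of them, is at most eps.

    Descent. Three estimates are added. The proximal step decreases the augmented
    Lagrangian by (gamma + kappa + 2c)/2 |x' - x|^2, the term in c coming from
    A^T A + B^T B >= 2; this pays for the momentum ([primal_descent]). The
    multiplier step increases the Lagrangian by alpha |A x|^2 and the dual value by
    at least alpha <A x, A xh>, where xh minimizes the Lagrangian; since the
    potential counts the dual value twice, the balance is
    alpha |A (x - xh)|^2 - alpha |A xh|^2, and strong convexity bounds the first
    term by the step, the momentum and the gradient error ([values_change],
    [constraint_error]). The step of the center z gains a multiple of
    beta |x' - z|^2 and loses 2 kappa <z' - z, xh' - xs>, where xs is the
    constrained minimizer; for small beta the loss is absorbed, provided that
    |xh - xs| <= Ce |A xh| ([cross_term_le], [lyapunov_descent]).

    The error bound. This last estimate is where the polyhedra enter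
    ([fiber_error_bound]): xh and xs minimize the same strongly convex function
    over two fibers of A, and the minimizer is a Lipschitz function of the fiber.
    A gradient step reduces this to the projection of a fixed point onto a fiber
    inside the polyhedral domain, that is, to a quadratic program with a varying
    right-hand side, whose solution is Lipschitz with a constant determined by the
    matrices alone ([qp_lipschitz]): along a segment of right-hand sides only
    finitely many active sets occur, each with a linear bound.

    Smoothness and the lower curvature bound contradict each other when L < mu,
    except in dimension zero, where the gap vanishes; otherwise mu <= L, as the
    estimates above require.

    Expectations. The next iterate is a Lipschitz function of the current state
    and of the stochastic gradient, so that all iterates are measurable
    ([sppdm_measurable]); the samples of an iteration are independent of each
    other and of the extrapolated point, so the cross terms in the square of the
    minibatch error have zero mean ([sum_variance_le]). *)

(** * Euclidean geometry *)

Ltac vector_ring := apply/matrixP => ? ?; rewrite !mxE; ring.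

Section EuclideanTheory.
Context {R : realType} {p : nat}.
Implicit Types (x y z : 'cV[R]_p) (a : R).

Lemma dotC x y : dot x y = dot y x.
Proof. by apply: eq_bigr => k _; rewrite mulrC. Qed.

Lemma dotDl x y z : dot (x + y) z = dot x z + dot y z.
Proof. by rewrite -big_split; apply: eq_bigr => k _; rewrite mxE mulrDl. Qed.

Lemma dotZl a x z : dot (a *: x) z = a * dot x z.
Proof. by rewrite big_distrr; apply: eq_bigr => k _; rewrite mxE /= mulrA. Qed.

Lemma dotNl x z : dot (- x) z = - dot x z.
Proof. by rewrite -scaleN1r dotZl mulN1r. Qed.

Lemma dotDr x y z : dot z (x + y) = dot z x + dot z y.
Proof. by rewrite dotC dotDl !(dotC z). Qed.

Lemma dotZr a x z : dot z (a *: x) = a * dot z x.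
Proof. by rewrite dotC dotZl (dotC z). Qed.

Lemma dotNr x z : dot z (- x) = - dot z x.
Proof. by rewrite dotC dotNl (dotC z). Qed.

Lemma dot0l x : dot 0 x = 0.
Proof. by rewrite -(scale0r x) dotZl mul0r. Qed.

Lemma dot0r x : dot x 0 = 0.
Proof. by rewrite dotC dot0l. Qed.

Definition dotE := (dotDl, dotDr, dotNl, dotNr, dotZl, dotZr).

Lemma dot_ge0 x : 0 <= dot x x.
Proof. by apply: sumr_ge0 => k _; rewrite -expr2 sqr_ge0. Qed.

Lemma dot_eq0 x : dot x x = 0 -> x = 0.
Proof.
move=> x0; apply/matrixP => k j; rewrite (ord1 j) mxE.
have /(_ k isT) := psumr_eq0P (fun i _ => sqr_ge0 (x i 0)) x0.
by move=> /eqP; rewrite sqrf_eq0 => /eqP.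
Qed.

Lemma enorm_ge0 x : 0 <= enorm x.
Proof. exact: sqrtr_ge0. Qed.

Lemma enorm_sq x : enorm x ^+ 2 = dot x x.
Proof. by rewrite sqr_sqrtr ?dot_ge0. Qed.

Lemma enorm0 : enorm (0 : 'cV[R]_p) = 0.
Proof. by rewrite /enorm dot0l sqrtr0. Qed.

Lemma enormZ a x : enorm (a *: x) = `|a| * enorm x.
Proof. by rewrite /enorm dotZl dotZr mulrA -expr2 sqrtrM ?sqr_ge0 // sqrtr_sqr. Qed.

Lemma enormN x : enorm (- x) = enorm x.
Proof. by rewrite /enorm dotNl dotNr opprK. Qed.

Lemma enormBC x y : enorm (x - y) = enorm (y - x).
Proof. by rewrite -enormN opprB. Qed.

Lemma enorm_le a x : 0 <= a -> (enorm x <= a) = (dot x x <= a ^+ 2).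
Proof. by move=> a0; rewrite -enorm_sq ler_pXn2r ?nnegrE ?enorm_ge0. Qed.

Lemma enorm_eq0 x : enorm x = 0 -> x = 0.
Proof. by move=> x0; apply: dot_eq0; rewrite -enorm_sq x0 expr0n. Qed.

Lemma dot_young a x y : 0 < a -> dot x y <= a / 2 * dot x x + (2 * a)^-1 * dot y y.
Proof.
move=> a0; have := dot_ge0 (a *: x - y); rewrite !dotE (dotC y x) => h.
rewrite -(@ler_pM2l _ (2 * a)) ?mulr_gt0 // mulrDr !mulrA mulfV ?mulf_neq0 ?gt_eqF //.
lra.
Qed.

Lemma dot_le x y : dot x y <= enorm x * enorm y.
Proof.
have [/enorm_eq0 ->|x0] := eqVneq (enorm x) 0; first by rewrite enorm0 dot0l mul0r.
have [/enorm_eq0 ->|y0] := eqVneq (enorm y) 0; first by rewrite enorm0 dot0r mulr0.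
have {}x0 : 0 < enorm x by rewrite lt_def x0 enorm_ge0.
have {}y0 : 0 < enorm y by rewrite lt_def y0 enorm_ge0.
have := @dot_young (enorm y / enorm x) x y (divr_gt0 y0 x0).
rewrite -!enorm_sq => /le_trans; apply.
rewrite le_eqVlt; apply/orP; left; apply/eqP; field.
by rewrite ?gt_eqF.
Qed.

Lemma dot_ge x y : - (enorm x * enorm y) <= dot x y.
Proof. by rewrite lerNl -dotNl -(enormN x) dot_le. Qed.

Lemma enormD x y : enorm (x + y) <= enorm x + enorm y.
Proof.
rewrite enorm_le ?addr_ge0 ?enorm_ge0 // !dotE sqrrD !enorm_sq (dotC y x).
by have := dot_le x y; lra.
Qed.

Lemma enormB x y : enorm (x - y) <= enorm x + enorm y.
Proof. by rewrite -(enormN y) enormD. Qed.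

Lemma enorm_dist x y z : enorm (x - z) <= enorm (x - y) + enorm (y - z).
Proof. by rewrite -[x - z](subrKA y) enormD. Qed.

Lemma coord_le_enorm x k : `|x k 0| <= enorm x.
Proof.
rewrite -ler_sqr ?nnegrE ?enorm_ge0 ?normr_ge0 // enorm_sq real_normK ?num_real //.
rewrite /dot (bigD1 k) //= -expr2 lerDl.
by apply: sumr_ge0 => j _; rewrite -expr2 sqr_ge0.
Qed.

Lemma enorm_le_sum x : enorm x <= \sum_k `|x k 0|.
Proof.
have h : 0 <= \sum_k `|x k 0| by apply: sumr_ge0.
rewrite enorm_le // expr2 mulr_suml; apply: ler_sum => k _.
rewrite -expr2 -[x k 0 ^+ 2]real_normK ?num_real // expr2 ler_wpM2l //.
by rewrite (bigD1 k) //= lerDl; apply: sumr_ge0.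
Qed.

End EuclideanTheory.

Section EuclideanMatrix.
Context {R : realType}.

Lemma dot_mulmx p q (M : 'M[R]_(p, q)) x y : dot (M *m x) y = dot x (M^T *m y).
Proof.
rewrite /dot.
under eq_bigr do rewrite mxE mulr_suml.
rewrite exchange_big /=; apply: eq_bigr => k _.
by rewrite mxE mulr_sumr; apply: eq_bigr => j _; rewrite mxE; ring.
Qed.

Lemma dot_mulmxr p q (M : 'M[R]_(p, q)) x y : dot x (M *m y) = dot (M^T *m x) y.
Proof. by rewrite dotC dot_mulmx dotC. Qed.

Lemma mulmx_bounded p q (M : 'M[R]_(p, q)) :
  exists2 C, 0 <= C & forall x, enorm (M *m x) <= C * enorm x.
Proof.
exists (\sum_i \sum_j `|M i j|) => [|x]; first by apply: sumr_ge0 => i _; apply: sumr_ge0.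
apply: le_trans (enorm_le_sum _) _; rewrite mulr_suml; apply: ler_sum => i _.
rewrite mxE mulr_suml; apply: le_trans (ler_norm_sum _ _ _) _.
apply: ler_sum => j _; rewrite normrM ler_wpM2l // coord_le_enorm //.
Qed.

(** Completeness for the Euclidean norm, deduced from that of the coordinates. *)
Lemma ecauchy_cvg p (u : nat -> 'cV[R]_p) :
  (forall eps : R, 0 < eps -> exists n0, forall i j, (n0 <= i)%N -> (n0 <= j)%N ->
     enorm (u i - u j) <= eps) ->
  exists l, forall eps : R, 0 < eps -> exists n0, forall i, (n0 <= i)%N ->
    enorm (u i - l) <= eps.
Proof.
move=> uC.
have cv k : cvgn (fun i => u i k 0).
  apply/cauchy_cvgP/cauchy_exP => eps eps0.
  have [n0 un0] := uC (eps / 2) (divr_gt0 eps0 (ltr0n _ 2)).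
  exists (u n0 k 0); exists n0 => // i /= n0i.
  have := coord_le_enorm (u n0 - u i) k; rewrite !mxE /= => /le_lt_trans; apply.
  by apply: le_lt_trans (un0 _ _ (leqnn _) n0i) _; lra.
exists (\col_k limn (fun i => u i k 0)) => eps eps0.
have p0 : 0 < p.+1%:R :> R by rewrite ltr0n.
have near k : exists n0, forall i, (n0 <= i)%N ->
    `|u i k 0 - limn (fun i => u i k 0)| <= eps / p.+1%:R.
  have /cvgrPdist_le/(_ (eps / p.+1%:R) (divr_gt0 eps0 p0)) [n0 _ un0] := cv k.
  by exists n0 => i n0i; rewrite distrC; apply: un0.
have [n_ un_] := choice near.
exists (\max_k n_ k) => i ni; apply: le_trans (enorm_le_sum _) _.
apply: le_trans (_ : \sum_(k < p) eps / p.+1%:R <= _).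
  apply: ler_sum => k _; rewrite !mxE; apply: un_.
  exact: leq_trans (leq_bigmax k) ni.
rewrite sumr_const card_ord -[_ *+ p]mulr_natr mulrAC ler_pdivrMr // ler_wpM2l ?ler_nat //.
exact: ltW.
Qed.

End EuclideanMatrix.

(** * Composite objectives *)

(** The two quadratic bounds are what smoothness and (weak, if [m < 0]) convexity
    amount to in the analysis of a first-order method; [dh] is the gradient. *)
Definition curved {R : realType} {p} (h : 'cV[R]_p -> R)
    (dh : 'cV[R]_p -> 'cV[R]_p) (m M : R) :=
  forall x y,
    h y + dot (dh y) (x - y) + m / 2 * dot (x - y) (x - y) <= h x <=
    h y + dot (dh y) (x - y) + M / 2 * dot (x - y) (x - y).

Definition eclosed {R : realType} {p} (C : set 'cV[R]_p) :=
  forall x, (forall eps : R, 0 < eps -> exists2 y, C y & enorm (x - y) <= eps) -> C x.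

(** A convex function [rho] on a domain [C], outside which it is understood to be
    infinite. Polyhedrality provides Lipschitz continuity on the domain, which is
    used in place of lower semicontinuity. *)
Record convex_part {R : realType} {p} (C : set 'cV[R]_p) (rho : 'cV[R]_p -> R)
    : Prop := {
  cvx_nonempty : C !=set0;
  cvx_closed : eclosed C;
  cvx_dom : forall t x y, 0 <= t <= 1 -> C x -> C y -> C (t *: x + (1 - t) *: y);
  cvx_fun : forall t x y, 0 <= t <= 1 -> C x -> C y ->
    rho (t *: x + (1 - t) *: y) <= t * rho x + (1 - t) * rho y;
  cvx_lipschitz : exists2 l, 0 <= l & forall x y, C x -> C y ->
    rho x - rho y <= l * enorm (x - y) }.

(** [- v] is a subgradient of [rho] at [x], that is, [x] minimizes
    [<v, .> + rho]. *)
Definition critical {R : realType} {p} (C : set 'cV[R]_p) (rho : 'cV[R]_p -> R)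
    (v x : 'cV[R]_p) :=
  C x /\ forall u, C u -> 0 <= dot v (u - x) + rho u - rho x.

Section Curved.
Context {R : realType} {p : nat}.
Implicit Types (x y z v : 'cV[R]_p) (h : 'cV[R]_p -> R).

Lemma curvedD h1 dh1 m1 M1 h2 dh2 m2 M2 :
  curved h1 dh1 m1 M1 -> curved h2 dh2 m2 M2 ->
  curved (fun x => h1 x + h2 x) (fun x => dh1 x + dh2 x) (m1 + m2) (M1 + M2).
Proof.
move=> H1 H2 x y; have /andP[a b] := H1 x y; have /andP[a' b'] := H2 x y.
by rewrite dotDl; apply/andP; split; lra.
Qed.

Lemma curved_sq k z :
  curved (fun x => k / 2 * dot (x - z) (x - z)) (fun x => k *: (x - z)) k k.
Proof.
move=> x y; rewrite !dotE (dotC z x) (dotC z y) (dotC x y).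
by apply/andP; split; lra.
Qed.

Lemma curved_monotone h dh m M x y : curved h dh m M ->
  m * dot (x - y) (x - y) <= dot (dh x - dh y) (x - y).
Proof.
move=> H; have /andP[a _] := H x y; have /andP[b _] := H y x.
by move: a b; rewrite !dotE; lra.
Qed.

End Curved.

Section Critical.
Context {R : realType} {p : nat} {C : set 'cV[R]_p} {rho : 'cV[R]_p -> R}.
Implicit Types (x y z v : 'cV[R]_p) (h : 'cV[R]_p -> R).

Lemma critical_monotone v1 v2 x1 x2 :
  critical C rho v1 x1 -> critical C rho v2 x2 -> dot (v1 - v2) (x1 - x2) <= 0.
Proof.
move=> [C1 o1] [C2 o2]; have := o1 _ C2; have := o2 _ C1.
by rewrite !dotE; lra.
Qed.

(** Quadratic growth away from a minimizer. *)
Lemma critical_growth h dh m M x u :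
  curved h dh m M -> critical C rho (dh x) x -> C u ->
  h x + rho x + m / 2 * dot (u - x) (u - x) <= h u + rho u.
Proof. by move=> H [_ o] Cu; have := o _ Cu; have /andP[+ _] := H u x; lra. Qed.

Hypothesis cvx : convex_part C rho.

(** Moving from a minimizer [x] towards [u] by a fraction [t] changes the
    objective by at most [t * a + t^2 * b], where [a] is the quantity to be shown
    nonnegative. *)
Lemma minimizer_critical h dh m M x :
  curved h dh m M -> C x -> (forall u, C u -> h x + rho x <= h u + rho u) ->
  critical C rho (dh x) x.
Proof.
move=> H Cx xmin; split=> // u Cu; rewrite leNgt; apply/negP => neg.
set a := (X in X < 0) in neg; pose b := `|M| / 2 * dot (u - x) (u - x) + 1.
have b1 : 1 <= b by rewrite lerDr mulr_ge0 ?dot_ge0 ?divr_ge0 ?normr_ge0.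
pose t := Num.min 1 (- a / (2 * b)).
have t0 : 0 < t by rewrite lt_min ltr01 divr_gt0 ?oppr_gt0 ?mulr_gt0 //; lra.
have t1 : t <= 1 by rewrite ge_min lexx.
have tb : t * b <= - a / 2.
  rewrite (le_trans (_ : _ <= - a / (2 * b) * b)) ?ler_wpM2r ?ge_min ?lexx ?orbT //; first lra.
  by rewrite le_eqVlt; apply/orP; left; apply/eqP; field; lra.
have t01 : 0 <= t <= 1 by rewrite t1 ltW.
have := xmin _ (cvx_dom cvx t01 Cu Cx); have := cvx_fun cvx t01 Cu Cx.
have /andP[_ ] := H (t *: u + (1 - t) *: x) x.
have -> : t *: u + (1 - t) *: x - x = t *: (u - x).
  by rewrite scalerBl scale1r scalerBr addrA addrAC addrK.
rewrite dotZl !dotZr => h1 h2 h3.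
have h4 : M / 2 * (t * (t * dot (u - x) (u - x))) <= t * (t * (b - 1)).
  have D0 : 0 <= t * t * dot (u - x) (u - x) by rewrite !mulr_ge0 ?dot_ge0 // ltW.
  by have := ler_wpM2r D0 (ler_norm M); rewrite /b; lra.
have : 0 <= t * (a + t * b) by move: h1 h2 h3 h4; rewrite /a; nra.
by rewrite pmulr_rge0 //; lra.
Qed.

(** Strong convexity makes a minimizing sequence a Cauchy sequence. *)
Lemma critical_exists h dh m M : curved h dh m M -> 0 < m ->
  exists x, critical C rho (dh x) x.
Proof.
move=> H m0; pose F x := h x + rho x.
suff [x Cx xmin] : exists2 x, C x & forall u, C u -> F x <= F u.
  by exists x; apply: minimizer_critical H Cx xmin.
have [l l0 lip] := cvx_lipschitz cvx.
(* With [x = x0] a lower bound of the objective; with [y] close to [x] its lower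
   semicontinuity on the domain. *)
have Flow x y : C x -> C y ->
    F x <= F y + (enorm (dh x) + l) * enorm (y - x) - m / 2 * enorm (y - x) ^+ 2.
  move=> Cx Cy; have /andP[+ _] := H y x; have := lip _ _ Cx Cy.
  have := dot_ge (dh x) (y - x); rewrite (enormBC x y) enorm_sq /F.
  by rewrite mulrDl; lra.
have Fmid x y : C x -> C y ->
    F (2^-1 *: x + (1 - 2^-1) *: y) <= (F x + F y) / 2 - m / 8 * dot (x - y) (x - y).
  move=> Cx Cy; set w := (X in F X <= _).
  have half : 0 <= (2^-1 : R) <= 1 by lra.
  have := cvx_fun cvx half Cx Cy; rewrite -/w.
  have /andP[+ _] := H x w; have /andP[+ _] := H y w; rewrite /F.
  have -> : x - w = 2^-1 *: (x - y).
    by rewrite /w; apply/matrixP => i j; rewrite !mxE; field.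
  have -> : y - w = - (2^-1 *: (x - y)).
    by rewrite /w; apply/matrixP => i j; rewrite !mxE; field.
  by rewrite !(dotNl, dotNr, dotZl, dotZr); lra.
have [x0 Cx0] := cvx_nonempty cvx.
pose S := F @` C.
have S_inf : has_inf S.
  split; first by exists (F x0); exists x0.
  exists (F x0 - (enorm (dh x0) + l) ^+ 2 / (2 * m)) => _ [y Cy <-].
  have := Flow _ _ Cx0 Cy; set a := _ + l; set b := enorm (y - x0) => h1.
  have : 0 <= m / 2 * (b - a / m) ^+ 2 by rewrite mulr_ge0 ?sqr_ge0 // divr_ge0 // ltW.
  have -> : m / 2 * (b - a / m) ^+ 2 = m / 2 * b ^+ 2 - a * b + a ^+ 2 / (2 * m).
    by field; lra.
  lra.
have infle u : C u -> inf S <= F u.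
  by move=> Cu; apply: ge_inf; [exact: S_inf.2 | exists u].
have near n : exists x, C x /\ F x <= inf S + n.+1%:R^-1.
  have n0 : 0 < n.+1%:R^-1 :> R by rewrite invr_gt0.
  have [_ [x Cx <-] xinf] := inf_adherent n0 S_inf.
  by exists x; split=> //; apply: ltW.
have [u uP] := choice near.
have half : 0 <= (2^-1 : R) <= 1 by lra.
have inv_le n0 i : (n0 <= i)%N -> i.+1%:R^-1 <= n0.+1%:R^-1 :> R.
  by move=> ni; rewrite lef_pV2 ?posrE // ler_nat.
have [eps eps0|x xlim] := @ecauchy_cvg R p u.
  have e0 : 0 < m / 8 * eps ^+ 2 by rewrite mulr_gt0 ?exprn_gt0 ?divr_gt0.
  have [n0 n0P] : exists n0, n0.+1%:R^-1 <= m / 8 * eps ^+ 2 :> R.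
    have [n0 _ /(_ _ (leqnn _)) h1] := near_infty_natSinv_lt (PosNum e0).
    by exists n0; apply: ltW.
  exists n0 => i j ni nj; rewrite enorm_le ?(ltW eps0) //.
  have [[Ci ui] [Cj uj]] := (uP i, uP j).
  have := le_trans (infle _ (cvx_dom cvx half Ci Cj)) (Fmid _ _ Ci Cj).
  have := le_trans (inv_le _ _ ni) n0P; have := le_trans (inv_le _ _ nj) n0P.
  move: ui uj; set a := i.+1%:R^-1; set b := j.+1%:R^-1 => h1 h2 h3 h4 h5.
  by rewrite -(@ler_pM2l _ (m / 8)) ?divr_gt0 //; lra.
have Cx : C x.
  apply: (cvx_closed cvx) => eps /xlim [n0 /(_ _ (leqnn _)) h1].
  by exists (u n0); [exact: (uP n0).1 | rewrite enormBC].
exists x => // y Cy; apply: le_trans (infle _ Cy).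
apply/ler_addgt0Pr => eps eps0.
pose a := enorm (dh x) + l + 1.
have a0 : 0 < a by rewrite ltr_wpDl // addr_ge0 // enorm_ge0.
have e2 : 0 < eps / 2 by lra.
have [n0 _ /(_ _ (leqnn _)) /= h0] := near_infty_natSinv_lt (PosNum e2).
have [n1 /(_ (maxn n0 n1) (leq_maxr _ _)) h1] := xlim _ (divr_gt0 e2 a0).
have [Cn un] := uP (maxn n0 n1); have := Flow _ _ Cx Cn.
have {}un : F (u (maxn n0 n1)) <= inf S + eps / 2.
  by rewrite (le_trans un) // lerD2l (le_trans (inv_le _ _ (leq_maxl n0 n1))) // ltW.
set b := enorm (u _ - x) in h1 *; have b0 : 0 <= b by apply: enorm_ge0.
have : a * b <= eps / 2 by rewrite mulrC -ler_pdivlMr.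
have : 0 <= m / 2 * b ^+ 2 by rewrite mulr_ge0 ?sqr_ge0 ?divr_ge0 // ltW.
by move: un; rewrite /a; lra.
Qed.

End Critical.

(** * Parametric quadratic programs *)

Section FiniteCovers.
Context {R : realType}.

Lemma ler_addeps (a b D : R) : 0 <= D ->
  (forall eps : R, 0 < eps -> a <= b + D * eps) -> a <= b.
Proof.
move=> D0 h; apply/ler_addgt0Pr => eps eps0.
have D1 : 0 < D + 1 by lra.
apply: le_trans (h (eps / (D + 1)) (divr_gt0 eps0 D1)) _.
by rewrite lerD2l mulrCA ler_piMr ?(ltW eps0) // ler_pdivrMr //; lra.
Qed.

Lemma finite_pos_lower (I : finType) (e : I -> R) : (forall i, 0 < e i) ->
  exists2 d, 0 < d & forall i, d <= e i.
Proof.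
move=> e0; have s0 (A : pred I) : 0 <= \sum_(i | A i) (e i)^-1.
  by apply: sumr_ge0 => i _; rewrite invr_ge0 ltW.
exists (1 + \sum_i (e i)^-1)^-1 => [|i]; first by rewrite invr_gt0 ltr_pwDl.
rewrite -[leRHS]invrK lef_pV2 ?posrE ?invr_gt0 ?ltr_pwDl //.
by rewrite (bigD1 i) //=; have := s0 (fun j => j != i); lra.
Qed.

Definition adherent (S : set R) (s : R) :=
  forall eps : R, 0 < eps -> exists2 t, S t & `|t - s| <= eps.

Lemma finite_accumulation (I : finType) (S : set R) (idx : R -> I) s :
  adherent S s -> exists i, adherent (S `&` [set t | idx t = i]) s.
Proof.
move=> acc; apply: contrapT => none.
have far i : exists e : R, 0 < e /\ forall t, S t -> idx t = i -> e < `|t - s|.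
  apply: contrapT => noe; apply: none; exists i => eps eps0.
  apply: contrapT => not; apply: noe; exists eps; split=> // t St ti.
  by rewrite ltNge; apply/negP => ts; apply: not; exists t.
have [e eP] := choice far.
have [d d0 de] := finite_pos_lower (fun i => (eP i).1).
have [t St ts] := acc _ d0; have := (eP (idx t)).2 t St erefl.
by rewrite ltNge (le_trans ts (de _)).
Qed.

Lemma adherentS (S S' : set R) s : S `<=` S' -> adherent S s -> adherent S' s.
Proof. by move=> SS' acc eps /acc[t /SS']; exists t. Qed.

(** A function on [0, 1] that is Lipschitz on the closure of each of finitely
    many sets covering [0, 1] is Lipschitz: the supremum of the points [t]
    satisfying the estimate between [0] and [t] belongs to them, and cannot be
    less than [1] since some set is adherent to it from the right. *)
Lemma lipschitz_of_finite_cover p (I : finType) (f : R -> 'cV[R]_p)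
    (idx : R -> I) (K : R) : 0 <= K ->
  (forall (t0 : R) i, 0 <= t0 <= 1 ->
     adherent [set t | 0 <= t <= 1 /\ idx t = i] t0 ->
     forall t : R, 0 <= t <= 1 -> idx t = i ->
       enorm (f t - f t0) <= K * `|t - t0|) ->
  enorm (f 1 - f 0) <= K.
Proof.
move=> K0 loc; pose T := [set t : R | 0 <= t <= 1 /\ enorm (f t - f 0) <= K * t].
have T0 : T 0 by split; [lra | rewrite subrr enorm0 mulr0].
have supT : has_sup T.
  by split; [exists 0 | exists 1 => t [/andP[_ t1] _]].
pose s := sup T.
have leS t : T t -> t <= s by move=> Tt; apply: ub_le_sup => //; exact: supT.2.
have s01 : 0 <= s <= 1.
  by rewrite leS //= ge_sup //; [exists 0 | move=> t [/andP[_ t1] _]].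
have [i iT] : exists i, adherent (T `&` [set t | idx t = i]) s.
  apply: finite_accumulation => eps eps0.
  have [t Tt ts] := sup_adherent eps0 supT; exists t => //.
  by have := leS _ Tt; rewrite -/s in ts; rewrite ler_norml; lra.
have Ts : T s.
  split=> //; apply: (@ler_addeps _ _ K) => // eps eps0.
  have [t [Tt ti] ts] := iT _ eps0; have ts' := leS _ Tt; case: Tt => t01 Tt.
  have /(_ t t01 ti) : forall t : R, 0 <= t <= 1 -> idx t = i ->
      enorm (f t - f s) <= K * `|t - s|.
    by apply: loc => //; apply: adherentS iT => u [[]].
  rewrite enormBC distrC ger0_norm ?subr_ge0 //.
  have := enorm_dist (f s) (f t) (f 0).
  have : 0 <= K * eps by rewrite mulr_ge0 // ltW.
  lra.
have [s1|s1] := eqVneq s 1; first by have := Ts.2; rewrite s1 mulr1.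
have {}s1 : s < 1 by rewrite lt_def eq_sym s1; case/andP: s01.
have [j jP] : exists j, adherent ([set t | s < t <= 1] `&` [set t | idx t = j]) s.
  apply: finite_accumulation => eps eps0.
  have [le|gt] := leP eps (1 - s).
    by exists (s + eps) => /=; [lra | rewrite addrAC subrr add0r ger0_norm // ltW].
  by exists 1 => /=; [lra | rewrite ger0_norm; lra].
have [t [/andP[st t1] tj] _] := jP _ ltr01.
have : T t; last by move/leS; rewrite leNgt st.
have t01 : 0 <= t <= 1 by lra.
split=> //; have /(_ t t01 tj) : forall t : R, 0 <= t <= 1 -> idx t = j ->
    enorm (f t - f s) <= K * `|t - s|.
  by apply: loc => //; apply: adherentS jP => u [/= u1 uj]; split=> //; lra.
rewrite gtr0_norm ?subr_gt0 //.
by have := enorm_dist (f t) (f s) (f 0); have := Ts.2; lra.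
Qed.

End FiniteCovers.

Section QuadraticProgram.
Context {R : realType} {P p m : nat} {J : finType}.
Variables (a : J -> 'cV[R]_P) (X : 'M[R]_(p, P)) (E : 'M[R]_(m, P)).
Implicit Types (I : {set J}) (l w v : 'cV[R]_P).

(** Optimality of [w] in the program that minimizes
    [1/2 |X w - p0|^2 + <l, w>] under [zeta j <= <a j, w>] and [E w = b]. *)
Definition qp_optimal (zeta : J -> R) l (p0 : 'cV[R]_p) (b : 'cV[R]_m) w :=
  [/\ forall j, zeta j <= dot (a j) w, E *m w = b &
    forall w', (forall j, zeta j <= dot (a j) w') -> E *m w' = b ->
      0 <= dot (X *m w - p0) (X *m (w' - w)) + dot l (w' - w)].

Definition active (zeta : J -> R) w : {set J} := [set j | dot (a j) w == zeta j].

(** Optimality along the directions that are feasible at every point whose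
    active constraints are those of [I]. *)
Definition cone_optimal I l (p0 : 'cV[R]_p) w :=
  forall v, (forall j, j \in I -> 0 <= dot (a j) v) -> E *m v = 0 ->
    0 <= dot (X *m w - p0) (X *m v) + dot l v.

Lemma qp_optimal_cone zeta l p0 b w :
  qp_optimal zeta l p0 b w -> cone_optimal (active zeta w) l p0 w.
Proof.
move=> [feas Ew opt] v vI Ev.
have pos j : 0 < (if j \in active zeta w then 1
    else (dot (a j) w - zeta j) / (`|dot (a j) v| + 1)).
  case: ifPn => // /[!inE] ne; apply: divr_gt0; last by rewrite ltr_wpDl.
  by rewrite subr_gt0 lt_def ne feas.
have [t t0 tP] := finite_pos_lower pos.
have := opt (w + t *: v); rewrite addrAC subrr add0r -scalemxAr !dotZr -mulrDr.
rewrite pmulr_rge0 //; apply; last by rewrite mulmxDr -scalemxAr Ev scaler0 addr0.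
move=> j; rewrite dotDr dotZr; have := tP j; case: ifPn => jI tj.
  by have := mulr_ge0 (ltW t0) (vI j jI); have := feas j; lra.
have v1 : 0 < `|dot (a j) v| + 1 by rewrite ltr_wpDl.
move: tj; rewrite ler_pdivlMr // mulrDr mulr1.
have := ler_wpM2l (ltW t0) (ler_norm (- dot (a j) v)); rewrite normrN; lra.
Qed.

(** A right inverse of [E] on the image of the subspace orthogonal to the [a j]
    with [j \in I], valued in this subspace. *)
Lemma constrained_pseudo_inverse I : exists G : 'M[R]_(P, m),
  forall v, (forall j, j \in I -> dot (a j) v = 0) ->
    (forall j, j \in I -> dot (a j) (G *m (E *m v)) = 0) /\
    E *m (G *m (E *m v)) = E *m v.
Proof.
pose M : 'M[R]_(P, #|J|) :=
  \matrix_(k, j) (if enum_val j \in I then a (enum_val j) k 0 else 0).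
have MP (v : 'cV[R]_P) :
    (forall j, j \in I -> dot (a j) v = 0) <-> v^T *m M = 0.
  split=> [h|h j jI].
    apply/matrixP => i j; rewrite !mxE.
    rewrite (eq_bigr (fun k =>
      v k 0 * (if enum_val j \in I then a (enum_val j) k 0 else 0))); last first.
      by move=> k _; rewrite !mxE (ord1 i).
    have [jI|_] := boolP (enum_val j \in I); last by rewrite big1 // => k _; rewrite mulr0.
    by rewrite -[RHS](h _ jI); apply: eq_bigr => k _; rewrite mulrC.
  have /matrixP/(_ 0 (enum_rank j)) := h; rewrite !mxE => <-.
  by apply: eq_bigr => k _; rewrite !mxE enum_rankK jI mulrC.
pose K := kermx M; pose H := K *m E^T.
exists (pinvmx H *m K)^T => v /MP vM.
have /submxP[u vK] : (v^T <= K)%MS by apply/sub_kermxP.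
have Ev : ((E *m v)^T <= H)%MS.
  by rewrite trmx_mul vK -mulmxA submxMl.
split.
  apply/MP; rewrite trmx_mul trmxK -[LHS]mulmxA -[_ *m K *m M]mulmxA mulmx_ker.
  by rewrite !mulmx0.
apply: trmx_inj; rewrite trmx_mul [X in X *m _ = _]trmx_mul trmxK -[LHS]mulmxA.
by rewrite -(mulmxA (pinvmx H)) -/H mulmxA mulmxKpV.
Qed.

(** With [I] fixed the projected solution is the orthogonal projection of any
    admissible displacement, so the pseudo-inverse bounds its variation. *)
Lemma cone_optimal_lipschitz I : exists2 K, 0 <= K & forall l p0 w1 w2,
  (forall j, j \in I -> dot (a j) (w1 - w2) = 0) ->
  cone_optimal I l p0 w1 -> cone_optimal I l p0 w2 ->
  enorm (X *m (w1 - w2)) <= K * enorm (E *m (w1 - w2)).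
Proof.
have [G GP] := constrained_pseudo_inverse I.
have [K K0 KP] := mulmx_bounded (X *m G).
exists K => // l p0 w1 w2 wI o1 o2; have := KP (E *m (w1 - w2)).
set d := w1 - w2 in wI *; have [vI Ev] := GP _ wI.
rewrite -mulmxA; set v := G *m _ in vI Ev *; apply: le_trans.
have uI j : j \in I -> dot (a j) (d - v) = 0.
  by move=> jI; rewrite dotDr dotNr wI ?vI // subr0.
have Eu : E *m (d - v) = 0 by rewrite mulmxBr Ev subrr.
have eqv w : cone_optimal I l p0 w ->
    dot (X *m w - p0) (X *m (d - v)) + dot l (d - v) = 0.
  move=> o; apply/eqP; rewrite eq_le; apply/andP; split; last first.
    by apply: o => // j /uI ->.
  rewrite -oppr_ge0 opprD -!dotNr -mulmxN; apply: o.
    by move=> j /uI; rewrite dotNr => ->; rewrite oppr0.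
  by rewrite mulmxN Eu oppr0.
have : dot (X *m d) (X *m (d - v)) = 0.
  have := eqv _ o1; have := eqv _ o2; rewrite /d (mulmxBr X w1).
  by rewrite !(dotDl, dotNl); lra.
rewrite [X *m (d - v)]mulmxBr dotDr dotNr => /eqP; rewrite subr_eq0 => /eqP h.
have [->|n0] := eqVneq (enorm (X *m d)) 0; first exact: enorm_ge0.
have {}n0 : 0 < enorm (X *m d) by rewrite lt_def n0 enorm_ge0.
by rewrite -(ler_pM2l n0) -expr2 enorm_sq h dot_le.
Qed.

Lemma qp_optimal_unique zeta l p0 b w w' :
  qp_optimal zeta l p0 b w -> (forall j, zeta j <= dot (a j) w') ->
  E *m w' = b -> 0 <= dot (X *m w' - p0) (X *m (w - w')) + dot l (w - w') ->
  X *m w' = X *m w.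
Proof.
move=> [fw Ew ow] fw' Ew' o'; have := ow _ fw' Ew'; move: o'.
rewrite !mulmxBr !dotE (dotC (X *m w')) => h1 h2.
apply/eqP; rewrite -subr_eq0; apply/eqP/dot_eq0/eqP.
rewrite eq_le dot_ge0 andbT !dotE (dotC (X *m w')).
by lra.
Qed.

(** The optimal [X w] is a Lipschitz function of [b], with a constant that does
    not depend on the data [zeta], [l], [p0]: on a segment of values of [b] the
    active set takes finitely many values, each of which yields a constant.
    The bound [M] on [w] in terms of [X w] gives limits of optimal solutions. *)
Lemma qp_lipschitz : exists2 K, 0 <= K &
  forall zeta l p0 b1 b2 (sol : R -> 'cV[R]_P) M,
  (forall t : R, 0 <= t <= 1 -> qp_optimal zeta l p0 (b2 + t *: (b1 - b2)) (sol t)) ->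
  (forall s t : R, 0 <= s <= 1 -> 0 <= t <= 1 ->
     enorm (sol s - sol t) <= M * enorm (X *m (sol s - sol t))) ->
  enorm (X *m sol 1 - X *m sol 0) <= K * enorm (b1 - b2).
Proof.
pose KP I K := 0 <= K /\ forall l p0 w1 w2,
  (forall j, j \in I -> dot (a j) (w1 - w2) = 0) ->
  cone_optimal I l p0 w1 -> cone_optimal I l p0 w2 ->
  enorm (X *m (w1 - w2)) <= K * enorm (E *m (w1 - w2)).
have K_ex I : exists K, KP I K by have [K ? ?] := cone_optimal_lipschitz I; exists K.
have [K_ K_P] := choice K_ex.
have K_le I : K_ I <= \sum_I' K_ I'.
  by rewrite (bigD1 I) //= lerDl; apply: sumr_ge0 => I' _; exact: (K_P I').1.
have K0 : 0 <= \sum_I' K_ I' by apply: sumr_ge0 => I' _; exact: (K_P I').1.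
exists (\sum_I K_ I) => // zeta l p0 b1 b2 sol M opt solM.
set B := enorm (b1 - b2); have B0 : 0 <= B := enorm_ge0 _.
have KB0 : 0 <= (\sum_I K_ I) * B by rewrite mulr_ge0.
apply: (lipschitz_of_finite_cover (f := fun t => X *m sol t)
  (idx := fun t => active zeta (sol t))) => // t0 I t01 acc t tt tI.
have lip s s' : 0 <= s <= 1 -> 0 <= s' <= 1 -> active zeta (sol s) = I ->
    active zeta (sol s') = I ->
    enorm (X *m (sol s - sol s')) <= (\sum_I K_ I) * B * `|s - s'|.
  move=> s01 s01' sI sI'; have [_ Es _] := opt _ s01; have [_ Es' _] := opt _ s01'.
  have Ed : E *m (sol s - sol s') = (s - s') *: (b1 - b2).
    by rewrite mulmxBr Es Es' opprD addrACA subrr add0r -scalerBl.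
  have := (K_P I).2 l p0 (sol s) (sol s'); rewrite Ed enormZ -/B => h.
  apply: le_trans (h _ _ _) _.
  - move=> j jI; move: (jI); rewrite -{1}sI inE dotDr dotNr => /eqP ->.
    by move: jI; rewrite -sI' inE => /eqP ->; rewrite subrr.
  - by have := qp_optimal_cone (opt _ s01); rewrite sI.
  - by have := qp_optimal_cone (opt _ s01'); rewrite sI'.
  by rewrite -mulrA (mulrC B) ler_wpM2r // mulr_ge0.
have u_ex n : exists t' : R,
    [/\ 0 <= t' <= 1, `|t' - t0| <= n.+1%:R^-1 & active zeta (sol t') = I].
  have [|t' [? ?] ?] := acc n.+1%:R^-1; first by rewrite invr_gt0.
  by exists t'.
have [u uP] := choice u_ex.
have u01 n : 0 <= u n <= 1 by have [] := uP n.
have uI n : active zeta (sol (u n)) = I by have [] := uP n.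
have ut (eps : R) : 0 < eps -> exists n0, forall n, (n0 <= n)%N -> `|u n - t0| <= eps.
  move=> eps0; have [n0 _ n0P] := near_infty_natSinv_lt (PosNum eps0).
  by exists n0 => n nn; have [_ h _] := uP n; apply: (le_trans h); apply/ltW/n0P.
set K := (\sum_I K_ I) * B in KB0 lip *.
pose M' := `|M| * K + 1; have M'1 : 1 <= M' by rewrite lerDr mulr_ge0.
have solM' n k : enorm (sol (u n) - sol (u k)) <= M' * `|u n - u k|.
  apply: le_trans (solM _ _ (u01 n) (u01 k)) _.
  apply: le_trans (ler_wpM2r (enorm_ge0 _) (ler_norm M)) _.
  apply: le_trans (ler_wpM2l (normr_ge0 M) (lip _ _ (u01 n) (u01 k) (uI n) (uI k))) _.
  by rewrite mulrA ler_wpM2r // lerDl.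
have [eps eps0|w wlim] := @ecauchy_cvg R P (sol \o u).
  have e0 : 0 < eps / (2 * M') by rewrite divr_gt0 ?mulr_gt0 //; lra.
  have [n0 n0P] := ut _ e0; exists n0 => i j ni nj; apply: le_trans (solM' _ _) _.
  rewrite mulrC -ler_pdivlMr; last lra.
  apply: le_trans (ler_distD t0 _ _) _; rewrite (distrC t0).
  have := n0P _ ni; have := n0P _ nj.
  have -> : eps / (2 * M') = eps / M' / 2 by field; lra.
  lra.
have wnear (eps : R) : 0 < eps -> exists n, enorm (sol (u n) - w) <= eps /\ `|u n - t0| <= eps.
  move=> eps0; have [n0 h0] := ut _ eps0; have [n1 h1] := wlim _ eps0.
  by exists (maxn n0 n1); split; [apply: h1; rewrite leq_maxr | apply: h0; rewrite leq_maxl].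
have feasw j : zeta j <= dot (a j) w.
  apply: (@ler_addeps _ _ _ (enorm (a j))) (enorm_ge0 _) _ => eps eps0.
  have [n [nw _]] := wnear _ eps0; have [/(_ j) h _ _] := opt _ (u01 n).
  have := dot_le (a j) (sol (u n) - w); rewrite dotDr dotNr.
  by have := ler_wpM2l (enorm_ge0 (a j)) nw; lra.
have actw j : j \in I -> dot (a j) w <= zeta j.
  move=> jI; apply: (@ler_addeps _ _ _ (enorm (a j))) (enorm_ge0 _) _ => eps eps0.
  have [n [nw _]] := wnear _ eps0; move: jI; rewrite -(uI n) inE => /eqP h.
  have := dot_ge (a j) (sol (u n) - w); rewrite dotDr dotNr.
  by have := ler_wpM2l (enorm_ge0 (a j)) nw; lra.
have [KE KE0 KEP] := mulmx_bounded E; have [KX KX0 KXP] := mulmx_bounded X.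
have Ew : E *m w = b2 + t0 *: (b1 - b2).
  apply/eqP; rewrite -subr_eq0; apply/eqP/enorm_eq0/eqP.
  rewrite eq_le enorm_ge0 andbT; apply: (@ler_addeps _ _ _ (KE + B)).
    by rewrite addr_ge0.
  move=> eps eps0; rewrite add0r; have [n [nw nt]] := wnear _ eps0.
  have [_ En _] := opt _ (u01 n).
  have := enorm_dist (E *m w) (E *m sol (u n)) (b2 + t0 *: (b1 - b2)).
  rewrite {2}En opprD addrACA subrr add0r -scalerBl enormZ -/B enormBC -mulmxBr.
  have := KEP (sol (u n) - w); have := ler_wpM2l KE0 nw; have := ler_wpM2r B0 nt.
  lra.
have ow : cone_optimal I l p0 w.
  move=> v vI Ev; apply: (@ler_addeps _ _ _ (KX * enorm (X *m v))).
    by rewrite mulr_ge0 ?enorm_ge0.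
  move=> eps eps0; have [n [nw _]] := wnear _ eps0.
  have := qp_optimal_cone (opt _ (u01 n)); rewrite uI => /(_ v vI Ev).
  have := dot_le (X *m (sol (u n) - w)) (X *m v).
  have := ler_wpM2r (enorm_ge0 (X *m v)) (KXP (sol (u n) - w)).
  have := ler_wpM2r (enorm_ge0 (X *m v)) (ler_wpM2l KX0 nw).
  by rewrite !mulmxBr !dotE; lra.
have Xw : X *m w = X *m sol t0.
  have [f0 E0 _] := opt _ t01.
  apply: (qp_optimal_unique (opt _ t01) feasw Ew (ow _ _ _)).
    by move=> j /actw h; rewrite dotDr dotNr; have := f0 j; lra.
  by rewrite mulmxBr E0 Ew subrr.
rewrite -Xw; apply: (@ler_addeps _ _ _ (K + KX)); first by rewrite addr_ge0.
move=> eps eps0; have [n [nw nt]] := wnear _ eps0.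
have := enorm_dist (X *m sol t) (X *m sol (u n)) (X *m w); rewrite -!mulmxBr.
have := lip _ _ tt (u01 n) tI (uI n); have := KXP (sol (u n) - w).
have := ler_wpM2l KX0 nw; have := ler_wpM2l KB0 nt.
have := ler_wpM2l KB0 (ler_distD t0 t (u n)); rewrite (distrC t0).
lra.
Qed.

End QuadraticProgram.

(** * The dual error bound *)

Section ConvexPart.
Context {R : realType} {p : nat} {C : set 'cV[R]_p} {rho : 'cV[R]_p -> R}.
Hypothesis cvx : convex_part C rho.

Definition fiber q (A : 'M[R]_(q, p)) (b : 'cV[R]_q) := [set x | C x /\ A *m x = b].

Lemma convex_part_fiber q (A : 'M[R]_(q, p)) b :
  fiber A b !=set0 -> convex_part (fiber A b) rho.
Proof.
move=> ne; split=> //.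
- move=> x xlim; split.
    by apply: (cvx_closed cvx) => eps /xlim[y [Cy _] ?]; exists y.
  apply/eqP; rewrite -subr_eq0; apply/eqP/enorm_eq0/eqP.
  have [K K0 KP] := mulmx_bounded A.
  rewrite eq_le enorm_ge0 andbT; apply: (ler_addeps K0) => eps /xlim[y [_ Ay] xy].
  by rewrite add0r -Ay -mulmxBr (le_trans (KP _)) // ler_wpM2l.
- move=> t x y t01 [Cx Ax] [Cy Ay]; split; first exact: cvx_dom cvx _ _ _ _ _ _.
  by rewrite mulmxDr -!scalemxAr Ax Ay -scalerDl subrKC scale1r.
- by move=> t x y t01 [Cx _] [Cy _]; apply: cvx_fun cvx _ _ _ _ _ _.
- by have [l l0 lip] := cvx_lipschitz cvx; exists l => // x y [? _] [? _]; apply: lip.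
Qed.

Lemma convex_part_scale k : 0 <= k -> convex_part C (fun x => k * rho x).
Proof.
move=> k0; split; [exact: cvx_nonempty cvx|exact: cvx_closed cvx|exact: cvx_dom cvx|..].
- move=> t x y t01 Cx Cy; have := ler_wpM2l k0 (cvx_fun cvx t01 Cx Cy); lra.
- have [l l0 lip] := cvx_lipschitz cvx; exists (k * l); first exact: mulr_ge0.
  by move=> x y Cx Cy; rewrite -mulrBr -mulrA ler_wpM2l // lip.
Qed.

End ConvexPart.

Lemma critical_scale {R : realType} {p} (C : set 'cV[R]_p) rho k v x :
  0 <= k -> critical C rho v x -> critical C (fun y => k * rho y) (k *: v) x.
Proof.
move=> k0 [Cx o]; split=> // u Cu; have := mulr_ge0 k0 (o u Cu).
by rewrite dotZl; lra.
Qed.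

(** A proximal point is a nonexpansive function of its center: the subdifferential
    is monotone. *)
Lemma critical_sq_nonexpansive {R : realType} {p} (C : set 'cV[R]_p) rho p1 p2 x1 x2 :
  critical C rho (x1 - p1) x1 -> critical C rho (x2 - p2) x2 ->
  enorm (x1 - x2) <= enorm (p1 - p2).
Proof.
move=> c1 c2; have := critical_monotone c1 c2; have := dot_le (p1 - p2) (x1 - x2).
move=> h1 h2.
have [->|n0] := eqVneq (enorm (x1 - x2)) 0; first exact: enorm_ge0.
have {}n0 : 0 < enorm (x1 - x2) by rewrite lt_def n0 enorm_ge0.
rewrite -(ler_pM2r n0) -expr2 enorm_sq.
by move: h1 h2; rewrite !dotE (dotC x2 x1); lra.
Qed.

(** The epigraph of [rho] is the image of the polyhedron of the [w] such that
    [zeta j <= <a j, w>] for all [j]; [lift] is a section of this image along the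
    graph of [rho]. *)
Record polyhedral_lift {R : realType} {p P} {J : finType}
    (a : J -> 'cV[R]_P) (X : 'M[R]_(p, P)) (cost : 'cV[R]_P) (zeta : J -> R)
    (C : set 'cV[R]_p) (rho : 'cV[R]_p -> R) (lift : 'cV[R]_p -> 'cV[R]_P)
    : Prop := {
  lift_feasible : forall x, C x -> forall j, zeta j <= dot (a j) (lift x);
  lift_proj : forall x, X *m lift x = x;
  lift_cost : forall x, dot cost (lift x) = rho x;
  lift_epigraph : forall w, (forall j, zeta j <= dot (a j) w) ->
    C (X *m w) /\ rho (X *m w) <= dot cost w;
  lift_lipschitz : exists M, forall x y, C x -> C y ->
    enorm (lift x - lift y) <= M * enorm (x - y) }.

(** A minimizer [x] of [h + rho] on a fiber of [A] also solves the quadratic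
    program obtained by freezing the gradient at [x], and the latter is Lipschitz
    in the fiber. A gradient step being a contraction, the two minimizers can be
    compared through the quadratic program with the gradient of the second one
    and the fiber of the first one. *)
Lemma fiber_error_bound {R : realType} {p P q} {J : finType}
    (a : J -> 'cV[R]_P) (X : 'M[R]_(p, P)) (A : 'M[R]_(q, p)) (m M : R) :
  0 < m -> m <= M -> exists2 K, 0 <= K &
  forall cost zeta C rho lift (dh : 'cV[R]_p -> 'cV[R]_p) x y,
  convex_part C rho -> polyhedral_lift a X cost zeta C rho lift ->
  (forall u v, enorm (dh u - dh v) <= M * enorm (u - v)) ->
  (forall u v, m * dot (u - v) (u - v) <= dot (dh u - dh v) (u - v)) ->
  critical (fiber (C := C) A (A *m x)) rho (dh x) x ->
  critical (fiber (C := C) A (A *m y)) rho (dh y) y ->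
  enorm (x - y) <= K * enorm (A *m x - A *m y).
Proof.
move=> m0 mM; have M0 : 0 < M by apply: lt_le_trans m0 mM.
have [K K0 KP] := qp_lipschitz a X (A *m X).
pose rate := m ^+ 2 / M ^+ 2; have rate0 : 0 < rate by rewrite divr_gt0 ?exprn_gt0.
have rate1 : rate <= 1.
  by rewrite ler_pdivrMr ?exprn_gt0 // mul1r ler_pXn2r ?nnegrE ?(ltW m0) ?(ltW M0).
exists (2 * K / rate) => [|cost zeta C rho lift dh x y cvx pl dhL dhm cx cy].
  by apply: divr_ge0; [exact: mulr_ge0 | exact: ltW].
(* The step size minimizing the contraction factor 1 - 2 t m + t^2 M^2. *)
pose t := m / M ^+ 2; have t0 : 0 < t by rewrite divr_gt0 ?exprn_gt0.
pose step u := u - t *: dh u.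
have contr : enorm (step x - step y) <= (1 - rate / 2) * enorm (x - y).
  have -> : step x - step y = (x - y) - t *: (dh x - dh y).
    by rewrite /step; vector_ring.
  rewrite enorm_le; last by rewrite mulr_ge0 ?enorm_ge0 //; lra.
  rewrite exprMn enorm_sq; have := dhm x y; have := dhL x y.
  rewrite enorm_le; last by rewrite mulr_ge0 ?enorm_ge0 // ltW.
  rewrite exprMn enorm_sq !(dotDl (x - y)) !(dotDr (x - y)) !(dotNl, dotNr, dotZl, dotZr).
  rewrite (dotC (x - y) (dh x - dh y)).
  set D := dot (x - y) (x - y); have D0 : 0 <= D by apply: dot_ge0.
  move=> h1 h2; have h3 := ler_wpM2l (ltW t0) h2.
  have h4 := ler_wpM2l (ltW t0) (ler_wpM2l (ltW t0) h1).
  have e1 : t * (m * D) = rate * D by rewrite /t /rate; field; lra.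
  have e2 : t * (t * (M ^+ 2 * D)) = rate * D by rewrite /t /rate; field; lra.
  have e3 : (1 - rate / 2) ^+ 2 * D = D - rate * D + rate ^+ 2 / 4 * D by field.
  have : 0 <= rate ^+ 2 / 4 * D by rewrite mulr_ge0 // divr_ge0 // sqr_ge0.
  by rewrite e3; rewrite e1 in h3; rewrite e2 in h4; lra.
have scaled u : critical (fiber (C := C) A (A *m u)) rho (dh u) u ->
    critical (fiber (C := C) A (A *m u)) (fun v => t * rho v) (u - step u) u.
  by move=> cu; rewrite /step subKr; apply: critical_scale => //; apply: ltW.
(* [sol s] is the projection of [step y] onto a fiber that moves from that of [y],
   where it is [y] itself, to that of [x]. *)
pose b s := A *m y + s *: (A *m x - A *m y).
have ex_sol s : exists u, 0 <= s <= 1 ->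
    critical (fiber (C := C) A (b s)) (fun v => t * rho v) (u - step y) u.
  have [s01|_] := boolP (0 <= s <= 1); last by exists 0.
  have ne : fiber (C := C) A (b s) !=set0.
    exists (s *: x + (1 - s) *: y); split.
      by apply: (cvx_dom cvx) => //; [exact: cx.1.1 | exact: cy.1.1].
    by rewrite /b mulmxDr -!scalemxAr scalerBl scale1r scalerBr addrC addrA addrAC.
  have cvx' := convex_part_scale (convex_part_fiber cvx ne) (ltW t0).
  by have [u] := critical_exists cvx' (curved_sq 1 (step y)) ltr01; rewrite scale1r; exists u.
have [sol solP] := choice ex_sol.
have [Ml MlP] := lift_lipschitz pl.
have qp s : 0 <= s <= 1 ->
    qp_optimal a X (A *m X) zeta (t *: cost) (step y) (b s) (lift (sol s)).
  move=> s01; have [[Cs As] o] := solP _ s01; split.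
  - exact: lift_feasible pl _ Cs.
  - by rewrite -mulmxA (lift_proj pl).
  move=> w fw; rewrite -mulmxA => Ew; have [Cw rw] := lift_epigraph pl fw.
  have := o _ (conj Cw Ew); have := ler_wpM2l (ltW t0) rw.
  rewrite mulmxBr (lift_proj pl) dotZl (dotDr w) dotNr (lift_cost pl).
  lra.
have := KP zeta (t *: cost) (step y) (A *m x) (A *m y) (lift \o sol) Ml qp.
rewrite /= !(lift_proj pl) => h; have {}h : enorm (sol 1 - sol 0) <=
    K * enorm (A *m x - A *m y).
  apply: h => s s' s01 s01'; rewrite mulmxBr !(lift_proj pl).
  by apply: MlP; [have [[]] := solP _ s01 | have [[]] := solP _ s01'].
have o0 : 0 <= (0 : R) <= 1 by lra.
have o1 : 0 <= (1 : R) <= 1 by lra.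
have sol0 : sol 0 = y.
  apply/eqP; rewrite -subr_eq0; apply/eqP/enorm_eq0/eqP.
  have := critical_sq_nonexpansive (solP _ o0); rewrite /b scale0r addr0.
  move=> /(_ _ _ (scaled _ cy)); rewrite subrr enorm0 => h0.
  by rewrite eq_le h0 enorm_ge0.
have sol1 : enorm (x - sol 1) <= enorm (step x - step y).
  have := solP _ o1; rewrite /b scale1r subrKC => h1.
  exact: critical_sq_nonexpansive (scaled _ cx) h1.
have := enorm_dist x (sol 1) y; rewrite sol0 in h.
rewrite -mulrA [rate^-1 * _]mulrC mulrA ler_pdivlMr //.
by move: (enorm (x - y)) (enorm (A *m x - _)) contr h sol1 => n1 n2; lra.
Qed.

(** * One iteration *)

Section Iteration.
Context {R : realType} {p ma mb : nat}.
Variables (A : 'M[R]_(ma, p)) (B : 'M[R]_(mb, p)) (nA : R).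
Hypothesis nA0 : 0 <= nA.
Hypothesis A_le : forall x, enorm (A *m x) <= nA * enorm x.
Hypothesis B_le : forall x, enorm (B *m x) <= nA * enorm x.
Hypothesis AB_ge : forall x,
  2 * dot x x <= dot (A *m x) (A *m x) + dot (B *m x) (B *m x).
Variables (C : set 'cV[R]_p) (rho f : 'cV[R]_p -> R) (g : 'cV[R]_p -> 'cV[R]_p).
Variables (L mu gamma c kappa : R).
Hypothesis f_curved : curved f g mu L.
Hypothesis g_lipschitz : forall x y, enorm (g x - g y) <= L * enorm (x - y).
Hypotheses (L0 : 0 < L) (muL : mu <= L) (gammaL : L < gamma).
Hypotheses (c0 : 0 < c) (kappa0 : 0 < kappa) (m0 : 0 < mu + kappa).
Implicit Types (x u z s v : 'cV[R]_p) (lam : 'cV[R]_ma).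

Definition augmented x z lam :=
  f x + rho x + dot lam (A *m x) + c / 2 * dot (A *m x) (A *m x)
  + kappa / 2 * dot (x - z) (x - z).

Definition augmented_grad x z lam :=
  g x + A^T *m lam + c *: (A^T *m (A *m x)) + kappa *: (x - z).

Definition moreau x z := f x + rho x + kappa / 2 * dot (x - z) (x - z).

Definition moreau_grad x z := g x + kappa *: (x - z).

(** The gradient at [x] of the smooth part of the objective of one iteration, with
    gradient estimate [v] at [s], iterate [y], center [z] and multiplier [lam]. *)
Definition step_grad v s y z lam x :=
  v + gamma *: (x - s) + A^T *m lam + c *: (A^T *m (A *m x))
  + c *: (B^T *m (B *m (x - y))) + kappa *: (x - z).

Lemma augmented_curved z lam :
  curved (fun x => f x + dot lam (A *m x) + c / 2 * dot (A *m x) (A *m x)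
                   + kappa / 2 * dot (x - z) (x - z))
         (fun x => augmented_grad x z lam) (mu + kappa) (L + c * nA ^+ 2 + kappa).
Proof.
move=> x y; have /andP[] := f_curved x y; rewrite /augmented_grad.
have -> : x = y + (x - y) by rewrite addrC subrK.
move: (x - y) => d; rewrite [y + d - y]addrAC subrr add0r => h1 h2.
have Ad := A_le d; rewrite enorm_le ?mulr_ge0 ?enorm_ge0 // exprMn enorm_sq in Ad.
have h3 := ler_wpM2l (ltW c0) Ad; have h4 := mulr_ge0 (ltW c0) (dot_ge0 (A *m d)).
move: h1 h2; rewrite !mulmxDr !dotE -!dot_mulmxr.
rewrite (dotC d y) (dotC z d) (dotC z y) (dotC (A *m d) (A *m y)).
by move=> h1 h2; apply/andP; split; lra.
Qed.

Lemma augmented_growth x z lam u :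
  critical C rho (augmented_grad x z lam) x -> C u ->
  augmented x z lam <= augmented u z lam.
Proof.
move=> cx Cu; have := critical_growth (augmented_curved z lam) cx Cu.
have : 0 <= (mu + kappa) / 2 * dot (u - x) (u - x).
  by rewrite mulr_ge0 ?dot_ge0 // divr_ge0 // ltW.
by rewrite /augmented; lra.
Qed.

Lemma moreau_curved z : curved (fun x => f x + kappa / 2 * dot (x - z) (x - z))
  (fun x => moreau_grad x z) (mu + kappa) (L + kappa).
Proof. exact: curvedD f_curved (curved_sq kappa z). Qed.

Lemma moreau_growth (C' : set 'cV[R]_p) x z u :
  critical C' rho (moreau_grad x z) x -> C' u -> moreau x z <= moreau u z.
Proof.
move=> cx Cu; have := critical_growth (moreau_curved z) cx Cu.
have : 0 <= (mu + kappa) / 2 * dot (u - x) (u - x).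
  by rewrite mulr_ge0 ?dot_ge0 // divr_ge0 // ltW.
by rewrite /moreau; lra.
Qed.

(** On a fiber of [A] the terms of the augmented Lagrangian that involve [A] are
    constant. *)
Lemma augmented_fiber x z lam : critical C rho (augmented_grad x z lam) x ->
  critical (fiber (C := C) A (A *m x)) rho (moreau_grad x z) x.
Proof.
move=> [Cx o]; split=> // u [Cu Au]; have := o u Cu.
rewrite /augmented_grad /moreau_grad !dotDl dotZl -!dot_mulmxr.
by rewrite mulmxBr Au subrr !dot0r mulr0 !addr0.
Qed.

Lemma trmx_le q (M : 'M[R]_(q, p)) n : 0 <= n ->
  (forall x, enorm (M *m x) <= n * enorm x) ->
  forall y, enorm (M^T *m y) <= n * enorm y.
Proof.
move=> n0 Mn y; have [->|h0] := eqVneq (enorm (M^T *m y)) 0.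
  by rewrite mulr_ge0 ?enorm_ge0.
have {}h0 : 0 < enorm (M^T *m y) by rewrite lt_def h0 enorm_ge0.
rewrite -(ler_pM2r h0) -expr2 enorm_sq dot_mulmx trmxK.
apply: le_trans (dot_le _ _) _; rewrite mulrAC mulrC.
by rewrite ler_wpM2r ?enorm_ge0.
Qed.

Definition residual_const E := (L + gamma) * (1 + E) + c * nA ^+ 2 + 1.

Section Step.
Variables (x d z eps : 'cV[R]_p) (lam : 'cV[R]_ma) (eta : R).
Hypothesis Cx : C x.
Variables (x' xh u : 'cV[R]_p).
Let s := x + eta *: d.
Let dx := x' - x.
Hypothesis x'_crit : critical C rho (step_grad (g s + eps) s x z lam x') x'.
Hypothesis xh_crit : critical C rho (augmented_grad xh z lam) xh.

(** Optimality of [x'] tested at [x]. The term [2 * c] comes from [AB_ge], and the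
    two curvature bounds of [f] at the extrapolated point leave [gamma - mu] in
    front of the momentum. *)
Lemma primal_descent :
  augmented x' z lam + (gamma + kappa + 2 * c) / 2 * dot dx dx <=
  augmented x z lam + (gamma - mu) / 2 * (eta ^+ 2 * dot d d) - dot eps dx.
Proof.
have [_ /(_ x Cx)] := x'_crit.
have /andP[_] := f_curved x' s; have /andP[+ _] := f_curved x s.
have := mulr_ge0 (ltW c0) (dot_ge0 (B *m dx)).
have := ler_wpM2l (ltW c0) (AB_ge dx).
rewrite /augmented /step_grad /dx; have -> : x' = x + (x' - x) by rewrite addrC subrK.
move: (x' - x) => e; have -> : x + e - x = e by vector_ring.
have -> : x - (x + e) = - e by vector_ring.
have -> : x + e - s = e - eta *: d by rewrite /s; vector_ring.
have -> : x - s = - (eta *: d) by rewrite /s; vector_ring.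
have gL : 0 <= (gamma - L) / 2 * dot (e - eta *: d) (e - eta *: d).
  by rewrite mulr_ge0 ?dot_ge0 // divr_ge0 // subr_ge0 ltW.
move: gL; rewrite !(dotDl, dotDr, dotNl, dotNr, dotZl, dotZr) -!dot_mulmxr.
rewrite !mulmxDr !(dotDl, dotDr, dotNl, dotNr, dotZl, dotZr).
rewrite (dotC d e) (dotC z x) (dotC z e) (dotC e x) (dotC (A *m e) (A *m x)).
lra.
Qed.

Lemma step_dist E : 0 <= eta <= E ->
  enorm (x' - s) <= (1 + E) * (enorm dx + enorm d).
Proof.
move=> /andP[e0 eE]; have -> : x' - s = dx - eta *: d.
  by rewrite /s /dx; vector_ring.
apply: le_trans (enormB _ _) _; rewrite enormZ ger0_norm //.
have := ler_wpM2r (enorm_ge0 d) eE; have := mulr_ge0 (le_trans e0 eE) (enorm_ge0 dx).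
by have := enorm_ge0 d; have := enorm_ge0 dx; lra.
Qed.

Lemma BtB_le v : enorm (B^T *m (B *m v)) <= nA ^+ 2 * enorm v.
Proof.
apply: le_trans (trmx_le nA0 B_le _) _.
by rewrite expr2 -mulrA ler_wpM2l.
Qed.

(** The new iterate minimizes the augmented Lagrangian up to a perturbation of the
    gradient, which strong convexity converts into a distance. *)
Lemma primal_error_bound E : 0 <= eta <= E ->
  enorm (x' - xh) <= residual_const E / (mu + kappa) * (enorm dx + enorm d + enorm eps).
Proof.
move=> etaE; pose res := g s - g x' + eps + gamma *: (x' - s) + c *: (B^T *m (B *m dx)).
have gamma0 : 0 < gamma by apply: lt_trans gammaL.
have res_le : enorm res <= residual_const E * (enorm dx + enorm d + enorm eps).
  have h1 : enorm res <= enorm (g s - g x') + enorm eps + gamma * enorm (x' - s)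
      + c * (nA ^+ 2 * enorm dx).
    rewrite /res; apply: le_trans (enormD _ _) _; apply: lerD.
      apply: le_trans (enormD _ _) _; apply: lerD; first exact: enormD.
      by rewrite enormZ gtr0_norm.
    by rewrite enormZ gtr0_norm // ler_wpM2l ?(ltW c0) // BtB_le.
  apply: (le_trans h1); have := g_lipschitz s x'; rewrite (enormBC s x').
  have h2 : 0 <= L + gamma by rewrite addr_ge0 ?ltW.
  have := ler_wpM2l h2 (step_dist etaE); rewrite /residual_const.
  have /andP[e0 eE] := etaE; have E0 := le_trans e0 eE.
  have n0 := mulr_ge0 (ltW c0) (sqr_ge0 nA).
  have := mulr_ge0 n0 (enorm_ge0 d); have := mulr_ge0 n0 (enorm_ge0 eps).
  have h3 : 0 <= (L + gamma) * (1 + E) by rewrite mulr_ge0 //; lra.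
  have := mulr_ge0 h3 (enorm_ge0 eps).
  by have := enorm_ge0 d; have := enorm_ge0 dx; lra.
have key : (mu + kappa) * dot (x' - xh) (x' - xh) <= enorm res * enorm (x' - xh).
  have := critical_monotone x'_crit xh_crit; have := curved_monotone x' xh f_curved.
  have := dot_ge res (x' - xh).
  have := mulr_ge0 (ltW c0) (dot_ge0 (A *m (x' - xh))).
  have -> : step_grad (g s + eps) s x z lam x' - augmented_grad xh z lam =
      res + (g x' - g xh) + c *: (A^T *m (A *m (x' - xh))) + kappa *: (x' - xh).
    rewrite /step_grad /augmented_grad /res !(mulmxBr A) !(mulmxBr A^T) -/dx.
    vector_ring.
  rewrite (dotDl _ (kappa *: _)) (dotDl _ (c *: _)) (dotDl res) !dotZl.
  by rewrite -dot_mulmxr; lra.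
rewrite -mulrA mulrCA ler_pdivlMl //; apply: le_trans res_le.
have [->|h0] := eqVneq (enorm (x' - xh)) 0; first by rewrite mulr0 enorm_ge0.
have {}h0 : 0 < enorm (x' - xh) by rewrite lt_def h0 enorm_ge0.
by rewrite -(ler_pM2r h0) -mulrA -expr2 enorm_sq.
Qed.

Lemma iterate_error_bound E : 0 <= eta <= E ->
  enorm (x - xh) <= (1 + residual_const E / (mu + kappa)) *
                    (enorm dx + enorm d + enorm eps).
Proof.
move=> etaE; have := enorm_dist x x' xh; rewrite (enormBC x x') -/dx.
have := primal_error_bound etaE; have := enorm_ge0 d; have := enorm_ge0 eps.
by lra.
Qed.

(** Both [x'] and [u] are proximal points, of [x' - step_grad x'] and of
    [x - g x - A^T lam], so that the distance between them is at most the one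
    between these two points. *)
Lemma stationarity_gap_le E : 0 <= eta <= E ->
  critical C rho (u - (x - g x - A^T *m lam)) u ->
  enorm (x - u) <= 2 * enorm dx + L * (E * enorm d) + enorm eps
    + gamma * ((1 + E) * (enorm dx + enorm d))
    + c * (nA * (enorm (A *m xh) + nA * enorm (x' - xh)))
    + c * (nA ^+ 2 * enorm dx) + kappa * enorm (x' - z).
Proof.
move=> etaE u_crit; have /andP[eta0 eE] := etaE.
have gamma0 : 0 < gamma by apply: lt_trans gammaL.
pose w := step_grad (g s + eps) s x z lam x'.
have x'w : critical C rho (x' - (x' - w)) x' by rewrite subKr.
have := critical_sq_nonexpansive x'w u_crit.
have -> : x' - w - (x - g x - A^T *m lam) =
    dx - (g s - g x) - eps - gamma *: (x' - s) - c *: (A^T *m (A *m x'))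
    - c *: (B^T *m (B *m dx)) - kappa *: (x' - z).
  by rewrite /w /step_grad -/dx; vector_ring.
have h1 : enorm (g s - g x) <= L * (E * enorm d).
  apply: le_trans (g_lipschitz _ _) _; rewrite ler_wpM2l ?(ltW L0) //.
  have -> : s - x = eta *: d by rewrite /s; vector_ring.
  by rewrite enormZ ger0_norm // ler_wpM2r ?enorm_ge0.
have h2 := ler_wpM2l (ltW gamma0) (step_dist etaE).
have h3 : enorm (A^T *m (A *m x')) <= nA * (enorm (A *m xh) + nA * enorm (x' - xh)).
  apply: le_trans (trmx_le nA0 A_le _) _; rewrite ler_wpM2l //.
  have -> : A *m x' = A *m xh + A *m (x' - xh) by rewrite mulmxBr; vector_ring.
  by apply: le_trans (enormD _ _) _; rewrite lerD2l.
have h4 := BtB_le dx.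
have := enorm_dist x x' u; rewrite (enormBC x x') -/dx.
have := enormB (dx - (g s - g x) - eps - gamma *: (x' - s) - c *: (A^T *m (A *m x'))
    - c *: (B^T *m (B *m dx))) (kappa *: (x' - z)).
have := enormB (dx - (g s - g x) - eps - gamma *: (x' - s) - c *: (A^T *m (A *m x')))
    (c *: (B^T *m (B *m dx))).
have := enormB (dx - (g s - g x) - eps - gamma *: (x' - s)) (c *: (A^T *m (A *m x'))).
have := enormB (dx - (g s - g x) - eps) (gamma *: (x' - s)).
have := enormB (dx - (g s - g x)) eps; have := enormB dx (g s - g x).
rewrite !enormZ !gtr0_norm //.
have := ler_wpM2l (ltW c0) h3; have := ler_wpM2l (ltW c0) h4.
lra.
Qed.

End Step.

(** The potential, with minimizers [xh] and [xs] in place of the minimum values. *)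
Definition lyapunov tau x (d : 'cV[R]_p) z lam xh xs :=
  augmented x z lam + tau * dot d d + 2 * moreau xs z - 2 * augmented xh z lam.

(** Weak duality, used twice: the dual value is at most both the Lagrangian at [x]
    and the constrained minimum. *)
Lemma lyapunov_ge tau x d z lam xh xs : 0 <= tau -> C x ->
  critical C rho (augmented_grad xh z lam) xh -> C xs -> A *m xs = 0 ->
  f xs + rho xs <= lyapunov tau x d z lam xh xs.
Proof.
move=> tau0 Cx cxh Cxs Axs; have := augmented_growth cxh Cx.
have := augmented_growth cxh Cxs; have := mulr_ge0 tau0 (dot_ge0 d).
have : 0 <= kappa / 2 * dot (xs - z) (xs - z).
  by rewrite mulr_ge0 ?dot_ge0 // divr_ge0 // ltW.
rewrite /lyapunov /moreau [augmented xs z lam]/augmented Axs !dot0r mulr0 !addr0.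
lra.
Qed.

(** Decrease of the value terms of the potential under a change of the multiplier followed by one of
    the proximal center: each minimum value is bounded from above by testing at the
    minimizer of another one. *)
Lemma values_change (x z z' xh0 xh xh' xs xs' : 'cV[R]_p) lam alpha :
  let lam' := lam + alpha *: (A *m x) in
  critical C rho (augmented_grad xh0 z lam) xh0 ->
  critical C rho (augmented_grad xh z lam') xh ->
  C xh' -> A *m xs = 0 -> C xs ->
  critical (fiber (C := C) A 0) rho (moreau_grad xs' z') xs' ->
  2 * moreau xs' z' - 2 * augmented xh' z' lam' <=
  2 * moreau xs z - 2 * augmented xh0 z lam
  + 2 * kappa * dot (z' - z) (xh' - xs) - 2 * alpha * dot (A *m x) (A *m xh).
Proof.
move=> lam' c0_ ch Cxh' Axs Cxs cxs'.
have := moreau_growth cxs' (conj Cxs Axs); have := augmented_growth c0_ ch.1.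
have := augmented_growth ch Cxh'.
rewrite /augmented /moreau /lam' !(dotDl lam) !(dotZl alpha).
rewrite !dotE (dotC z xs) (dotC z' xs) (dotC z xh).
rewrite (dotC z xh') (dotC z' xh') (dotC z xh0).
lra.
Qed.

Section Descent.
Variables (E alpha beta Ce : R).
Let W := gamma + kappa + 2 * c.
Let R2 := 1 + residual_const E / (mu + kappa).
Let Z := 2 * kappa ^+ 2 / (mu + kappa) + 2 * kappa ^+ 2 * Ce ^+ 2 / alpha.
Hypothesis E_small : E ^+ 2 * (2 * (gamma - mu + 3 * L)) <= W - 3 * L.
Hypotheses (alpha0 : 0 < alpha) (alpha_small : alpha * (nA ^+ 2 * R2 ^+ 2) <= W / 96).
Hypotheses (beta0 : 0 < beta) (beta1 : beta <= 1) (beta_small : beta * Z <= kappa / 4).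

Variables (x d z eps x' xh0 xh xh' xs xs' u : 'cV[R]_p) (lam : 'cV[R]_ma) (eta : R).
Let s := x + eta *: d.
Let lam' := lam + alpha *: (A *m x).
Let z' := z + beta *: (x' - z).
Hypotheses (Cx : C x) (etaE : 0 <= eta <= E).
Hypothesis x'_crit : critical C rho (step_grad (g s + eps) s x z lam' x') x'.
Hypothesis xh0_crit : critical C rho (augmented_grad xh0 z lam) xh0.
Hypothesis xh_crit : critical C rho (augmented_grad xh z lam') xh.
Hypothesis xh'_crit : critical C rho (augmented_grad xh' z' lam') xh'.
Hypothesis xs_crit : critical (fiber (C := C) A 0) rho (moreau_grad xs z) xs.
Hypothesis xs'_crit : critical (fiber (C := C) A 0) rho (moreau_grad xs' z') xs'.
Hypothesis xh_xs : enorm (xh - xs) <= Ce * enorm (A *m xh).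

Let E0 : 0 <= E. Proof. by case/andP: etaE => /le_trans; apply. Qed.
Let W0 : 0 < W.
Proof. by rewrite /W !addr_gt0 ?mulr_gt0 // (lt_trans L0). Qed.
Let K0 : 0 <= residual_const E.
Proof.
rewrite /residual_const !addr_ge0 // mulr_ge0 ?sqr_ge0 ?(ltW c0) //.
  by rewrite addr_ge0 ?(ltW L0) // ltW // (lt_trans L0).
by rewrite addr_ge0.
Qed.

(** The optimality residual of [xh'] for the center [z] is [kappa (z - z')]. *)
Lemma center_change : enorm (xh' - xh) <= kappa / (mu + kappa) * enorm (z' - z).
Proof.
have h1 := critical_monotone xh'_crit xh_crit.
have h2 := curved_monotone xh' xh (augmented_curved z lam').
have h3 : (mu + kappa) * dot (xh' - xh) (xh' - xh) <=
    kappa * (enorm (z' - z) * enorm (xh' - xh)).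
  apply: le_trans h2 _; have h4 := ler_wpM2l (ltW kappa0) (dot_le (z' - z) (xh' - xh)).
  apply: le_trans h4; move: h1.
  have -> : augmented_grad xh' z' lam' - augmented_grad xh z lam' =
    (augmented_grad xh' z lam' - augmented_grad xh z lam') - kappa *: (z' - z).
    by rewrite /augmented_grad; vector_ring.
  by rewrite (dotDl (_ - _)) dotNl dotZl; lra.
rewrite mulrAC ler_pdivlMr //.
have [->|h0] := eqVneq (enorm (xh' - xh)) 0; first by rewrite mul0r mulr_ge0 ?enorm_ge0 ?ltW.
have {}h0 : 0 < enorm (xh' - xh) by rewrite lt_def h0 enorm_ge0.
rewrite -(ler_pM2r h0); move: h3; rewrite -enorm_sq; lra.
Qed.

(** [xh' - xs] is split at [xh]: the center moves [xh] little, and the error bound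
    controls the rest by the constraint violation of [xh]. *)
Lemma cross_term_le : 2 * kappa * dot (z' - z) (xh' - xs) <=
  Z * dot (z' - z) (z' - z) + alpha / 2 * dot (A *m xh) (A *m xh).
Proof.
have -> : xh' - xs = (xh' - xh) + (xh - xs) by rewrite addrA subrK.
rewrite dotDr -!enorm_sq.
have := dot_le (z' - z) (xh' - xh); have := dot_le (z' - z) (xh - xs).
have := ler_wpM2l (enorm_ge0 (z' - z)) center_change.
have := ler_wpM2l (enorm_ge0 (z' - z)) xh_xs.
set n := enorm (z' - z); set h := enorm (A *m xh).
move=> h1 h2 h3 h4.
have k2 : 0 <= 2 * kappa by rewrite mulr_ge0 ?ltW.
have := ler_wpM2l k2 (le_trans h3 h1); have := ler_wpM2l k2 (le_trans h4 h2).
have -> : 2 * kappa * (n * (kappa / (mu + kappa) * n)) =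
  2 * kappa ^+ 2 / (mu + kappa) * n ^+ 2 by ring.
have : 0 <= (2 * alpha)^-1 * (alpha * h - 2 * kappa * Ce * n) ^+ 2.
  by rewrite mulr_ge0 ?sqr_ge0 // invr_ge0 mulr_ge0 // ltW.
have -> : (2 * alpha)^-1 * (alpha * h - 2 * kappa * Ce * n) ^+ 2 =
  alpha / 2 * h ^+ 2 - 2 * kappa * (n * (Ce * h))
  + 2 * kappa ^+ 2 * Ce ^+ 2 / alpha * n ^+ 2.
  by field; rewrite gt_eqF.
by rewrite /Z; lra.
Qed.

Let sq3 (a b e : R) : (a + b + e) ^+ 2 <= 3 * (a ^+ 2 + b ^+ 2 + e ^+ 2).
Proof. have := sqr_ge0 (a - b); have := sqr_ge0 (a - e); have := sqr_ge0 (b - e); lra. Qed.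

Lemma constraint_error :
  alpha * dot (A *m (x - xh)) (A *m (x - xh)) <=
  W / 32 * (dot (x' - x) (x' - x) + dot d d + dot eps eps).
Proof.
rewrite -!enorm_sq; have := iterate_error_bound x'_crit xh_crit etaE.
set S := _ + _ + enorm eps => h1.
have S0 : 0 <= S by rewrite !addr_ge0 ?enorm_ge0.
have R0 : 0 <= R2 by rewrite addr_ge0 // divr_ge0 // ltW.
have h2 : enorm (A *m (x - xh)) ^+ 2 <= nA ^+ 2 * R2 ^+ 2 * S ^+ 2.
  rewrite -!exprMn ler_pXn2r ?nnegrE ?mulr_ge0 ?enorm_ge0 //.
  by apply: le_trans (A_le _) _; rewrite -mulrA ler_wpM2l.
have := ler_wpM2l (ltW alpha0) h2; rewrite mulrA.
have := ler_wpM2r (sqr_ge0 S) alpha_small.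
have := ler_wpM2l (ltW W0) (sq3 (enorm (x' - x)) (enorm d) (enorm eps)); rewrite -/S.
lra.
Qed.

Let tau := 3 / 8 * W.

(** The step decreases the potential by [W / 2 * |x' - x|^2]; the choice
    [tau = 3 / 8 * W] splits it between the next momentum term and what remains
    after the momentum term [W / 4 * |d|^2] of this step and the errors. *)
Lemma lyapunov_descent :
  lyapunov tau x' (x' - x) z' lam' xh' xs'
  + W / 32 * (dot (x' - x) (x' - x) + dot d d)
  + alpha / 2 * dot (A *m xh) (A *m xh)
  + kappa * beta / 4 * dot (x' - z) (x' - z) <=
  lyapunov tau x d z lam xh0 xs + (4 / W + W / 32) * dot eps eps.
Proof.
have Axs : A *m xs = 0 by case: xs_crit => [[]].
have Cxs : C xs by case: xs_crit => [[]].
have h1 := primal_descent Cx x'_crit.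
have h2 := values_change xh0_crit xh_crit xh'_crit.1 Axs Cxs xs'_crit.
have h3 := constraint_error; have h4 := cross_term_le.
have dz : z' - z = beta *: (x' - z) by rewrite /z' addrAC subrr add0r.
have h5 : augmented x' z' lam' = augmented x' z lam'
    - kappa / 2 * (2 * beta - beta ^+ 2) * dot (x' - z) (x' - z).
  rewrite /augmented; have -> : x' - z' = (1 - beta) *: (x' - z).
    by rewrite /z'; vector_ring.
  by rewrite dotZl dotZr; ring.
have h6 : augmented x z lam' = augmented x z lam + alpha * dot (A *m x) (A *m x).
  by rewrite /augmented /lam' dotDl dotZl; ring.
have h7 : dot (A *m (x - xh)) (A *m (x - xh)) = dot (A *m x) (A *m x)
    - 2 * dot (A *m x) (A *m xh) + dot (A *m xh) (A *m xh).
  by rewrite mulmxBr !dotE (dotC (A *m xh) (A *m x)); ring.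
have W8 : 0 < W / 8 by rewrite divr_gt0.
have h8 := dot_young (- (x' - x)) eps W8.
rewrite dotNl dotNl dotNr opprK (dotC (x' - x) eps) in h8.
have e8 : (2 * (W / 8))^-1 = 4 / W by field; rewrite gt_eqF.
rewrite e8 in h8.
have eta2 : eta ^+ 2 <= E ^+ 2.
  by rewrite ler_pXn2r ?nnegrE //; case/andP: etaE.
have gmu : 0 <= gamma - mu by rewrite subr_ge0 ltW // (le_lt_trans muL).
have h9 : (gamma - mu) / 2 * (eta ^+ 2 * dot d d) <= W / 4 * dot d d.
  rewrite mulrA ler_wpM2r ?dot_ge0 //.
  have := ler_wpM2l gmu eta2; have := mulr_ge0 (ltW L0) (sqr_ge0 E).
  by move: E_small; have := L0; lra.
rewrite dz dotZl dotZr !mulrA in h4.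
have h10 : Z * beta * beta * dot (x' - z) (x' - z) <=
    kappa * beta / 4 * dot (x' - z) (x' - z).
  rewrite ler_wpM2r ?dot_ge0 // [_ * beta * _]mulrAC -mulrA mulrC.
  by have := ler_wpM2r (ltW beta0) beta_small; lra.
have h11 : kappa * beta / 2 * dot (x' - z) (x' - z) <=
    kappa / 2 * (2 * beta - beta ^+ 2) * dot (x' - z) (x' - z).
  rewrite ler_wpM2r ?dot_ge0 //.
  have : 0 <= kappa * beta * (1 - beta).
    by rewrite !mulr_ge0 ?(ltW kappa0) ?(ltW beta0) // subr_ge0.
  by lra.
rewrite /lyapunov h5; rewrite h6 in h1; rewrite /tau.
rewrite dz dotZl in h2; rewrite dotZl in h4.
rewrite h7 in h3; rewrite -/W in h1.
move: (augmented x' z lam') (augmented x z lam) h1 h2 => p1 p2.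
move: (moreau xs' z') (moreau xs z) (augmented xh' z' lam') (augmented xh0 z lam).
move=> q1 q2 q3 q4; have := mulr_ge0 (ltW W0) (dot_ge0 d).
lra.
Qed.

Definition gap_const := 3 + L * E + gamma * (1 + E) + c * nA ^+ 2
  + (c * nA ^+ 2 + nA) * R2 + c * nA + kappa.

Let sq5 (a b e h y : R) :
  (a + b + e + h + y) ^+ 2 <= 5 * (a ^+ 2 + b ^+ 2 + e ^+ 2 + h ^+ 2 + y ^+ 2).
Proof.
have := sqr_ge0 (a - b); have := sqr_ge0 (a - e); have := sqr_ge0 (b - e).
have := sqr_ge0 (a - h); have := sqr_ge0 (b - h); have := sqr_ge0 (e - h).
have := sqr_ge0 (a - y); have := sqr_ge0 (b - y); have := sqr_ge0 (e - y).
have := sqr_ge0 (h - y); lra.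
Qed.

Lemma gap_le_residuals :
  critical C rho (u - (x - g x - A^T *m lam')) u ->
  dot (x - u) (x - u) + dot (A *m x) (A *m x) <= 10 * gap_const ^+ 2 *
  (dot (x' - x) (x' - x) + dot d d + dot eps eps + dot (A *m xh) (A *m xh)
   + dot (x' - z) (x' - z)).
Proof.
move=> u_crit; have h1 := stationarity_gap_le xh x'_crit etaE u_crit.
have h2 := primal_error_bound x'_crit xh_crit etaE.
have h3 := iterate_error_bound x'_crit xh_crit etaE.
have h4 : enorm (A *m x) <= enorm (A *m xh) + nA * enorm (x - xh).
  have -> : A *m x = A *m xh + A *m (x - xh) by rewrite mulmxBr; vector_ring.
  by apply: le_trans (enormD _ _) _; rewrite lerD2l.
rewrite -!enorm_sq; move: h1 h2 h3 h4.
move: (enorm_ge0 (x' - x)) (enorm_ge0 d) (enorm_ge0 eps) (enorm_ge0 (A *m xh))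
  (enorm_ge0 (x' - z)) (enorm_ge0 (x - u)) (enorm_ge0 (A *m x)) (enorm_ge0 (x' - xh))
  (enorm_ge0 (x - xh)).
move: (enorm (x' - x)) (enorm d) (enorm eps) (enorm (A *m xh)) (enorm (x' - z))
  (enorm (x - u)) (enorm (A *m x)) (enorm (x' - xh)) (enorm (x - xh)).
move=> a b e h y n1 n2 n3 n4 a0 b0 e0 h0 y0 n10 n20 n30 n40 h1 h2 h3 h4.
have S0 : 0 <= a + b + e + h + y by rewrite !addr_ge0.
have KR : residual_const E / (mu + kappa) <= R2 by rewrite /R2 lerDr.
have R0 : 0 <= R2 by rewrite addr_ge0 // divr_ge0 // ltW.
have abe : 0 <= a + b + e by rewrite !addr_ge0.
have absS : a + b + e <= a + b + e + h + y by rewrite -[leRHS]addrA lerDl addr_ge0.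
have n3S : n3 <= R2 * (a + b + e + h + y).
  by apply: le_trans h2 _; apply: ler_pM => //; rewrite divr_ge0 // ltW.
have n4S : n4 <= R2 * (a + b + e + h + y).
  by apply: le_trans h3 _; rewrite ler_wpM2l.
have gamma0 : 0 <= gamma by rewrite ltW // (lt_trans L0).
have LE0 : 0 <= L * E by rewrite mulr_ge0 // ltW.
have gE0 : 0 <= gamma * (1 + E) by rewrite mulr_ge0 // addr_ge0.
have cn0 : 0 <= c * nA by rewrite mulr_ge0 // ltW.
have cn2 : 0 <= c * nA ^+ 2 by rewrite mulr_ge0 ?sqr_ge0 // ltW.
have cnR : 0 <= c * nA ^+ 2 * R2 by rewrite mulr_ge0.
have nR : 0 <= nA * R2 by rewrite mulr_ge0.
set S := a + b + e + h + y in S0 absS n3S n4S *.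
have G0 : 0 <= gap_const by rewrite /gap_const mulrDl !addr_ge0 // ltW.
have p1 := ler_wpM2l cn2 n3S.
have p2 := ler_wpM2l nA0 n4S.
have p3 : L * E * b <= L * E * S by rewrite ler_wpM2l // /S; lra.
have p4 : gamma * (1 + E) * (a + b) <= gamma * (1 + E) * S.
  by rewrite ler_wpM2l // /S; lra.
have p5 : c * nA * h <= c * nA * S by rewrite ler_wpM2l // /S; lra.
have p6 : c * nA ^+ 2 * a <= c * nA ^+ 2 * S by rewrite ler_wpM2l // /S; lra.
have p7 : kappa * y <= kappa * S by rewrite ler_wpM2l ?(ltW kappa0) // /S; lra.
have q1 := mulr_ge0 LE0 S0; have q2 := mulr_ge0 gE0 S0; have q3 := mulr_ge0 cn0 S0.
have q4 := mulr_ge0 cn2 S0; have q5 := mulr_ge0 cnR S0; have q6 := mulr_ge0 nR S0.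
have q7 := mulr_ge0 (ltW kappa0) S0.
have aS : 2 * a + e <= 3 * S by rewrite /S; lra.
have hS : h <= S by rewrite /S; lra.
have n1S : n1 <= gap_const * S.
  by apply: le_trans h1 _; rewrite /gap_const; lra.
have n2S : n2 <= gap_const * S.
  by apply: le_trans h4 _; rewrite /gap_const; lra.
have sq n : 0 <= n -> n <= gap_const * S -> n ^+ 2 <= gap_const ^+ 2 * S ^+ 2.
  by move=> n0 nS; rewrite -exprMn ler_pXn2r ?nnegrE // mulr_ge0.
have := sq _ n10 n1S; have := sq _ n20 n2S.
have := ler_wpM2l (sqr_ge0 gap_const) (sq5 a b e h y); rewrite -/S.
lra.
Qed.

End Descent.
End Iteration.

(** * Trajectories *)

(** Quantified over the dimension and the functions, since [tau], [alpha] and the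
    other constants have to be uniform in them. *)
Definition descent_property {R : realType}
    (L mu gamma c kappa nA E tau alpha Ce beta C0 C1 : R) :=
  forall p ma mb (A : 'M[R]_(ma, p)) (B : 'M[R]_(mb, p)) (C : set 'cV[R]_p) rho f g,
  (forall x, enorm (A *m x) <= nA * enorm x) ->
  (forall x, enorm (B *m x) <= nA * enorm x) ->
  (forall x, 2 * dot x x <= dot (A *m x) (A *m x) + dot (B *m x) (B *m x)) ->
  curved f g mu L -> (forall x y, enorm (g x - g y) <= L * enorm (x - y)) ->
  forall (x d z eps x' xh0 xh xh' xs xs' u : 'cV[R]_p) (lam : 'cV[R]_ma) (eta : R),
  let s := x + eta *: d in
  let lam' := lam + alpha *: (A *m x) in
  let z' := z + beta *: (x' - z) in
  C x -> 0 <= eta <= E ->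
  critical C rho (step_grad A B gamma c kappa (g s + eps) s x z lam' x') x' ->
  critical C rho (augmented_grad A g c kappa xh0 z lam) xh0 ->
  critical C rho (augmented_grad A g c kappa xh z lam') xh ->
  critical C rho (augmented_grad A g c kappa xh' z' lam') xh' ->
  critical (fiber (C := C) A 0) rho (moreau_grad g kappa xs z) xs ->
  critical (fiber (C := C) A 0) rho (moreau_grad g kappa xs' z') xs' ->
  enorm (xh - xs) <= Ce * enorm (A *m xh) ->
  critical C rho (u - (x - g x - A^T *m lam')) u ->
  dot (x - u) (x - u) + dot (A *m x) (A *m x) <=
  C0 * (lyapunov A rho f c kappa tau x d z lam xh0 xs
        - lyapunov A rho f c kappa tau x' (x' - x) z' lam' xh' xs'
        + C1 * dot eps eps).

(** [tau] and [abar] are chosen before the error bound [Ce] is known, hence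
    independently of the polyhedra; [bbar] makes the loss due to the center, which
    is proportional to [beta ^+ 2 * Ce ^+ 2 / alpha], smaller than its gain. *)
Lemma gap_descent {R : realType} (L mu gamma c kappa nA E : R) :
  0 <= nA -> 0 < L -> mu <= L -> 3 * L < gamma -> 0 < c -> 0 < kappa ->
  0 < mu + kappa -> 0 <= E ->
  E ^+ 2 * (2 * (gamma - mu + 3 * L)) <= gamma + kappa + 2 * c - 3 * L ->
  exists tau abar, [/\ 0 < tau, 0 < abar <= c &
  forall alpha, 0 < alpha <= abar -> forall Ce : R,
  exists bbar, 0 < bbar <= 1 /\
  forall beta, 0 < beta < bbar ->
  exists C0 C1, [/\ 0 < C0, 0 < C1 &
  descent_property L mu gamma c kappa nA E tau alpha Ce beta C0 C1]].
Proof.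
move=> nA0 L0 muL gammaL3 c0 kappa0 m0 E0 E_small.
have gammaL : L < gamma by lra.
pose W := gamma + kappa + 2 * c; have W0 : 0 < W by rewrite /W; lra.
pose R2 := 1 + residual_const nA L gamma c E / (mu + kappa).
have N0 : 0 <= nA ^+ 2 * R2 ^+ 2 by rewrite mulr_ge0 // sqr_ge0.
have N1 : 0 < nA ^+ 2 * R2 ^+ 2 + 1 by lra.
exists (3 / 8 * W), (Num.min c (W / 96 / (nA ^+ 2 * R2 ^+ 2 + 1))); split.
- by rewrite mulr_gt0 // divr_gt0.
- by rewrite lt_min c0 /= !divr_gt0 //= ge_min lexx.
move=> alpha /andP[alpha0]; rewrite le_min => /andP[_ alpha1] Ce.
have alpha_small : alpha * (nA ^+ 2 * R2 ^+ 2) <= W / 96.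
  apply: le_trans (_ : alpha * (nA ^+ 2 * R2 ^+ 2 + 1) <= _); last by rewrite -ler_pdivlMr.
  by rewrite ler_wpM2l ?(ltW alpha0) //; lra.
pose Z := 2 * kappa ^+ 2 / (mu + kappa) + 2 * kappa ^+ 2 * Ce ^+ 2 / alpha.
have Z0 : 0 < Z.
  rewrite ltr_pwDl //; first by rewrite divr_gt0 // mulr_gt0 // exprn_gt0.
  apply: divr_ge0; last exact: ltW.
  by apply: mulr_ge0; [apply: mulr_ge0 | ]; rewrite ?sqr_ge0.
exists (Num.min 1 (kappa / 4 / Z)); split.
  by rewrite lt_min ltr01 /= !divr_gt0 //= ge_min lexx.
move=> beta /andP[beta0]; rewrite lt_min => /andP[/ltW beta1 beta2].
have beta_small : beta * Z <= kappa / 4 by rewrite -ler_pdivlMr // ltW.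
pose k0 := Num.min (W / 32) (Num.min (alpha / 2) (kappa * beta / 4)).
have k00 : 0 < k0 by rewrite !lt_min !divr_gt0 // mulr_gt0.
have [k1 k2 k3] : [/\ k0 <= W / 32, k0 <= alpha / 2 & k0 <= kappa * beta / 4].
  by rewrite /k0 !ge_min !lexx !orbT.
pose G := 10 * (gap_const nA L mu gamma c kappa E) ^+ 2.
have G0 : 0 <= G by rewrite mulr_ge0 // sqr_ge0.
have W4 : 0 < 4 / W by rewrite divr_gt0.
exists ((G + 1) / k0), (4 / W + W / 32 + k0); split.
- by rewrite divr_gt0 //; lra.
- by rewrite !addr_gt0 // divr_gt0.
move=> p ma mb A B C rho f g A_le B_le AB_ge f_curved g_lip.
move=> x d z eps x' xh0 xh xh' xs xs' u lam eta s lam' z' Cx etaE hx' h1 h2 h3 h4 h5 h6 h7.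
have h8 := lyapunov_descent nA0 A_le B_le AB_ge f_curved g_lip L0 muL gammaL c0 kappa0 m0
  E_small alpha0 alpha_small beta0 beta1 beta_small Cx etaE hx' h1 h2 h3 h4 h5 h6.
have h9 := gap_le_residuals nA0 A_le B_le f_curved g_lip L0 gammaL c0 kappa0 m0
  etaE hx' h2 h7.
rewrite -/lam' -/z' -/W in h8.
set V := lyapunov _ _ _ _ _ _ x d _ _ _ _ in h8 *.
set V' := lyapunov _ _ _ _ _ _ x' _ _ _ _ _ in h8 *.
rewrite -/G in h9; apply: (le_trans h9).
move: h8; move: (dot_ge0 (x' - x)) (dot_ge0 d) (dot_ge0 eps) (dot_ge0 (A *m xh))
  (dot_ge0 (x' - z)).
move: (dot _ _) (dot d d) (dot eps eps) (dot (A *m xh) _) (dot (x' - z) _).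
move=> a b e h y a0 b0 e0 h0 y0 h8.
have S0 : 0 <= a + b + e + h + y by rewrite !addr_ge0.
apply: le_trans (_ : (G + 1) * (a + b + e + h + y) <= _); first by rewrite ler_wpM2r //; lra.
rewrite -mulrA ler_wpM2l //; first lra.
rewrite ler_pdivlMl //.
have := ler_wpM2r (addr_ge0 a0 b0) k1; have := ler_wpM2r h0 k2; have := ler_wpM2r y0 k3.
lra.
Qed.

(** Summation over a trajectory: the potential telescopes and is bounded from
    below. *)
Lemma gap_sum_le {R : realType} p ma (A : 'M[R]_(ma, p)) C rho f g
    (c kappa tau C0 C1 flow mu L nA : R) (x z xh xs : nat -> 'cV[R]_p)
    (lam : nat -> 'cV[R]_ma) (gap err : nat -> R) :
  0 <= nA -> (forall v, enorm (A *m v) <= nA * enorm v) ->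
  curved f g mu L -> 0 < c -> 0 < kappa -> 0 < mu + kappa -> 0 <= tau -> 0 < C0 ->
  (forall v, C v -> A *m v = 0 -> flow <= f v + rho v) ->
  (forall k, C (x k)) ->
  (forall k, critical C rho (augmented_grad A g c kappa (xh k) (z k) (lam k)) (xh k)) ->
  (forall k, critical (fiber (C := C) A 0) rho (moreau_grad g kappa (xs k) (z k)) (xs k)) ->
  let V k := lyapunov A rho f c kappa tau (x k) (x k - x k.-1) (z k) (lam k) (xh k) (xs k) in
  (forall k, gap k <= C0 * (V k - V k.+1 + C1 * err k)) ->
  forall K, \sum_(k < K) gap k <= C0 * (V 0%N - flow + C1 * \sum_(k < K) err k).
Proof.
move=> nA0 A_le f_curved c0 kappa0 m0 tau0 C00 flow_le Cx xhP xsP V gapV K.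
have VK : flow <= V K.
  have [[Cs As] _] := xsP K; apply: le_trans (flow_le _ Cs As) _.
  exact: (lyapunov_ge nA0 A_le f_curved c0 kappa0 m0 _ tau0 (Cx K) (xhP K) Cs As).
apply: le_trans (_ : C0 * (V 0%N - V K + C1 * \sum_(k < K) err k) <= _); last first.
  by rewrite ler_wpM2l ?(ltW C00) // lerD2r lerB.
elim: K {VK} => [|K IH]; first by rewrite !big_ord0 subrr mulr0 addr0 mulr0.
by rewrite !big_ord_recr /=; have := gapV K; lra.
Qed.

(** * Polyhedral regularizers over a network *)

Section Blocks.
Context {R : realType}.

Lemma sum_mxtens m n (F : 'I_(m * n) -> R) :
  \sum_l F l = \sum_i \sum_k F (mxtens_index (i, k)).
Proof.
rewrite pair_big (reindex (@mxtens_index m n)) /=.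
  by apply: eq_bigr => -[].
by exists (@mxtens_unindex m n) => l _; rewrite ?mxtens_indexK ?mxtens_unindexK.
Qed.

Lemma dot_blocks m n (x y : 'cV[R]_(m * n)) :
  dot x y = \sum_i dot (block x i) (block y i).
Proof.
rewrite /dot sum_mxtens; apply: eq_bigr => i _; apply: eq_bigr => k _.
by rewrite !mxE.
Qed.

Lemma block_stack m n (x_ : 'I_m -> 'cV[R]_n) i : block (stack x_) i = x_ i.
Proof.
by apply/matrixP => k j; rewrite !mxE mxtens_indexK (ord1 j).
Qed.

Lemma blockD m n (x y : 'cV[R]_(m * n)) i : block (x + y) i = block x i + block y i.
Proof. by apply/matrixP => k j; rewrite !mxE. Qed.

Lemma blockZ m n a (x : 'cV[R]_(m * n)) i : block (a *: x) i = a *: block x i.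
Proof. by apply/matrixP => k j; rewrite !mxE. Qed.

Lemma blockB m n (x y : 'cV[R]_(m * n)) i : block (x - y) i = block x i - block y i.
Proof. by apply/matrixP => k j; rewrite !mxE. Qed.

Lemma enorm_block m n (x : 'cV[R]_(m * n)) i : enorm (block x i) <= enorm x.
Proof.
rewrite enorm_le ?enorm_ge0 // enorm_sq dot_blocks (bigD1 i) //= lerDl.
by apply: sumr_ge0 => j _; apply: dot_ge0.
Qed.

Lemma dot_col_mx m n (a b : 'cV[R]_m) (c d : 'cV[R]_n) :
  dot (col_mx a c) (col_mx b d) = dot a b + dot c d.
Proof.
rewrite /dot big_split_ord; congr (_ + _); apply: eq_bigr => i _.
  by rewrite !col_mxEu.
by rewrite !col_mxEd.
Qed.

End Blocks.

(** The incidence matrix acts on blocks as a difference along each edge, its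
    absolute value as a sum, and the parallelogram identity gives
    A^T A + B^T B = 2 D. *)
Section Network.
Context {R : realType} {N n : nat} (e : rel 'I_N).
Implicit Types (x : 'cV[R]_(N * n)) (l : 'I_#|edges e|).

Lemma edge_neq l : (enum_val l).1 != (enum_val l).2.
Proof.
have := enum_valP l; rewrite inE => /andP[_].
by apply: contraTneq => ->; rewrite ltnn.
Qed.

Lemma mul_tens1 (M : 'M[R]_(#|edges e|, N)) x l :
  block ((M *t (1%:M : 'M[R]_n)) *m x) l = \sum_i M l i *: block x i.
Proof.
apply/matrixP => k j; rewrite (ord1 j) !mxE summxE sum_mxtens.
apply: eq_bigr => i _; rewrite (bigD1 k) //= big1 ?addr0 => [|k' k'k].
  by rewrite tensmxE !mxE eqxx mulr1.
by rewrite tensmxE !mxE eq_sym (negbTE k'k) mulr0 mul0r.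
Qed.

Lemma Amx_block x l :
  block (Amx e *m x) l = block x (enum_val l).1 - block x (enum_val l).2.
Proof.
rewrite mul_tens1 (bigD1 (enum_val l).1) //= (bigD1 (enum_val l).2) /=; last first.
  by rewrite eq_sym edge_neq.
rewrite big1 ?addr0 => [|i /andP[i1 i2]]; last first.
  by rewrite mxE eq_sym (negbTE i1) eq_sym (negbTE i2) subrr scale0r.
rewrite !mxE !eqxx (negbTE (edge_neq l)) eq_sym (negbTE (edge_neq l)).
by rewrite subr0 sub0r scale1r scaleN1r.
Qed.

Lemma Bmx_tens : Bmx e = map_mx Num.norm (incidence R e) *t (1%:M : 'M[R]_n).
Proof.
apply/matrixP => u v; case: (mxtens_indexP u) => l k; case: (mxtens_indexP v) => i k'.
rewrite mxE !tensmxE normrM !mxE; congr (_ * _).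
by case: (_ == _); rewrite ?normr1 ?normr0.
Qed.

Lemma Bmx_block x l :
  block (Bmx e *m x) l = block x (enum_val l).1 + block x (enum_val l).2.
Proof.
rewrite Bmx_tens mul_tens1 (bigD1 (enum_val l).1) //= (bigD1 (enum_val l).2) /=; last first.
  by rewrite eq_sym edge_neq.
rewrite big1 ?addr0 => [|i /andP[i1 i2]]; last first.
  by rewrite !mxE eq_sym (negbTE i1) eq_sym (negbTE i2) subrr normr0 scale0r.
rewrite !mxE !eqxx (negbTE (edge_neq l)) eq_sym (negbTE (edge_neq l)).
by rewrite subr0 sub0r normrN normr1 !scale1r.
Qed.

Hypotheses (e_sym : symmetric e) (e_irr : irreflexive e).

Lemma sum_edges (F : 'I_N -> R) :
  \sum_(ij in edges e) (F ij.1 + F ij.2) = \sum_i (degree e i)%:R * F i.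
Proof.
have -> : \sum_(ij in edges e) (F ij.1 + F ij.2) =
    \sum_i \sum_j ((e i j && (i < j)%N)%:R * (F i + F j)).
  rewrite pair_big big_mkcond; apply: eq_bigr => -[i j] _ /=.
  by rewrite inE /=; case: ifP => _; rewrite ?mul1r ?mul0r.
under eq_bigr do (under eq_bigr do rewrite mulrDr; rewrite big_split).
rewrite big_split /= [X in _ + X]exchange_big -big_split; apply: eq_bigr => i _ /=.
rewrite -big_split /degree -sum1_card natr_sum mulr_suml [in RHS]big_mkcond /=.
apply: eq_bigr => j _; rewrite inE (e_sym j i) -mulrDl.
case eij: (e i j) => /=; last by rewrite addr0 mul0r.
by case: ltngtP eij => [||/val_inj ->]; rewrite ?addr0 ?add0r // e_irr.
Qed.

Lemma sum_Amx_Bmx x :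
  dot (Amx e *m x) (Amx e *m x) + dot (Bmx e *m x) (Bmx e *m x) =
  2 * \sum_i (degree e i)%:R * dot (block x i) (block x i).
Proof.
rewrite -sum_edges (dot_blocks (Amx e *m x)) (dot_blocks (Bmx e *m x)) -big_split /=.
rewrite [in RHS]big_enum_val mulr_sumr; apply: eq_bigr => l _ /=.
by rewrite Amx_block Bmx_block !dotE (dotC (block x (enum_val l).2)); ring.
Qed.

Lemma degree_le i : (degree e i <= N)%N.
Proof. by rewrite -[leqRHS]card_ord; apply: max_card. Qed.

Lemma sum_Amx_Bmx_le x :
  dot (Amx e *m x) (Amx e *m x) + dot (Bmx e *m x) (Bmx e *m x) <=
  (2 * N%:R) ^+ 2 * dot x x.
Proof.
rewrite sum_Amx_Bmx (dot_blocks x) !mulr_sumr; apply: ler_sum => i _.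
rewrite mulrA ler_wpM2r ?dot_ge0 //.
have N1 : 1 <= N%:R :> R by rewrite ler1n (leq_ltn_trans _ (ltn_ord i)).
have : (degree e i)%:R <= N%:R :> R by rewrite ler_nat degree_le.
by nra.
Qed.

Lemma Amx_le x : enorm (Amx e *m x) <= 2 * N%:R * enorm x.
Proof.
rewrite enorm_le ?mulr_ge0 ?enorm_ge0 ?ler0n // exprMn enorm_sq.
by apply: le_trans (sum_Amx_Bmx_le x); rewrite lerDl dot_ge0.
Qed.

Lemma Bmx_le x : enorm (Bmx e *m x) <= 2 * N%:R * enorm x.
Proof.
rewrite enorm_le ?mulr_ge0 ?enorm_ge0 ?ler0n // exprMn enorm_sq.
by apply: le_trans (sum_Amx_Bmx_le x); rewrite lerDr dot_ge0.
Qed.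

Lemma sum_Amx_Bmx_ge x : (forall i, (1 <= degree e i)%N) ->
  2 * dot x x <= dot (Amx e *m x) (Amx e *m x) + dot (Bmx e *m x) (Bmx e *m x).
Proof.
move=> d1; rewrite sum_Amx_Bmx (dot_blocks x) ler_pM2l //; apply: ler_sum => i _.
by rewrite ler_peMl ?dot_ge0 // ler1n.
Qed.

End Network.

Section Polyhedral.
Context {R : realType}.

(** A polyhedral lift already gives the convexity, the Lipschitz continuity and,
    by completeness, the closedness required of a nonsmooth part. *)
Lemma polyhedral_convex_part p P (J : finType) (a : J -> 'cV[R]_P)
    (X : 'M[R]_(p, P)) cost zeta C rho lift :
  polyhedral_lift a X cost zeta C rho lift -> C !=set0 -> convex_part C rho.
Proof.
move=> pl ne; have [M MP] := lift_lipschitz pl.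
have mix t x y : 0 <= t <= 1 -> C x -> C y -> C (t *: x + (1 - t) *: y) /\
    rho (t *: x + (1 - t) *: y) <= t * rho x + (1 - t) * rho y.
  move=> /andP[t0 t1] Cx Cy.
  have [|] := lift_epigraph pl (w := t *: lift x + (1 - t) *: lift y).
    move=> j; rewrite dotDr !dotZr; have := ler_wpM2l t0 (lift_feasible pl Cx j).
    have t1' : 0 <= 1 - t by rewrite subr_ge0.
    by have := ler_wpM2l t1' (lift_feasible pl Cy j); lra.
  by rewrite mulmxDr -!scalemxAr !(lift_proj pl) dotDr !dotZr !(lift_cost pl).
split=> //.
- move=> x xlim; have u_ex k : exists u, C u /\ enorm (x - u) <= k.+1%:R^-1.
    by have [|u] := xlim k.+1%:R^-1; rewrite ?invr_gt0 //; exists u.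
  have [u uP] := choice u_ex; pose M' := `|M| + 1.
  have M'0 : 0 < M' by rewrite ltr_wpDl.
  have near (eps : R) : 0 < eps -> exists k0, forall k, (k0 <= k)%N ->
      enorm (x - u k) <= eps.
    move=> eps0; have [k0 _ k0P] := near_infty_natSinv_lt (PosNum eps0).
    by exists k0 => k kk; have [_ h] := uP k; apply: (le_trans h); apply/ltW/k0P.
  have [eps eps0|w wlim] := @ecauchy_cvg R P (lift \o u).
    have [k0 k0P] := near (eps / M' / 2) (divr_gt0 (divr_gt0 eps0 M'0) (ltr0n _ 2)).
    exists k0 => i j ki kj; apply: le_trans (MP _ _ (uP i).1 (uP j).1) _.
    have := enorm_dist (u i) x (u j); rewrite (enormBC (u i) x).
    have := k0P _ ki; have := k0P _ kj => h1 h2 h3.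
    have h4 : enorm (u i - u j) <= eps / M' by lra.
    have : M * enorm (u i - u j) <= M' * enorm (u i - u j).
      by rewrite ler_wpM2r ?enorm_ge0 // /M'; have := ler_norm M; lra.
    move/le_trans; apply; rewrite -ler_pdivlMl //.
    by rewrite mulrC.
  have [|] := lift_epigraph pl (w := w).
    move=> j; apply: (ler_addeps (enorm_ge0 (a j))) => eps eps0.
    have [k0 /(_ _ (leqnn _)) h] := wlim _ eps0.
    have := lift_feasible pl (uP k0).1 j.
    have := dot_le (a j) (lift (u k0) - w); rewrite dotDr dotNr.
    by have := ler_wpM2l (enorm_ge0 (a j)) h; rewrite /=; lra.
  suff -> : X *m w = x by [].
  apply/eqP; rewrite -subr_eq0; apply/eqP/enorm_eq0/eqP; rewrite eq_le enorm_ge0 andbT.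
  have [K K0 KP] := mulmx_bounded X.
  have K1 : 0 <= K + 1 by rewrite addr_ge0.
  apply: (ler_addeps K1) => eps eps0; rewrite add0r.
  have [k0 h0] := wlim _ eps0; have [k1 h1] := near _ eps0.
  have := enorm_dist (X *m w) (X *m lift (u (maxn k0 k1))) x.
  rewrite {2}(lift_proj pl) -mulmxBr.
  have := KP (w - lift (u (maxn k0 k1))); have h2 := h1 _ (leq_maxr k0 k1).
  have h3 := ler_wpM2l K0 (h0 _ (leq_maxl k0 k1)).
  by move: h2 h3; rewrite /= (enormBC x (u _)) (enormBC _ w); lra.
- by move=> t x y t01 Cx Cy; have [] := mix t x y t01 Cx Cy.
- by move=> t x y t01 Cx Cy; have [] := mix t x y t01 Cx Cy.
exists (enorm cost * `|M|) => [|x y Cx Cy]; first by rewrite mulr_ge0 ?enorm_ge0.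
rewrite -!(lift_cost pl) -dotNr -dotDr; apply: le_trans (dot_le _ _) _.
rewrite -mulrA ler_wpM2l ?enorm_ge0 //; apply: le_trans (MP _ _ Cx Cy) _.
by rewrite ler_wpM2r ?enorm_ge0 // ler_norm.
Qed.

Lemma fin_num_of_epigraph n (r : 'cV[R]_n -> \bar R) x (y : R) :
  proper_function r -> (r x <= y%:E)%E -> r x = (fine (r x))%:E.
Proof.
move=> [nminf _] rxy; rewrite fineK // fin_numE nminf /=.
by apply: contraTneq rxy => ->; rewrite leye_eq.
Qed.

Section OneBlock.
Variables (n q : nat) (S : 'M[R]_(q, n)) (s zeta : 'cV[R]_q) (r : 'cV[R]_n -> \bar R).
Hypothesis r_proper : proper_function r.
Hypothesis r_epi : epigraph r =
  [set xy | forall l, zeta l 0 <= (S *m xy.1 + xy.2 *: s) l 0].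

Lemma epigraphP x (y : R) : (r x <= y%:E)%E <->
  forall l, zeta l 0 <= (S *m x) l 0 + y * s l 0.
Proof.
have : epigraph r (x, y) <-> (r x <= y%:E)%E by [].
rewrite r_epi /= => <-; split=> h l; have := h l; rewrite !mxE //=.
Qed.

(** An epigraph is closed under upward translations. *)
Lemma epigraph_slope_ge0 l : 0 <= s l 0.
Proof.
have [nm [x rx]] := r_proper; have rE : r x = (fine (r x))%:E.
  by rewrite fineK // fin_numE nm /=; apply: contraTneq rx => ->; rewrite ltxx.
set y := fine (r x) in rE; rewrite leNgt; apply/negP => sl.
pose b := (S *m x) l 0 + y * s l 0 - zeta l 0.
have := (epigraphP x (y + (`|b| + 1) / - s l 0)).1.
have le : (r x <= (y + (`|b| + 1) / - s l 0)%:E)%E.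
  by rewrite rE lee_fin lerDl divr_ge0 ?addr_ge0 // oppr_ge0 ltW.
move=> /(_ le l); rewrite mulrDl.
have -> : (`|b| + 1) / - s l 0 * s l 0 = - (`|b| + 1) by field; rewrite lt_eqF.
by have := ler_norm b; rewrite /b; lra.
Qed.

(** The rows with a positive slope in the epigraph bound the growth of [r], the
    others only delimit its domain. *)
Lemma epigraph_lipschitz : exists2 M, 0 <= M & forall x y (v w : R),
  (r x <= v%:E)%E -> (r y <= w%:E)%E -> fine (r x) - fine (r y) <= M * enorm (x - y).
Proof.
have [K K0 KP] := mulmx_bounded S.
have s0 := epigraph_slope_ge0.
have M0 : 0 <= \sum_l K / s l 0 by apply: sumr_ge0 => l _; rewrite divr_ge0.
exists (\sum_l K / s l 0) => // x y v w rx ry; set M := \sum_l _ in M0 *.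
have rxE := fin_num_of_epigraph r_proper rx.
have ryE := fin_num_of_epigraph r_proper ry.
rewrite lerBlDl -lee_fin -rxE; apply/epigraphP => l.
have ey : zeta l 0 <= (S *m y) l 0 + fine (r y) * s l 0.
  by apply: (epigraphP y _).1; rewrite -ryE.
have ex : zeta l 0 <= (S *m x) l 0 + fine (r x) * s l 0.
  by apply: (epigraphP x _).1; rewrite -rxE.
have [sl0|sl] := eqVneq (s l 0) 0; first by move: ex; rewrite sl0 !mulr0.
have {}sl : 0 < s l 0 by rewrite lt_def sl s0.
have KM : K <= M * s l 0.
  rewrite -ler_pdivrMr // /M (bigD1 l) //= lerDl.
  by apply: sumr_ge0 => i _; rewrite divr_ge0.
have := le_trans (coord_le_enorm (S *m (y - x)) l) (KP (y - x)).
rewrite enormBC mulmxBr !mxE => /(le_trans (ler_norm _)) h.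
have := ler_wpM2r (enorm_ge0 (x - y)) KM.
move: ey h; rewrite !mxE; lra.
Qed.

End OneBlock.

Section Regularizer.
Variables (N n : nat) (q : 'I_N -> nat).
Variables (Sx : forall i, 'M[R]_(q i, n)) (Sy zeta : forall i, 'cV[R]_(q i)).

(** The epigraphs of all agents form one polyhedron in the variables
    [(x, y_1, .., y_N)], with the rows of all [Sx i] and cost [y_1 + .. + y_N]. *)
Definition row_index : finType := {i : 'I_N & 'I_(q i)}.

Definition lift_row (j : row_index) : 'cV[R]_(N * n + N) :=
  col_mx (stack (fun i => if i == tag j then (row (tagged j) (Sx (tag j)))^T else 0))
         (Sy (tag j) (tagged j) 0 *: delta_mx (tag j) 0).

Definition lift_proj_mx : 'M[R]_(N * n, N * n + N) := row_mx 1%:M 0.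

Definition lift_cost_vec : 'cV[R]_(N * n + N) := col_mx 0 (const_mx 1).

Lemma dot_lift_row j (x : 'cV[R]_(N * n)) (y : 'cV[R]_N) :
  dot (lift_row j) (col_mx x y) =
  (Sx (tag j) *m block x (tag j)) (tagged j) 0 + y (tag j) 0 * Sy (tag j) (tagged j) 0.
Proof.
rewrite dot_col_mx; congr (_ + _).
  rewrite dot_blocks (bigD1 (tag j)) //= big1 ?addr0 => [|i ij]; last first.
    by rewrite block_stack (negbTE ij) dot0l.
  by rewrite block_stack eqxx /dot mxE; apply: eq_bigr => k _; rewrite !mxE.
rewrite dotZl mulrC; congr (_ * _); rewrite /dot (bigD1 (tag j)) //= big1 ?addr0.
  by rewrite mxE !eqxx mul1r.
by move=> i ij; rewrite mxE (negbTE ij) mul0r.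
Qed.

Variable r_ : 'I_N -> 'cV[R]_n -> \bar R.
Hypothesis r_proper : forall i, proper_function (r_ i).
Hypothesis r_poly : assumption2 Sx Sy zeta r_.

Definition rdom : set 'cV[R]_(N * n) := [set x | (rsum r_ x < +oo)%E].

Definition rfin (x : 'cV[R]_(N * n)) : R := \sum_i fine (r_ i (block x i)).

Lemma rdomP x : rdom x <-> forall i, r_ i (block x i) = (fine (r_ i (block x i)))%:E.
Proof.
split=> [rx i|h]; last first.
  by rewrite /rdom /= /rsum (eq_bigr _ (fun i _ => h i)) sumEFin ltry.
rewrite fineK // fin_numE (r_proper i).1 /=; apply: contraTneq rx => ri.
rewrite /rsum -leNgt leye_eq; apply/eqP/esum_eqyP => [j _|]; first exact: (r_proper j).1.
by exists i; split.
Qed.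

Lemma rsumE x : rdom x -> rsum r_ x = (rfin x)%:E.
Proof. by move=> /rdomP h; rewrite /rsum (eq_bigr _ (fun i _ => h i)) sumEFin. Qed.

Lemma rsum_ninfty x : ~ rdom x -> rsum r_ x = +oo%E.
Proof. by move=> nx; apply/eqP; rewrite -leye_eq leNgt; apply/negP. Qed.

Definition rlift (x : 'cV[R]_(N * n)) : 'cV[R]_(N * n + N) :=
  col_mx x (\col_i fine (r_ i (block x i))).

Lemma rlift_polyhedral : polyhedral_lift lift_row lift_proj_mx lift_cost_vec
  (fun j => zeta (tag j) (tagged j) 0) rdom rfin rlift.
Proof.
have epi i x (y : R) : (r_ i x <= y%:E)%E <->
    forall l, zeta i l 0 <= (Sx i *m x) l 0 + y * Sy i l 0.
  exact: epigraphP (r_poly i) _ _.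
split.
- move=> x /rdomP rx [i l]; rewrite dot_lift_row [(\col__ _) _ _]mxE.
  have := (epi i (block x i) (fine (r_ i (block x i)))).1; rewrite -rx => /(_ (lexx _)).
  exact.
- by move=> x; rewrite mul_row_col mul1mx mul0mx addr0.
- move=> x; rewrite dot_col_mx dot0l add0r; apply: eq_bigr => i _.
  by rewrite !mxE mul1r.
- move=> w fw; rewrite -[w]vsubmxK mul_row_col mul1mx mul0mx addr0.
  set x := usubmx w; set y := dsubmx w.
  have le i : (r_ i (block x i) <= (y i 0)%:E)%E.
    apply/epi => l; have := fw (Tagged (fun i => 'I_(q i)) l).
    by rewrite -[w in dot _ w]vsubmxK dot_lift_row.
  have fin i := fin_num_of_epigraph (r_proper i) (le i).
  split; first exact/rdomP.
  rewrite dot_col_mx dot0l add0r; apply: ler_sum => i _.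
  by rewrite mxE mul1r -lee_fin -fin.
have M_ex i : exists M, 0 <= M /\ forall x y (v w : R),
    (r_ i x <= v%:E)%E -> (r_ i y <= w%:E)%E ->
    fine (r_ i x) - fine (r_ i y) <= M * enorm (x - y).
  by have [M] := epigraph_lipschitz (r_proper i) (r_poly i); exists M.
have [M MP] := choice M_ex.
exists (1 + \sum_i M i) => x y /rdomP rx /rdomP ry.
have -> : rlift x - rlift y = col_mx (x - y)
    (\col_i (fine (r_ i (block x i)) - fine (r_ i (block y i)))).
  rewrite /rlift opp_col_mx add_col_mx; congr (col_mx _ _).
  by apply/matrixP => i j; rewrite !mxE.
have split_le p1 p2 (a : 'cV[R]_p1) (b : 'cV[R]_p2) : enorm (col_mx a b) <= enorm a + enorm b.
  rewrite enorm_le ?addr_ge0 ?enorm_ge0 // dot_col_mx sqrrD !enorm_sq.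
  by rewrite addrAC lerDl mulrn_wge0 // mulr_ge0 ?enorm_ge0.
apply: le_trans (split_le _ _ _ _) _; rewrite mulrDl mul1r lerD2l.
apply: le_trans (enorm_le_sum _) _; rewrite mulr_suml; apply: ler_sum => i _.
have le1 z : (forall i, r_ i (block z i) = (fine (r_ i (block z i)))%:E) ->
    (r_ i (block z i) <= (fine (r_ i (block z i)))%:E)%E by move=> ->.
have h1 := (MP i).2 _ _ _ _ (le1 _ rx) (le1 _ ry).
have h2 := (MP i).2 _ _ _ _ (le1 _ ry) (le1 _ rx).
rewrite -blockB in h1; rewrite enormBC -blockB in h2.
have h3 := ler_wpM2l (MP i).1 (enorm_block (x - y) i).
by rewrite mxE ler_norml; apply/andP; split; lra.
Qed.

End Regularizer.
End Polyhedral.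

(** * The problem data *)

Section Smooth.
Context {R : realType} {p : nat}.
Implicit Types (h : 'cV[R]_p -> R) (x y d : 'cV[R]_p).

Lemma derive_grad h x d : differentiable h x -> 'D_d h x = dot (grad h x) d.
Proof.
move=> dh; rewrite deriveE // [in LHS](matrix_sum_delta d) linear_sum /=.
by apply: eq_bigr => k _; rewrite big_ord1 linearZ /= mxE deriveE // mulrC.
Qed.

Lemma is_derive_line h y d (t : R) : (forall x, differentiable h x) ->
  is_derive t 1 (fun t : R => h (y + t *: d)) (dot (grad h (y + t *: d)) d).
Proof.
move=> dh; rewrite -derive_grad //.
have E : (fun s : R => s^-1 *: (((fun t : R => h (y + t *: d)) \o shift t) (s *: (1 : R))
      - h (y + t *: d))) =
    (fun s : R => s^-1 *: ((h \o shift (y + t *: d)) (s *: d) - h (y + t *: d))).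
  apply/funext => s /=; congr (_ *: (h _ - _)).
  by rewrite /shift /= [s *: 1]mulr1 scalerDl addrCA.
apply: DeriveDef.
  by rewrite /derivable E; apply: diff_derivable.
by rewrite /derive E.
Qed.

(** Mean value theorem for [h (y + t d) - a t - b t^2] on the segment from [y] to
    [x = y + d]: the derivative is at most 0 for this [b]. *)
Lemma descent_lemma h (L : R) : 0 <= L -> (forall x, differentiable h x) ->
  (forall x y, enorm (grad h x - grad h y) <= L * enorm (x - y)) ->
  forall x y, h x <= h y + dot (grad h y) (x - y) + L / 2 * dot (x - y) (x - y).
Proof.
move=> L0 dh gL x y; set d := x - y; set D := dot d d.
pose a := dot (grad h y) d; pose b := L / 2 * D.
pose psi := (fun t : R => h (y + t *: d)) - (fun t : R => a * t + b * t ^+ 2).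
have psi' (t : R) : is_derive t 1 psi (dot (grad h (y + t *: d)) d - (a + b * (2 * t))).
  have q' : is_derive t 1 (fun t : R => a * t + b * t ^+ 2) (a + b * (2 * t)).
    have := is_deriveD (is_deriveZ a (is_derive_id t (1 : R)))
      (is_deriveZ b (is_deriveX 2 (is_derive_id t (1 : R)))).
    by rewrite /GRing.scale /= !mulr1.
  exact: is_deriveB (is_derive_line y d t dh) q'.
have cpsi : {within `[0, 1], continuous psi}.
  by apply: derivable_within_continuous => t _; exact: ex_derive.
have [t t01] := MVT (@ltr01 R) (fun t _ => psi' t) cpsi.
rewrite /psi !fctE subr0 mulr1 scale1r scale0r addr0 subrKC.
have /andP[t0 t1] : 0 < t < 1 by move: t01; rewrite in_itv.
have h1 : dot (grad h (y + t *: d) - grad h y) d <= L * t * D.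
  apply: le_trans (dot_le _ _) _; rewrite /D -enorm_sq expr2 mulrA ler_wpM2r ?enorm_ge0 //.
  apply: le_trans (gL _ _) _; rewrite addrAC subrr add0r enormZ gtr0_norm //.
  by rewrite mulrA.
move: h1; rewrite dotDl dotNl -/a /b => h1 h2.
by lra.
Qed.

End Smooth.

Section Problem.
Context {R : realType} {N n : nat} (e : rel 'I_N) (q : 'I_N -> nat).
Variables (Sx : forall i, 'M[R]_(q i, n)) (Sy zeta : forall i, 'cV[R]_(q i)).
Variables (f_ : 'I_N -> 'cV[R]_n -> R) (r_ : 'I_N -> 'cV[R]_n -> \bar R).
Variables (L mu flow : R).
Hypothesis L0 : 0 <= L.
Hypothesis problem : consensus_problem e f_ r_.
Hypothesis smooth : assumption1 e L mu flow f_ r_.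
Hypothesis polyhedral : assumption2 Sx Sy zeta r_.
Implicit Types (x z v s u : 'cV[R]_(N * n)) (lam : 'cV[R]_(#|edges e| * n)).

Local Notation A := (@Amx R N n e).
Local Notation B := (@Bmx R N n e).
Local Notation f := (fsum f_).
Local Notation g := (grad (fsum f_)).
Local Notation C := (rdom r_).
Local Notation rho := (rfin r_).

Lemma regularizer_convex : convex_part C rho.
Proof.
apply: polyhedral_convex_part (rlift_polyhedral (cp_proper problem) polyhedral) _.
by have [x [_ rx]] := cp_feasible problem; exists x.
Qed.

Lemma fsum_curved : curved f g mu L.
Proof.
move=> x y; have := a1_lower_curvature smooth x y; rewrite enorm_sq => h.
apply/andP; split; first by lra.
exact: descent_lemma L0 (a1_differentiable smooth) (a1_lipschitz smooth) x y.
Qed.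

Lemma objective_fin (a : R) x : C x -> (a%:E + rsum r_ x)%E = (a + rho x)%:E.
Proof. by move=> Cx; rewrite (rsumE (cp_proper problem) Cx) EFinD. Qed.

Lemma argmin_critical (h : 'cV[R]_(N * n) -> R) dh m M x : curved h dh m M ->
  argmin (fun u => (h u)%:E + rsum r_ u)%E x -> critical C rho (dh x) x.
Proof.
move=> H xmin; have [y Cy] := cvx_nonempty regularizer_convex.
have Cx : C x.
  apply: contrapT => nCx; have := xmin y.
  by rewrite (objective_fin _ Cy) (rsum_ninfty nCx) addey // leye_eq.
apply: (minimizer_critical regularizer_convex H Cx) => u Cu.
by have := xmin u; rewrite !objective_fin.
Qed.

Lemma critical_argmin (h : 'cV[R]_(N * n) -> R) dh m M x : 0 <= m -> curved h dh m M ->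
  critical C rho (dh x) x -> argmin (fun u => (h u)%:E + rsum r_ u)%E x.
Proof.
move=> m0 H cx u; rewrite (objective_fin _ cx.1).
have [Cu|nCu] := pselect (C u); last by rewrite (rsum_ninfty nCu) addey // leey.
rewrite objective_fin // lee_fin; have := critical_growth H cx Cu.
have : 0 <= m / 2 * dot (u - x) (u - x) by rewrite mulr_ge0 ?dot_ge0 ?divr_ge0.
lra.
Qed.

Lemma prox_curved v : curved (fun u => 2^-1 * enorm (v - u) ^+ 2) (fun u => u - v) 1 1.
Proof.
move=> x y; have := curved_sq 1 v x y; rewrite !(enormBC v) !enorm_sq scale1r.
by rewrite div1r.
Qed.

Lemma prox_critical v : critical C rho (prox (rsum r_) v - v) (prox (rsum r_) v).
Proof.
have [u cu] := critical_exists regularizer_convex (prox_curved v) ltr01.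
apply: (argmin_critical (prox_curved v)).
exact: (xgetPex 0 (ex_intro _ u (critical_argmin ler01 (prox_curved v) cu))).
Qed.

Lemma prox_nonexpansive v1 v2 :
  enorm (prox (rsum r_) v1 - prox (rsum r_) v2) <= enorm (v1 - v2).
Proof. exact: critical_sq_nonexpansive (prox_critical v1) (prox_critical v2). Qed.

Lemma ereal_inf_attained (I : Type) (S : set I) (F : I -> \bar R) i :
  S i -> (forall j, S j -> (F i <= F j)%E) -> ereal_inf [set F j | j in S] = F i.
Proof.
move=> Si Fi; apply/eqP; rewrite eq_le; apply/andP; split.
  by apply: ereal_inf_lbound; exists i.
by apply: le_ereal_inf_tmp => _ [j Sj <-]; apply: Fi.
Qed.

Section Values.
Variables (c kappa : R).
Hypotheses (c0 : 0 < c) (kappa0 : 0 < kappa) (m0 : 0 < mu + kappa).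
Hypotheses (e_sym : symmetric e) (e_irr : irreflexive e).

Let A_le := @Amx_le R N n e e_sym e_irr.
Let cvx := regularizer_convex.
Let nA0 : 0 <= 2 * N%:R :> R. Proof. by rewrite mulr_ge0. Qed.

Lemma Lc_fin x z lam : C x -> Lc f_ r_ kappa c x z lam = (augmented A rho f c kappa x z lam)%:E.
Proof.
move=> Cx; rewrite /Lc objective_fin // !enorm_sq /augmented; congr (_%:E); ring.
Qed.

Lemma dual_valueE xh z lam : critical C rho (augmented_grad A g c kappa xh z lam) xh ->
  dual_value f_ r_ kappa c z lam = (augmented A rho f c kappa xh z lam)%:E.
Proof.
move=> ch; rewrite /dual_value -Lc_fin ?ch.1 //; last exact: ch.1.
apply: (@ereal_inf_attained _ setT (fun x => Lc f_ r_ kappa c x z lam)) => // u _.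
rewrite Lc_fin; last exact: ch.1.
have [Cu|nCu] := pselect (C u); last by rewrite /Lc (rsum_ninfty nCu) addey // leey.
by rewrite Lc_fin // lee_fin (augmented_growth nA0 A_le fsum_curved c0 m0 ch).
Qed.

Lemma primal_valueE xs z : critical (fiber (C := C) A 0) rho (moreau_grad g kappa xs z) xs ->
  primal_value e f_ r_ kappa z = (moreau rho f kappa xs z)%:E.
Proof.
move=> cs; have [Cs As] := cs.1.
have fin x : C x -> ((f x + kappa / 2 * enorm (x - z) ^+ 2)%:E + rsum r_ x)%E =
    (moreau rho f kappa x z)%:E.
  by move=> Cx; rewrite objective_fin // enorm_sq /moreau addrAC.
rewrite -fin // /primal_value.
apply: (@ereal_inf_attained _ [set x | A *m x = 0]
  (fun x => ((f x + kappa / 2 * enorm (x - z) ^+ 2)%:E + rsum r_ x)%E)) => // u Au.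
have [Cu|nCu] := pselect (C u); last by rewrite (rsum_ninfty nCu) addey // leey.
by rewrite !fin // lee_fin (moreau_growth fsum_curved m0 cs).
Qed.

Lemma augmented_min z lam : exists xh, critical C rho (augmented_grad A g c kappa xh z lam) xh.
Proof.
exact (critical_exists cvx (augmented_curved nA0 A_le kappa fsum_curved c0 z lam) m0).
Qed.

Lemma moreau_min z : exists xs, critical (fiber (C := C) A 0) rho (moreau_grad g kappa xs z) xs.
Proof.
have ne : fiber (C := C) A 0 !=set0 by have [x [Ax rx]] := cp_feasible problem; exists x.
exact (critical_exists (convex_part_fiber cvx ne) (moreau_curved kappa fsum_curved z) m0).
Qed.

Lemma initial_potentialE tau alpha x0 xh xs : C x0 ->
  critical C rho (augmented_grad A g c kappa xh x0 (- alpha *: (A *m x0))) xh ->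
  critical (fiber (C := C) A 0) rho (moreau_grad g kappa xs x0) xs ->
  initial_potential e f_ r_ kappa c tau alpha x0 =
  (lyapunov A rho f c kappa tau x0 (x0 - x0) x0 (- alpha *: (A *m x0)) xh xs)%:E.
Proof.
move=> Cx0 ch cs; rewrite /initial_potential /potential (dual_valueE ch).
by rewrite (primal_valueE cs) Lc_fin // enorm_sq.
Qed.

End Values.

Lemma objective_lower_bound x : C x -> A *m x = 0 -> flow <= f x + rho x.
Proof.
move=> Cx Ax; have := a1_lower_bound smooth Ax.
by rewrite objective_fin // lte_fin => /ltW.
Qed.

Lemma QgapE x lam : let u := prox (rsum r_) (x - g x - A^T *m lam) in
  Qgap f_ r_ x lam = dot (x - u) (x - u) + dot (A *m x) (A *m x).
Proof. by rewrite /= /Qgap !enorm_sq. Qed.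

Section StepMap.
Variables (gamma c kappa : R).
Hypotheses (gamma0 : 0 < gamma) (c0 : 0 < c) (kappa0 : 0 < kappa).
Hypotheses (e_sym : symmetric e) (e_irr : irreflexive e).

Definition step_objective v s y z lam x : R :=
  f s + dot v (x - s) + gamma / 2 * enorm (x - s) ^+ 2
  + dot lam (A *m x) + c / 2 * enorm (A *m x) ^+ 2
  + c / 2 * enorm (B *m (x - y)) ^+ 2 + kappa / 2 * enorm (x - z) ^+ 2.

Lemma step_curved v s y z lam :
  curved (step_objective v s y z lam) (fun x => step_grad A B gamma c kappa v s y z lam x)
    (gamma + kappa) (gamma + kappa + 2 * (c * (2 * N%:R) ^+ 2)).
Proof.
have sq_le k (M : 'M[R]_(k, N * n)) d : (forall x, enorm (M *m x) <= 2 * N%:R * enorm x) ->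
    dot (M *m d) (M *m d) <= (2 * N%:R) ^+ 2 * dot d d.
  move=> M_le; have := M_le d; rewrite enorm_le ?mulr_ge0 ?enorm_ge0 ?ler0n //.
  by rewrite exprMn enorm_sq.
move=> x w; rewrite /step_objective /step_grad !enorm_sq.
have -> : x = w + (x - w) by rewrite addrC subrK.
move: (x - w) => d; have -> : w + d - w = d by rewrite addrAC subrr add0r.
have h1 := ler_wpM2l (ltW c0) (sq_le _ _ d (@Amx_le R N n e e_sym e_irr)).
have h2 := ler_wpM2l (ltW c0) (sq_le _ _ d (@Bmx_le R N n e e_sym e_irr)).
have h3 := mulr_ge0 (ltW c0) (dot_ge0 (A *m d)).
have h4 := mulr_ge0 (ltW c0) (dot_ge0 (B *m d)).
have -> : w + d - y = (w - y) + d by rewrite addrAC.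
rewrite !(dotDl, dotNl, dotZl) -!dot_mulmxr !mulmxDr !dotE.
rewrite (dotC d w) (dotC s w) (dotC s d) (dotC z w) (dotC z d).
rewrite (dotC (A *m d) (A *m w)) (dotC (B *m d) (B *m w)) (dotC (B *m d)).
rewrite (dotC (B *m - y) (B *m w)).
by apply/andP; split; lra.
Qed.

Local Notation Phi b x := (step_grad A B gamma c kappa b 0 0 0 0 x).

(** The state enters the objective of an iteration only through this linear term;
    the next iterate is a function of it, Lipschitz by strong convexity and
    therefore measurable. *)
Definition step_input v s y z lam : 'cV[R]_(N * n) :=
  v - gamma *: s + A^T *m lam - c *: (B^T *m (B *m y)) - kappa *: z.

Definition step_solution (b : 'cV[R]_(N * n)) : 'cV[R]_(N * n) :=
  xget 0 [set x | critical C rho (Phi b x) x].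

Lemma step_grad_input v s y z lam x :
  step_grad A B gamma c kappa v s y z lam x = Phi (step_input v s y z lam) x.
Proof.
rewrite /step_grad /step_input !subr0 mulmx0 !(mulmxBr B) !(mulmxBr B^T).
by vector_ring.
Qed.

Lemma step_lipschitz b1 b2 x1 x2 :
  critical C rho (Phi b1 x1) x1 -> critical C rho (Phi b2 x2) x2 ->
  enorm (x1 - x2) <= (gamma + kappa)^-1 * enorm (b1 - b2).
Proof.
move=> c1 c2; have gk0 : 0 < gamma + kappa by rewrite addr_gt0.
have h1 := critical_monotone c1 c2.
have h2 := curved_monotone x1 x2 (step_curved b2 0 0 0 0).
have := dot_ge (b1 - b2) (x1 - x2).
have e12 : Phi b1 x1 - Phi b2 x2 = (b1 - b2) + (Phi b2 x1 - Phi b2 x2).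
  by rewrite /step_grad; vector_ring.
rewrite e12 dotDl in h1 => h3; rewrite ler_pdivlMl //.
have [->|n0] := eqVneq (enorm (x1 - x2)) 0; first by rewrite mulr0 enorm_ge0.
have {}n0 : 0 < enorm (x1 - x2) by rewrite lt_def n0 enorm_ge0.
rewrite -(ler_pM2r n0) -mulrA -expr2 enorm_sq; lra.
Qed.

Lemma step_solution_critical b : critical C rho (Phi b (step_solution b)) (step_solution b).
Proof.
have gk0 : 0 < gamma + kappa by rewrite addr_gt0.
have [x cx] := critical_exists regularizer_convex (step_curved b 0 0 0 0) gk0.
exact: (xgetPex 0 (ex_intro (fun x => critical C rho (Phi b x) x) x cx)).
Qed.

Lemma step_solution_lipschitz b1 b2 :
  enorm (step_solution b1 - step_solution b2) <= (gamma + kappa)^-1 * enorm (b1 - b2).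
Proof. exact: step_lipschitz (step_solution_critical b1) (step_solution_critical b2). Qed.

Lemma step_solutionE v s y z lam x :
  critical C rho (step_grad A B gamma c kappa v s y z lam x) x ->
  x = step_solution (step_input v s y z lam).
Proof.
rewrite step_grad_input => cx.
have h := step_lipschitz cx (step_solution_critical (step_input v s y z lam)); rewrite subrr enorm0 mulr0 in h.
by apply/eqP; rewrite -subr_eq0; apply/eqP/enorm_eq0/eqP; rewrite eq_le h enorm_ge0.
Qed.

Lemma sppdm_step_critical v s y z lam x :
  argmin (sppdm_objective f_ r_ gamma c kappa v s y z lam) x ->
  critical C rho (step_grad A B gamma c kappa v s y z lam x) x.
Proof. exact: (argmin_critical (step_curved v s y z lam)). Qed.

End StepMap.

Section Path.
Variables (gamma c kappa E tau alpha beta Ce C0 C1 : R).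
Hypotheses (c0 : 0 < c) (kappa0 : 0 < kappa) (m0 : 0 < mu + kappa).
Hypotheses (tau0 : 0 <= tau) (C00 : 0 < C0).
Hypotheses (e_sym : symmetric e) (e_irr : irreflexive e).
Hypothesis d1 : forall i, (1 <= degree e i)%N.
Hypothesis desc : descent_property L mu gamma c kappa (2 * N%:R) E tau alpha Ce beta C0 C1.
Hypothesis Ce_bound : forall xh xs z lam,
  critical C rho (augmented_grad A g c kappa xh z lam) xh ->
  critical (fiber (C := C) A 0) rho (moreau_grad g kappa xs z) xs ->
  enorm (xh - xs) <= Ce * enorm (A *m xh).
Variable eta : nat -> R.
Hypothesis etaE : forall k, 0 <= eta k <= E.

(** The estimate for one realization of the algorithm, [v k] being the gradient
    estimate that it uses. *)
Lemma path_gap_sum (x z : nat -> 'cV[R]_(N * n))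
    (lam : nat -> 'cV[R]_(#|edges e| * n)) (v : nat -> 'cV[R]_(N * n)) :
  let s k := x k + eta k *: (x k - x k.-1) in
  C (x 0%N) -> z 0%N = x 0%N -> lam 0%N = - alpha *: (A *m x 0%N) ->
  (forall k, lam k.+1 = lam k + alpha *: (A *m x k)) ->
  (forall k, argmin (sppdm_objective f_ r_ gamma c kappa (v k) (s k) (x k) (z k) (lam k.+1))
     (x k.+1)) ->
  (forall k, z k.+1 = z k + beta *: (x k.+1 - z k)) ->
  exists2 V : R, initial_potential e f_ r_ kappa c tau alpha (x 0%N) = V%:E &
    forall K, \sum_(k < K) Qgap f_ r_ (x k) (lam k.+1) <=
      C0 * (V - flow + C1 * \sum_(k < K) enorm (v k - g (s k)) ^+ 2).
Proof.
move=> s Cx0 z0 lam0 lamS xS zS.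
have nA0 : 0 <= 2 * N%:R :> R by rewrite mulr_ge0.
have A_le := @Amx_le R N n e e_sym e_irr.
have xc k := sppdm_step_critical c0 e_sym e_irr (xS k).
have Cx k : C (x k) by case: k => // k; have [] := xc k.
have [xh xhP] := choice (fun k => augmented_min c0 m0 e_sym e_irr (z k) (lam k)).
have [xh' xh'P] := choice (fun k => augmented_min c0 m0 e_sym e_irr (z k) (lam k.+1)).
have [xs xsP] := choice (fun k => moreau_min m0 (z k)).
exists (lyapunov A rho f c kappa tau (x 0%N) (x 0%N - x 0%N) (x 0%N) (lam 0%N) (xh 0%N) (xs 0%N)).
  rewrite lam0; apply: initial_potentialE => //.
  - by rewrite -lam0 -z0; apply: xhP.
  - by rewrite -z0; apply: xsP.
move=> K; pose gap k := Qgap f_ r_ (x k) (lam k.+1).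
have := gap_sum_le nA0 A_le fsum_curved c0 kappa0 m0 tau0 C00 objective_lower_bound Cx xhP xsP
  (C1 := C1) (gap := gap) (err := fun k => enorm (v k - g (s k)) ^+ 2).
rewrite /= z0; apply => k; rewrite /gap QgapE enorm_sq /=.
have := desc (@Amx_le R N n e e_sym e_irr) (@Bmx_le R N n e e_sym e_irr)
  (fun u => sum_Amx_Bmx_ge e_sym e_irr u d1) fsum_curved (a1_lipschitz smooth)
  (d := x k - x k.-1) (eps := v k - g (s k)) (Cx k) (etaE k).
rewrite -/(s k) subrKC => /(_ _ (z k) (x k.+1) (xh k) (xh' k) (xh k.+1) (xs k) (xs k.+1)
  (prox (rsum r_) (x k - g (x k) - A^T *m lam k.+1)) (lam k)).
rewrite -lamS -zS; apply => //; first exact: Ce_bound (xh'P k) (xsP k).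
exact: prox_critical.
Qed.

End Path.

End Problem.

(** The constant depends on the graph, the matrices and the moduli only: [f_],
    [r_] and the right-hand sides [zeta] of the polyhedra are arbitrary. *)
Lemma dual_error_bound {R : realType} {N n : nat} (e : rel 'I_N) (q : 'I_N -> nat)
    (Sx : forall i, 'M[R]_(q i, n)) (Sy : forall i, 'cV[R]_(q i)) (L mu kappa : R) :
  0 <= L -> mu <= L -> 0 < kappa -> 0 < mu + kappa -> exists K : R,
  forall f_ r_ zeta flow c, consensus_problem e f_ r_ -> assumption1 e L mu flow f_ r_ ->
  assumption2 Sx Sy zeta r_ -> forall xh xs z lam,
  critical (rdom r_) (rfin r_)
    (augmented_grad (Amx e) (grad (fsum f_)) c kappa xh z lam) xh ->
  critical (fiber (C := rdom r_) (Amx e) 0) (rfin r_)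
    (moreau_grad (grad (fsum f_)) kappa xs z) xs ->
  enorm (xh - xs) <= K * enorm (Amx e *m xh).
Proof.
move=> L0 muL kappa0 m0; have mM : mu + kappa <= L + kappa by rewrite lerD2r.
have [K _ KP] := fiber_error_bound (lift_row Sx Sy) (lift_proj_mx N n)
  (@Amx R N n e) m0 mM.
exists K => f_ r_ zeta flow c prob smo poly xh xs z lam ch cs.
have [[Cs As] _] := cs; have fc := fsum_curved L0 smo.
have := KP _ _ _ _ _ (fun x => moreau_grad (grad (fsum f_)) kappa x z) xh xs
  (regularizer_convex prob poly) (rlift_polyhedral (cp_proper prob) poly).
rewrite As subr0; apply => //; last exact: augmented_fiber ch.
  move=> u v; have -> : moreau_grad (grad (fsum f_)) kappa u z -
      moreau_grad (grad (fsum f_)) kappa v z =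
      (grad (fsum f_) u - grad (fsum f_) v) + kappa *: (u - v).
    by rewrite /moreau_grad; vector_ring.
  apply: le_trans (enormD _ _) _; rewrite mulrDl enormZ gtr0_norm //.
  by rewrite lerD2r (a1_lipschitz smo).
by move=> u v; apply: curved_monotone (moreau_curved kappa fc z).
Qed.

(** * Measurability of random vectors *)

Section RandomVectors.
Context {R : realType} {d : measure_display} {T : measurableType d}.

(** Coordinatewise, so that measurability of real functions applies directly. *)
Definition vector_measurable p (X : T -> 'cV[R]_p) :=
  forall k, measurable_fun setT (fun w => X w k 0).

Lemma vector_measurableD p (X Y : T -> 'cV[R]_p) :
  vector_measurable X -> vector_measurable Y -> vector_measurable (fun w => X w + Y w).
Proof.
move=> mX mY k; apply: (eq_measurable_fun (fun w => X w k 0 + Y w k 0)).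
  by move=> w _; rewrite mxE.
exact: measurable_funD.
Qed.

Lemma vector_measurableZ p a (X : T -> 'cV[R]_p) :
  vector_measurable X -> vector_measurable (fun w => a *: X w).
Proof.
move=> mX k; apply: (eq_measurable_fun (fun w => a * X w k 0)).
  by move=> w _; rewrite mxE.
by apply: measurable_funM => //; exact: measurable_cst.
Qed.

Lemma vector_measurableB p (X Y : T -> 'cV[R]_p) :
  vector_measurable X -> vector_measurable Y -> vector_measurable (fun w => X w - Y w).
Proof.
move=> mX mY; have := vector_measurableD mX (vector_measurableZ (-1) mY).
by under eq_fun do rewrite scaleN1r.
Qed.

Lemma vector_measurable_mulmx p q (M : 'M[R]_(q, p)) (X : T -> 'cV[R]_p) :
  vector_measurable X -> vector_measurable (fun w => M *m X w).
Proof.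
move=> mX k; apply: (eq_measurable_fun (fun w => \sum_j M k j * X w j 0)).
  by move=> w _; rewrite mxE.
apply: measurable_sum => j; apply: measurable_funM => //; exact: measurable_cst.
Qed.

Lemma vector_measurable_block m n (X : T -> 'cV[R]_(m * n)) i :
  vector_measurable X -> vector_measurable (fun w => block (X w) i).
Proof.
move=> mX k; apply: (eq_measurable_fun (fun w => X w (mxtens_index (i, k)) 0)) => //.
by move=> w _; rewrite mxE.
Qed.

Lemma measurable_dot p (X Y : T -> 'cV[R]_p) :
  vector_measurable X -> vector_measurable Y -> measurable_fun setT (fun w => dot (X w) (Y w)).
Proof. by move=> mX mY; apply: measurable_sum => k; apply: measurable_funM. Qed.

(** Open sets are given by the sup norm; the estimates below are Euclidean. *)
Definition eopen p (U : set 'cV[R]_p) :=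
  forall x, U x -> exists2 r : R, 0 < r & forall y, enorm (x - y) < r -> U y.

Lemma open_eopen p (U : set 'cV[R]_p) : open U -> eopen U.
Proof.
move=> oU x Ux; have /nbhs_ballP[r r0 rU] : nbhs x U by apply: open_nbhs_nbhs.
exists r => // y xy; apply: rU; split=> // i j; rewrite (ord1 j).
by have := coord_le_enorm (x - y) i; rewrite !mxE => /le_lt_trans; apply.
Qed.

Lemma rational_approx p (x : 'cV[R]_p) (r : R) : 0 < r ->
  exists c : {ffun 'I_p -> rat}, enorm (x - \col_k ratr (c k)) < r.
Proof.
move=> r0; have p0 : 0 < p.+1%:R :> R by rewrite ltr0n.
have near k : exists c : rat, `|x k 0 - ratr c| < r / p.+1%:R.
  have : 0 < r / p.+1%:R by rewrite divr_gt0.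
  move: (r / _) (x k 0) => a b a0; have ab : b - a < b + a by lra.
  have [c] := rat_in_itvoo ab; rewrite in_itv /= => /andP[c1 c2].
  by exists c; rewrite ltr_norml; lra.
have [c cP] := choice near; exists (finfun c).
apply: le_lt_trans (enorm_le_sum _) _.
apply: le_lt_trans (_ : \sum_(k < p) r / p.+1%:R < _).
  by apply: ler_sum => k _; rewrite !mxE ffunE ltW.
rewrite sumr_const card_ord -[_ *+ p]mulr_natr mulrAC ltr_pdivrMr //.
by rewrite ltr_pM2l // ltr_nat.
Qed.

(** An open set is the union of the balls with rational center and radius that it
    contains. *)
Lemma measurable_eopen p (X : T -> 'cV[R]_p) (U : set 'cV[R]_p) :
  vector_measurable X -> eopen U -> measurable (X @^-1` U).
Proof.
move=> mX oU.
pose ball (j : {ffun 'I_p -> rat} * nat) : set 'cV[R]_p :=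
  [set y | enorm (y - \col_k ratr (j.1 k)) < j.2.+1%:R^-1].
pose F j := if `[< ball j `<=` U >] then X @^-1` (ball j) else set0.
have -> : X @^-1` U = \bigcup_j F j.
  apply/seteqP; split=> [w /= /oU[r r0 rU]|w [j _]]; last first.
    by rewrite /F; case: asboolP => // jU /jU.
  have [k _ /(_ _ (leqnn _)) /= kr] := near_infty_natSinv_lt (PosNum (divr_gt0 r0 (ltr0n R 2))).
  have k0 : 0 < k.+1%:R^-1 :> R by rewrite invr_gt0.
  have [c cP] := rational_approx (X w) k0.
  exists (c, k) => //; rewrite /F; case: asboolP => [_|]; first exact: cP.
  case=> y /= yc; apply: rU; apply: le_lt_trans (enorm_dist _ (\col_k ratr (c k)) _) _.
  rewrite (enormBC _ y); have := ltrD cP yc => /lt_le_trans; apply.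
  by move: kr; rewrite /=; move: (k.+1%:R^-1) => a; lra.
apply: countable_bigcupT_measurable => [|j]; first exact: countableP.
rewrite /F; case: asboolP => // _.
have -> : X @^-1` ball j = (fun w => dot (X w - \col_k ratr (j.1 k)) (X w - \col_k ratr (j.1 k)))
    @^-1` `]-oo, j.2.+1%:R^-1 ^+ 2[.
  apply/seteqP; split=> w /=; rewrite in_itv /= -enorm_sq;
  by rewrite ltr_pXn2r ?nnegrE ?enorm_ge0 ?invr_ge0.
rewrite -[X in measurable X]setTI; apply: measurable_dot => //.
  by apply: vector_measurableB => // k; apply: measurable_cst.
by apply: vector_measurableB => // k; apply: measurable_cst.
Qed.

Lemma measurable_borel p (X : T -> 'cV[R]_p) : vector_measurable X ->
  measurable_fun setT (X : T -> borel_cV R p).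
Proof.
move=> mX; apply: (@measurability _ _ T (borel_cV R p) setT X (@open 'cV[R]_p)) => // _ [U oU <-].
by rewrite setTI; apply: measurable_eopen mX (open_eopen oU).
Qed.

Lemma measurable_lipschitz_real p (X : T -> 'cV[R]_p) (phi : 'cV[R]_p -> R) K :
  vector_measurable X -> (forall x y, `|phi x - phi y| <= K * enorm (x - y)) ->
  measurable_fun setT (phi \o X).
Proof.
move=> mX phiK; apply: (measurability _ (RGenOInfty.measurableE R)) => _ [_ [a ->] <-].
rewrite setTI comp_preimage; apply: measurable_eopen => // x /=.
rewrite in_itv /= andbT => ax; pose K' := `|K| + 1.
have K'0 : 0 < K' by rewrite ltr_wpDl.
exists ((phi x - a) / K') => [|y xy]; first by rewrite divr_gt0 // subr_gt0.
rewrite in_itv /= andbT; have := phiK x y; have := ler_norm (phi x - phi y).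
have : K * enorm (x - y) <= K' * enorm (x - y).
  by rewrite ler_wpM2r ?enorm_ge0 // /K'; have := ler_norm K; lra.
by move: xy; rewrite ltr_pdivlMr // mulrC; lra.
Qed.

Lemma vector_measurable_lipschitz p q (X : T -> 'cV[R]_p) (Phi : 'cV[R]_p -> 'cV[R]_q) K :
  vector_measurable X -> (forall x y, enorm (Phi x - Phi y) <= K * enorm (x - y)) ->
  vector_measurable (Phi \o X).
Proof.
move=> mX PhiK k; apply: (measurable_lipschitz_real (phi := fun x => Phi x k 0) mX) => x y.
apply: le_trans (PhiK x y); have := coord_le_enorm (Phi x - Phi y) k.
by rewrite !mxE.
Qed.

Lemma vector_measurable_open p (X : T -> 'cV[R]_p) :
  (forall U, open U -> measurable (X @^-1` U)) -> vector_measurable X.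
Proof.
move=> mX k; apply: (measurability _ (RGenOInfty.measurableE R)) => _ [_ [a ->] <-].
rewrite setTI; apply: (mX ((fun y : 'cV[R]_p => y k 0) @^-1` `]a, +oo[)).
by move/continuousP: (@coord_continuous R p 1 k 0); apply; apply: interval_open.
Qed.

End RandomVectors.

(** * Independence *)

(** Independence is expressed by product rules for events; the image measure of a
    pair is then the product of the laws. *)
Section Independence.
Local Open Scope ereal_scope.
Context {R : realType} {d : measure_display} {T : measurableType d} (P : probability T R).

Section Pair.
Context {d1 d2 : measure_display} {E1 : measurableType d1} {E2 : measurableType d2}.
Variables (X : {mfun T >-> E1}) (Y : {mfun T >-> E2}).
Hypothesis indep : forall A B, measurable A -> measurable B ->
  P (X @^-1` A `&` Y @^-1` B) = P (X @^-1` A) * P (Y @^-1` B).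

Let XY w := (X w, Y w).
Let mXY : measurable_fun setT XY.
Proof. exact: measurable_fun_pair. Qed.
Let mXY_mixin := isMeasurableFun.Build _ _ _ _ _ mXY.
Definition pair_mfun : {mfun T >-> (E1 * E2)%type} := MeasurableFun.Pack (MeasurableFun.Class mXY_mixin).

Lemma joint_law Z : measurable Z ->
  (distribution P X \x distribution P Y) Z = P (pair_mfun @^-1` Z).
Proof.
by move=> mZ; apply: (product_measure_unique (m' := distribution P pair_mfun)).
Qed.

(** Fubini's theorem for the joint law, which is a product measure. *)
Lemma ge0_integral_indep (phi : E1 * E2 -> \bar R) :
  measurable_fun setT phi -> (forall z, 0 <= phi z) ->
  \int[P]_w phi (X w, Y w) = \int[distribution P X]_x \int[distribution P Y]_y phi (x, y).
Proof.
move=> mphi phi0; transitivity (\int[distribution P pair_mfun]_z phi z).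
  by rewrite ge0_integral_distribution.
rewrite -[RHS](fubini_tonelli1 phi mphi phi0); apply: eq_measure_integral => Z mZ _.
by rewrite /= joint_law.
Qed.

Lemma integral_indep (phi : E1 * E2 -> \bar R) :
  measurable_fun setT phi -> P.-integrable setT (fun w => phi (X w, Y w)) ->
  \int[P]_w phi (X w, Y w) = \int[distribution P X]_x \int[distribution P Y]_y phi (x, y).
Proof.
move=> mphi iphi; transitivity (\int[distribution P pair_mfun]_z phi z).
  by rewrite integral_distribution.
have eqm Z : measurable Z -> Z `<=` setT ->
    distribution P pair_mfun Z = (distribution P X \x distribution P Y) Z.
  by move=> mZ _; rewrite joint_law.
rewrite (eq_measure_integral _ eqm) -integral12_prod_meas1 //.
apply/integrableP; split=> //; rewrite -(eq_measure_integral _ eqm).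
have [_] := integrableP _ _ _ iphi; rewrite ge0_integral_distribution //.
exact: measurableT_comp.
Qed.

End Pair.

(** Independence of the pair [(X, Y)] from an event [F] follows from the product
    rule on rectangles: the restriction of the joint law to [F] is the product of
    a multiple of the law of [X] by the law of [Y]. *)
Lemma indep_pair {d1 d2 : measure_display} {E1 : measurableType d1}
    {E2 : measurableType d2} (X : {mfun T >-> E1}) (Y : {mfun T >-> E2}) (F : set T) :
  measurable F ->
  (forall A B, measurable A -> measurable B ->
    P (X @^-1` A `&` Y @^-1` B) = P (X @^-1` A) * P (Y @^-1` B)) ->
  (forall A B, measurable A -> measurable B ->
    P (X @^-1` A `&` Y @^-1` B `&` F) = P (X @^-1` A) * P (Y @^-1` B) * P F) ->
  forall Z, measurable Z ->
  P (pair_mfun X Y @^-1` Z `&` F) = P (pair_mfun X Y @^-1` Z) * P F.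
Proof.
move=> mF indep2 indep3 Z mZ.
have PF : P F = (fine (P F))%:E by rewrite fineK // fin_num_measure.
have PF0 : (0 <= fine (P F))%R by rewrite fine_ge0.
pose m1 := mscale (NngNum PF0) (distribution P X).
pose m' := pushforward (mrestr P mF) (pair_mfun X Y).
transitivity ((m1 \x distribution P Y) Z).
  apply/esym/(product_measure_unique (m' := m')) => // A B mA mB.
  rewrite [LHS](_ : _ = P (X @^-1` A `&` Y @^-1` B `&` F)) // indep3 //.
  rewrite [RHS](_ : _ = (fine (P F))%:E * P (X @^-1` A) * P (Y @^-1` B)) //.
  by rewrite -PF muleC muleA.
rewrite -(joint_law indep2 mZ) /product_measure1 ge0_integral_mscale //=.
  by rewrite PF muleC.
exact: measurable_fun_xsection.
Qed.

Lemma integral_probability_cst {d1 : measure_display} {E1 : measurableType d1}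
    (D : probability E1 R) (r : R) : \int[D]__ r%:E = r%:E.
Proof.
by rewrite integral_cst //= [X in (_ * X)](_ : _ = 1) ?mule1 //; apply: probability_setT.
Qed.

Lemma integral_sqr_le_sum {d1 : measure_display} {E1 : measurableType d1}
    (D : probability E1 R) (n : nat) (u : 'I_n -> E1 -> R) l :
  (forall l, measurable_fun setT (u l)) ->
  \int[D]_y (u l y ^+ 2)%:E <= \int[D]_y (\sum_l u l y ^+ 2)%:E.
Proof.
move=> mu; apply: ge0_le_integral => //.
- by move=> y _; rewrite lee_fin sqr_ge0.
- by apply/measurable_EFinP/measurable_funX.
- by apply/measurable_EFinP; apply: measurable_sum => l'; apply: measurable_funX.
- move=> y _; rewrite lee_fin (bigD1 l) //= lerDl.
  by apply: sumr_ge0 => l' _; apply: sqr_ge0.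
Qed.

Lemma square_integrable {d1 : measure_display} {E1 : measurableType d1}
    (D : probability E1 R) (u : E1 -> R) :
  measurable_fun setT u -> \int[D]_y (u y ^+ 2)%:E < +oo ->
  D.-integrable setT (fun y => (u y)%:E).
Proof.
move=> mu u2; apply/integrableP; split; first exact/measurable_EFinP.
apply: (@le_lt_trans _ _ (\int[D]_y (1 + u y ^+ 2)%:E)).
  apply: ge0_le_integral => //.
  - by apply: measurableT_comp => //; apply/measurable_EFinP.
  - by apply/measurable_EFinP/measurable_funD => //; apply: measurable_funX.
  move=> y _; rewrite abse_EFin lee_fin.
  have := sqr_ge0 (u y - 1); have := sqr_ge0 (u y + 1); have := sqr_ge0 (u y).
  by rewrite ler_norml => *; apply/andP; split; nra.
under eq_integral do rewrite EFinD.
rewrite ge0_integralD //.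
- by rewrite integral_probability_cst lte_add_pinfty // ltry.
- by move=> y _; rewrite lee_fin sqr_ge0.
- by apply/measurable_EFinP/measurable_funX.
Qed.

(** Conditionally on [S] the terms are independent and centered, so the products
    of distinct ones have zero mean. *)
Lemma sum_variance_le {d1 d2 : measure_display} {E1 : measurableType d1}
    {E2 : measurableType d2} (S : {mfun T >-> E1}) (m n : nat)
    (Y : 'I_m -> {mfun T >-> E2}) (D : probability E2 R)
    (h : 'I_n -> E1 * E2 -> R) (V : R) :
  (forall j B, measurable B -> P (Y j @^-1` B) = D B) ->
  (forall j A B, measurable A -> measurable B ->
    P (S @^-1` A `&` Y j @^-1` B) = P (S @^-1` A) * P (Y j @^-1` B)) ->
  (forall i j A B C, i != j -> measurable A -> measurable B -> measurable C ->
    P (S @^-1` A `&` Y i @^-1` B `&` Y j @^-1` C) =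
    P (S @^-1` A) * P (Y i @^-1` B) * P (Y j @^-1` C)) ->
  (forall l, measurable_fun setT (h l)) ->
  (forall l s, \int[D]_y (h l (s, y))%:E = 0) ->
  (forall s, \int[D]_y (\sum_l h l (s, y) ^+ 2)%:E <= V%:E) ->
  \int[P]_w (\sum_l (\sum_j h l (S w, Y j w)) ^+ 2)%:E <= (m%:R * V)%:E.
Proof.
move=> law indep2 indep3 mh centered var.
have lawE j (f : E2 -> \bar R) : \int[distribution P (Y j)]_y f y = \int[D]_y f y.
  by apply: eq_measure_integral => A mA _; apply: law.
pose u l j w := h l (S w, Y j w).
have mu l j : measurable_fun setT (u l j).
  by apply: (measurableT_comp (mh l)); apply: measurable_fun_pair.
have mh2 : measurable_fun setT (fun z : E1 * E2 => (\sum_l h l z ^+ 2)%R).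
  by apply: measurable_sum => l; apply: measurable_funX.
have diag j : \int[P]_w (\sum_l u l j w ^+ 2)%:E <= V%:E.
  rewrite (ge0_integral_indep (indep2 j) (phi := fun z => (\sum_l h l z ^+ 2)%:E)) //.
  - apply: (@le_trans _ _ (\int[distribution P S]_s V%:E)).
      apply: ge0_le_integral => //.
      + by move=> s _; apply: integral_ge0 => y _; rewrite lee_fin sumr_ge0 // => l _; apply: sqr_ge0.
      + apply: (measurable_fun_fubini_tonelli_F (fun z => (\sum_l h l z ^+ 2)%:E)) => //.
          by apply/measurable_EFinP.
        by move=> z; rewrite lee_fin sumr_ge0 // => l _; apply: sqr_ge0.
      + by move=> s _; rewrite lawE.
    by rewrite integral_probability_cst.
  - exact/measurable_EFinP.
  - by move=> z; rewrite lee_fin sumr_ge0 // => l _; apply: sqr_ge0.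
have isq l j : P.-integrable setT (fun w => (u l j w ^+ 2)%:E).
  apply/integrableP; split; first by apply/measurable_EFinP/measurable_funX.
  apply: le_lt_trans (ltry V); apply: le_trans (diag j).
  under eq_integral do rewrite gee0_abs ?lee_fin ?sqr_ge0 //.
  exact: (@integral_sqr_le_sum _ _ P _ (fun l => u l j) l (fun l => mu l j)).
have iprod l i j : P.-integrable setT (fun w => (u l i w * u l j w)%:E).
  apply: (le_integrable measurableT _ _ (integrableD measurableT (isq l i) (isq l j))).
    by apply/measurable_EFinP/measurable_funM.
  move=> w _; rewrite -EFinD !abse_EFin lee_fin [leRHS]ger0_norm ?addr_ge0 ?sqr_ge0 //.
  have := sqr_ge0 (u l i w - u l j w); have := sqr_ge0 (u l i w + u l j w).
  by have := sqr_ge0 (u l i w); have := sqr_ge0 (u l j w); rewrite ler_norml; nra.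
have ih l s : D.-integrable setT (fun y => (h l (s, y))%:E).
  apply: square_integrable; first by apply: measurableT_comp.
  apply: le_lt_trans (ltry V); apply: le_trans (var s).
  apply: (@integral_sqr_le_sum _ _ D _ (fun l y => h l (s, y)) l) => l'.
  exact: measurableT_comp.
have cross l i j : i != j -> \int[P]_w (u l i w * u l j w)%:E = 0.
  move=> ij; have indep3' A B : measurable A -> measurable B ->
      P (pair_mfun S (Y i) @^-1` A `&` Y j @^-1` B) =
      P (pair_mfun S (Y i) @^-1` A) * P (Y j @^-1` B).
    move=> mA mB; apply: indep_pair => //; [|by move=> *; apply: indep2|by move=> *; apply: indep3].
    by rewrite -[X in measurable X]setTI; apply: (measurable_funP (Y j)).
  have := integral_indep indep3'
    (phi := fun z => (h l (z.1.1, z.1.2) * h l (z.1.1, z.2))%:E) _ (iprod l i j).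
  move=> /= -> ; last first.
    apply/measurable_EFinP/measurable_funM.
      apply: (measurableT_comp (mh l)); apply: measurable_fun_pair.
        by apply: measurableT_comp.
      by apply: measurableT_comp.
    apply: (measurableT_comp (mh l)); apply: measurable_fun_pair => //.
    by apply: measurableT_comp.
  apply: integral0_eq => z _; rewrite lawE.
  under eq_integral do rewrite EFinM.
  by rewrite integralZl // centered mule0.
have expand w : (\sum_l (\sum_j h l (S w, Y j w)) ^+ 2)%:E =
    \sum_l \sum_i \sum_j (u l i w * u l j w)%:E.
  rewrite -sumEFin; apply: eq_bigr => l _.
  rewrite expr2 big_distrlr /= -sumEFin; apply: eq_bigr => i _.
  by rewrite -sumEFin.
under eq_integral do rewrite expand.
rewrite integral_sum //; last first.
  by move=> l; apply: integrable_sum => // i _; apply: integrable_sum => // j _.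
rewrite (eq_bigr (fun l => \sum_i \int[P]_w (u l i w ^+ 2)%:E)); last first.
  move=> l _; rewrite integral_sum //; last by move=> i; apply: integrable_sum.
  apply: eq_bigr => i _; rewrite integral_sum // (bigD1 i) //= big1 ?adde0 => [|j ji].
    by apply: eq_integral => w _; rewrite expr2.
  by rewrite cross // eq_sym.
rewrite exchange_big /=; apply: le_trans (_ : \sum_(i < m) V%:E <= _).
  apply: lee_sum => i _; apply: le_trans (diag i).
  under [leRHS]eq_integral do rewrite -sumEFin.
  by rewrite integral_sum.
by rewrite sumEFin sumr_const card_ord mulr_natl.
Qed.

End Independence.

(** * Stochastic gradients *)

Section BlockGradient.
Context {R : realType} {N n : nat}.
Implicit Type x : 'cV[R]_(N * n).

Lemma block_delta (i j : 'I_N) (k : 'I_n) :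
  block (delta_mx (mxtens_index (i, k)) 0 : 'cV[R]_(N * n)) j =
  if j == i then delta_mx k 0 else 0.
Proof.
apply/matrixP => l t; rewrite (ord1 t) !mxE (inj_eq (can_inj (@mxtens_indexK _ _))) xpair_eqE.
by case: eqVneq; rewrite !mxE.
Qed.

Lemma grad_fsum (f_ : 'I_N -> 'cV[R]_n -> R) x i : block (grad (fsum f_) x) i = grad (f_ i) (block x i).
Proof.
apply/matrixP => k j; rewrite !mxE /derive.
suff -> : (fun t : R => t^-1 *: ((fsum f_ \o shift x) (t *: delta_mx (mxtens_index (i, k)) 0)
    - fsum f_ x)) =
  (fun t => t^-1 *: ((f_ i \o shift (block x i)) (t *: delta_mx k 0) - f_ i (block x i))) by [].
apply/funext => t /=; congr (_ *: _); rewrite /fsum -sumrB (bigD1 i) //= big1 ?addr0 => [|i' i'i].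
  by rewrite /shift /= blockD blockZ block_delta eqxx.
by rewrite /shift /= blockD blockZ block_delta (negPf i'i) scaler0 add0r subrr.
Qed.

(** Two points of one agent are compared by completing them with the same blocks. *)
Lemma grad_block_lipschitz (f_ : 'I_N -> 'cV[R]_n -> R) L i s1 s2 :
  (forall x y, enorm (grad (fsum f_) x - grad (fsum f_) y) <= L * enorm (x - y)) ->
  enorm (grad (f_ i) s1 - grad (f_ i) s2) <= L * enorm (s1 - s2).
Proof.
move=> gL; pose x s : 'cV[R]_(N * n) := stack (fun j => if j == i then s else 0).
have bx s j : block (x s) j = if j == i then s else 0 by rewrite block_stack.
have -> : enorm (s1 - s2) = enorm (x s1 - x s2).
  rewrite /enorm dot_blocks (bigD1 i) //= big1 ?addr0 => [|j ji].
    by rewrite blockB !bx eqxx.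
  by rewrite blockB !bx (negPf ji) subrr -enorm_sq enorm0 expr0n.
apply: le_trans (gL _ _); apply: le_trans (enorm_block _ i).
by rewrite blockB !grad_fsum !bx eqxx.
Qed.

End BlockGradient.

Section Sampling.
Context {R : realType} {N n : nat} (f_ : 'I_N -> 'cV[R]_n -> R).
Context {dX : 'I_N -> measure_display} {X : forall i, measurableType (dX i)}.
Context (D : forall i, probability (X i) R).
Context (G : forall i, 'cV[R]_n -> X i -> 'cV[R]_n) (sigma L : R).
Hypothesis oracle : assumption3 f_ D G sigma.
Hypothesis grad_lipschitz : forall x y,
  enorm (grad (fsum f_) x - grad (fsum f_) y) <= L * enorm (x - y).

Definition oracle_error i l (v : borel_cV R n * X i) : R := G v.1 v.2 l 0 - grad (f_ i) v.1 l 0.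

Let vector_measurable_id p : vector_measurable (fun x : borel_cV R p => x).
Proof. by apply: vector_measurable_open => U oU; apply: sub_sigma_algebra. Qed.

Let measurable_oracle_error i l : measurable_fun setT (@oracle_error i l).
Proof.
apply: measurable_funB; first exact: (a3_measurable oracle).
apply: (measurableT_comp (f := fun s : borel_cV R n => grad (f_ i) s l 0)) => //.
exact: (@vector_measurable_lipschitz R _ (borel_cV R n) n n id (grad (f_ i)) L
  (@vector_measurable_id n) (fun x y => grad_block_lipschitz i x y grad_lipschitz) l).
Qed.

Let oracle_error_variance i s :
  (\int[D i]_y (\sum_l oracle_error l (s, y) ^+ 2)%:E <= (sigma ^+ 2)%:E)%E.
Proof.
have := a3_variance oracle i s; rewrite unlock; apply: le_trans.
rewrite le_eqVlt; apply/orP; left; apply/eqP/eq_integral => y _; congr (_%:E).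
by rewrite enorm_sq; apply: eq_bigr => l _; rewrite /oracle_error !mxE expr2.
Qed.

Let oracle_error_centered i l s : (\int[D i]_y (oracle_error l (s, y))%:E = 0)%E.
Proof.
have me l' : measurable_fun setT (fun y : X i => oracle_error l' (s, y)).
  apply: (measurableT_comp (measurable_oracle_error l')).
  exact: pair1_measurable.
have ie : (D i).-integrable setT (fun y => (oracle_error l (s, y))%:E).
  apply: square_integrable => //; apply: le_lt_trans (ltry (sigma ^+ 2)).
  apply: le_trans (oracle_error_variance i s).
  exact: (@integral_sqr_le_sum _ _ _ (D i) _ (fun l y => oracle_error l (s, y)) l).
have ic : (D i).-integrable setT (fun _ : X i => (grad (f_ i) s l 0)%:E).
  exact: finite_measure_integrable_cst.
have := a3_unbiased oracle i s l; rewrite unlock.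
have -> : (\int[D i]_y (G s y l 0)%:E =
    \int[D i]_y ((oracle_error l (s, y))%:E + (grad (f_ i) s l 0)%:E))%E.
  by apply: eq_integral => y _; rewrite -EFinD /oracle_error subrK.
rewrite integralD // integral_probability_cst; move: (integrable_fin_num measurableT ie).
by case: (integral _ _ _) => // a _; rewrite -EFinD => -[]; rewrite -[RHS]add0r => /addIr ->.
Qed.

Context {d : measure_display} {T : measurableType d} (P : probability T R).
Context (m : nat) (xi : nat -> forall i, 'I_m -> {RV P >-> X i}).

Lemma vector_measurable_minibatch k (s : T -> 'cV[R]_(N * n)) :
  vector_measurable s -> vector_measurable (fun w => minibatch G xi k (s w) w).
Proof.
move=> ms k'; case: (mxtens_indexP k') => i l.
apply: (eq_measurable_fun (fun w =>
    m%:R^-1 * \sum_(j < m) G (block (s w) i) (xi k i j w) l 0)).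
  by move=> w _; rewrite !mxE mxtens_indexK summxE.
apply: measurable_funM => //; apply: measurable_sum => j.
have mp : measurable_fun setT (fun w => (block (s w) i : borel_cV R n, xi k i j w)).
  by apply: measurable_fun_pair => //; exact/measurable_borel/vector_measurable_block.
exact: (measurableT_comp (f := fun v : borel_cV R n * X i => G v.1 v.2 l 0)
  (a3_measurable oracle l) mp).
Qed.

Context (eta : nat -> R) (x : nat -> T -> 'cV[R]_(N * n)).
Hypothesis mx : forall k, vector_measurable (x k).
Hypothesis law : forall k i (j : 'I_m) U, measurable U ->
  distribution P (xi k i j) U = D i U.
Hypothesis indep : forall k, mutually_independent P (sampling_systems xi x k).

Local Notation s := (extrapolation eta x).

Lemma vector_measurable_extrapolation k : vector_measurable (s k).
Proof.
by apply: vector_measurableD => //; apply: vector_measurableZ; apply: vector_measurableB.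
Qed.

(** The extrapolated point is a continuous function of the iterates up to [k]. *)
Lemma past_extrapolation k i (A : set (borel_cV R n)) :
  measurable A -> past x k ((fun w => block (s k w) i) @^-1` A).
Proof.
move=> mA; pose gen := [set F | exists t U, [/\ (t <= k)%N, open U & F = x t @^-1` U]].
have mxt t : (t <= k)%N -> @vector_measurable R _ (g_sigma_algebraType gen) _ (x t).
  move=> tk; apply: vector_measurable_open => U oU; apply: sub_sigma_algebra.
  by exists t, U.
have : @vector_measurable R _ (g_sigma_algebraType gen) _ (fun w => block (s k w) i).
  apply: vector_measurable_block; apply: vector_measurableD; first exact: mxt.
  apply/vector_measurableZ/vector_measurableB; first exact: mxt.
  by apply: mxt; apply: leq_pred.
by move=> /measurable_borel /(_ measurableT _ mA); rewrite setTI.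
Qed.

(** The errors of the agents are estimated separately: for agent [i], block [i] of
    the extrapolated point and the samples of [i] satisfy the product rules. *)
Lemma minibatch_variance k : (0 < m)%N ->
  (\int[P]_w (enorm (minibatch G xi k (s k w) w - grad (fsum f_) (s k w)) ^+ 2)%:E
   <= (N%:R * sigma ^+ 2 / m%:R)%:E)%E.
Proof.
move=> m_gt0; pose S i w : borel_cV R n := block (s k w) i.
have mS i : measurable_fun setT (S i).
  exact/measurable_borel/vector_measurable_block/vector_measurable_extrapolation.
pose Sm i : {mfun T >-> borel_cV R n} :=
  MeasurableFun.Pack (MeasurableFun.Class (isMeasurableFun.Build _ _ _ _ _ (mS i))).
have mSA i A : measurable A -> measurable (S i @^-1` A).
  by move=> mA; rewrite -[X in measurable X]setTI; apply: (mS i).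
have mxi i j B : measurable B -> measurable (xi k i j @^-1` B).
  by move=> mB; rewrite -[X in measurable X]setTI; apply: measurable_funP.
have PE F : measurable F -> (fine (P F))%:E = P F.
  by move=> mF; rewrite fineK // fin_num_measure.
have xiF i j B : measurable B -> sampling_systems xi x k (Some (i, j)) (xi k i j @^-1` B).
  by move=> mB; exists B => //; rewrite setTI.
have indep2 i j A B : measurable A -> measurable B ->
    (P (Sm i @^-1` A `&` xi k i j @^-1` B) = P (Sm i @^-1` A) * P (xi k i j @^-1` B))%E.
  move=> mA mB; pose F o := if o == Some (i, j) then xi k i j @^-1` B else S i @^-1` A.
  have := @indep k [:: None; Some (i, j)] F isT.
  rewrite !big_cons big_nil mulr1 EFinM /F eqxx !PE //; [|exact: mxi|exact: mSA].
  move=> <- => [|o]; last first.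
    by rewrite !inE => /orP[] /eqP-> /=; [apply: past_extrapolation|rewrite eqxx; apply: xiF].
  congr (P _); apply/seteqP; split=> [w [wA wB] o|w w_].
    by rewrite /= !inE => /orP[] /eqP -> //=; rewrite eqxx.
  split; first by apply: (w_ None).
  by have := w_ (Some (i, j)); rewrite /= eqxx; apply; rewrite !inE eqxx orbT.
have indep3 i (j j' : 'I_m) A B C : j != j' -> measurable A -> measurable B -> measurable C ->
    (P (Sm i @^-1` A `&` xi k i j @^-1` B `&` xi k i j' @^-1` C) =
    P (Sm i @^-1` A) * P (xi k i j @^-1` B) * P (xi k i j' @^-1` C))%E.
  move=> jj mA mB mC; pose F o := if o == Some (i, j) then xi k i j @^-1` B else
    if o == Some (i, j') then xi k i j' @^-1` C else S i @^-1` A.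
  have jj' : (Some (i, j') == Some (i, j)) = false.
    by apply/eqP => -[/eqP]; rewrite eq_sym (negPf jj).
  have := @indep k [:: None; Some (i, j); Some (i, j')] F.
  rewrite /= !inE eq_sym jj' /= => /(_ isT).
  rewrite !big_cons big_nil mulr1 !EFinM /F !eqxx jj' !PE //;
    [|exact: mxi|exact: mxi|exact: mSA].
  rewrite muleA => <- => [|o]; last first.
    rewrite !inE => /or3P[] /eqP-> /=; rewrite ?eqxx ?jj'; first exact: past_extrapolation.
      exact: xiF.
    exact: xiF.
  congr (P _); apply/seteqP; split=> [w [[wA wB] wC] o|w w_].
    by rewrite /= !inE => /or3P[] /eqP -> //=; rewrite ?jj' ?eqxx.
  split; first (split; first by apply: (w_ None)).
    by have := w_ (Some (i, j)); rewrite /= eqxx; apply; rewrite !inE eqxx orbT.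
  by have := w_ (Some (i, j')); rewrite /= jj' eqxx; apply; rewrite !inE eqxx !orbT.
have agent i := sum_variance_le (S := Sm i) (Y := fun j => xi k i j) (D := D i)
  (h := @oracle_error i) (fun j B mB => @law k i j B mB) (indep2 i) (indep3 i)
  (@measurable_oracle_error i) (@oracle_error_centered i) (oracle_error_variance i).
pose Z i w : R := \sum_l (\sum_j oracle_error l (S i w, xi k i j w)) ^+ 2.
have Z0 i w : 0 <= Z i w by apply: sumr_ge0 => l _; apply: sqr_ge0.
have mZ i : measurable_fun setT (Z i).
  apply: measurable_sum => l; apply: measurable_funX; apply: measurable_sum => j.
  by apply: (measurableT_comp (measurable_oracle_error l)); apply: measurable_fun_pair.
have m0 : m%:R != 0 :> R by rewrite pnatr_eq0 -lt0n.
have errorE w : enorm (minibatch G xi k (s k w) w - grad (fsum f_) (s k w)) ^+ 2 =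
    \sum_i m%:R^-1 ^+ 2 * Z i w.
  rewrite enorm_sq dot_blocks; apply: eq_bigr => i _.
  rewrite blockB grad_fsum block_stack /Z mulr_sumr; apply: eq_bigr => l _.
  have -> : \sum_j oracle_error l (S i w, xi k i j w) =
      (\sum_(j < m) G (block (s k w) i) (xi k i j w)) l 0 - m%:R * grad (f_ i) (S i w) l 0.
    by rewrite summxE /oracle_error sumrB /= sumr_const card_ord mulr_natl.
  by rewrite -expr2 -exprMn mulrBr (mulKf m0) !mxE.
under eq_integral do rewrite errorE -sumEFin.
rewrite ge0_integral_sum //; last 2 first.
- by move=> i; apply/measurable_EFinP/measurable_funM.
- by move=> i w _; rewrite lee_fin mulr_ge0 // sqr_ge0.
apply: (@le_trans _ _ (\sum_(i < N) (m%:R^-1 * sigma ^+ 2)%:E)%E).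
  apply: lee_sum => i _; under eq_integral do rewrite EFinM.
  rewrite ge0_integralZl ?lee_fin ?sqr_ge0 //; last 2 first.
  - exact/measurable_EFinP.
  - by move=> w _; rewrite lee_fin.
  apply: le_trans (lee_wpmul2l _ (agent i)) _; first by rewrite lee_fin sqr_ge0.
  by rewrite -EFinM lee_fin expr2 -mulrA (mulKf m0).
by rewrite sumEFin lee_fin sumr_const card_ord -[leLHS]mulr_natl [m%:R^-1 * _]mulrC mulrA.
Qed.

End Sampling.

(** * The iterates as random vectors *)

Section Iterates.
Context {R : realType} {N n : nat} (e : rel 'I_N) (q : 'I_N -> nat).
Variables (Sx : forall i, 'M[R]_(q i, n)) (Sy zeta : forall i, 'cV[R]_(q i)).
Variables (f_ : 'I_N -> 'cV[R]_n -> R) (r_ : 'I_N -> 'cV[R]_n -> \bar R).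
Variables (L mu flow : R).
Hypothesis problem : consensus_problem e f_ r_.
Hypothesis smooth : assumption1 e L mu flow f_ r_.
Hypothesis polyhedral : assumption2 Sx Sy zeta r_.
Context {dX : 'I_N -> measure_display} {X : forall i, measurableType (dX i)}.
Context (D : forall i, probability (X i) R).
Context (G : forall i, 'cV[R]_n -> X i -> 'cV[R]_n) (sigma : R).
Hypothesis oracle : assumption3 f_ D G sigma.
Context {d : measure_display} {T : measurableType d}.

Lemma measurable_Qgap (x : T -> 'cV[R]_(N * n)) (lam : T -> 'cV[R]_(#|edges e| * n)) :
  vector_measurable x -> vector_measurable lam ->
  measurable_fun setT (fun w => Qgap f_ r_ (x w) (lam w)).
Proof.
move=> mx mlam; pose g := grad (fsum f_).
have mg : vector_measurable (fun w => g (x w)).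
  exact: (vector_measurable_lipschitz mx (a1_lipschitz smooth)).
have mv : vector_measurable (fun w => x w - g (x w) - (Amx e)^T *m lam w).
  by apply: vector_measurableB; [exact: vector_measurableB|exact: vector_measurable_mulmx].
have mu_ : vector_measurable (fun w => prox (rsum r_) (x w - g (x w) - (Amx e)^T *m lam w)).
  apply: (@vector_measurable_lipschitz _ _ _ _ _ _ (prox (rsum r_)) 1 mv) => u v.
  by rewrite mul1r; apply: (prox_nonexpansive problem polyhedral).
under eq_fun do rewrite QgapE.
apply: measurable_funD; first by apply: measurable_dot; apply: vector_measurableB.
by apply: measurable_dot; apply: vector_measurable_mulmx.
Qed.

Context (P : probability T R) (m : nat) (xi : nat -> forall i, 'I_m -> {RV P >-> X i}).
Context (alpha beta gamma c kappa : R) (eta : nat -> R).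
Hypotheses (gamma0 : 0 < gamma) (c0 : 0 < c) (kappa0 : 0 < kappa).
Hypotheses (e_sym : symmetric e) (e_irr : irreflexive e).
Variables (x0 : 'cV[R]_(N * n)) (x z : nat -> T -> 'cV[R]_(N * n)).
Variable lambda : nat -> T -> 'cV[R]_(#|edges e| * n).
Hypothesis run : sppdm f_ r_ D G alpha beta gamma c kappa eta xi x0 x z lambda.

(** Two consecutive iterates are carried along, because of the extrapolation. *)
Lemma sppdm_measurable k :
  [/\ vector_measurable (x k), vector_measurable (z k) & vector_measurable (lambda k)].
Proof.
suff : [/\ vector_measurable (x k.-1), vector_measurable (x k), vector_measurable (z k)
    & vector_measurable (lambda k)] by case.
have cst p (a : 'cV[R]_p) : vector_measurable (fun _ : T => a).
  by move=> l; apply: measurable_cst.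
elim: k => [|k [mx' mx mz mlam]] /=.
  have -> : x 0%N = fun=> x0 by apply/funext; apply: sppdm_x0 run.
  have -> : z 0%N = fun=> x0 by apply/funext; apply: sppdm_z0 run.
  have -> : lambda 0%N = fun=> - alpha *: (Amx e *m x0).
    by apply/funext; apply: sppdm_lambda0 run.
  by split; apply: cst.
have mlam' : vector_measurable (lambda k.+1).
  have -> : lambda k.+1 = fun w => lambda k w + alpha *: (Amx e *m x k w).
    by apply/funext => w; apply: (sppdm_lambda run k).
  by apply: vector_measurableD => //; apply/vector_measurableZ/vector_measurable_mulmx.
have ms : vector_measurable (extrapolation eta x k).
  by apply: vector_measurableD => //; apply: vector_measurableZ; apply: vector_measurableB.
have mx1 : vector_measurable (x k.+1).
  have -> : x k.+1 = step_solution e r_ gamma c kappa \o (fun w =>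
      step_input gamma c kappa (minibatch G xi k (extrapolation eta x k w) w)
        (extrapolation eta x k w) (x k w) (z k w) (lambda k.+1 w)).
    apply/funext => w /=.
    have cx := sppdm_step_critical problem polyhedral c0 e_sym e_irr (sppdm_x run k w).
    exact: (step_solutionE problem polyhedral gamma0 c0 kappa0 e_sym e_irr cx).
  apply: vector_measurable_lipschitz => [|b1 b2]; last first.
    exact: (step_solution_lipschitz problem polyhedral gamma0 c0 kappa0 e_sym e_irr).
  apply: vector_measurableB; last exact: vector_measurableZ.
  apply: vector_measurableB; last first.
    by apply/vector_measurableZ/vector_measurable_mulmx/vector_measurable_mulmx.
  apply: vector_measurableD; last exact: vector_measurable_mulmx.
  apply: vector_measurableB; last exact: vector_measurableZ.
  exact: (vector_measurable_minibatch oracle).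
split=> //.
have -> : z k.+1 = fun w => z k w + beta *: (x k.+1 w - z k w).
  by apply/funext => w; apply: (sppdm_z run k).
by apply: vector_measurableD => //; apply: vector_measurableZ; apply: vector_measurableB.
Qed.

End Iterates.

(** * Averaging over the iterations *)

Lemma expected_sum_le {R : realType} {d : measure_display} {T : measurableType d}
    (P : probability T R) (K : nat) (gap err : nat -> T -> R) (C0 C1 V U : R) :
  0 <= C0 -> 0 <= C1 ->
  (forall k, measurable_fun setT (gap k)) -> (forall k, measurable_fun setT (err k)) ->
  (forall k w, 0 <= gap k w) -> (forall k w, 0 <= err k w) ->
  (forall w, \sum_(k < K) gap k w <= C0 * (V + C1 * \sum_(k < K) err k w)) ->
  (forall k, (\int[P]_w (err k w)%:E <= U%:E)%E) ->
  (\sum_(k < K) 'E_P[gap k] <= (C0 * (V + C1 * (K%:R * U)))%:E)%E.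
Proof.
move=> C00 C10 mgap merr gap0 err0 path errU.
have ierr k : P.-integrable setT (fun w => (err k w)%:E).
  apply/integrableP; split; first exact/measurable_EFinP.
  under eq_integral do rewrite gee0_abs ?lee_fin //.
  exact: le_lt_trans (errU k) (ltry U).
have iZ k : P.-integrable setT (fun w => ((C0 * C1)%:E * (err k w)%:E)%E).
  by apply: integrableZl.
under eq_bigr do rewrite unlock.
rewrite -ge0_integral_sum //; last 2 first.
- by move=> k; apply/measurable_EFinP.
- by move=> k w _; rewrite lee_fin.
apply: (@le_trans _ _ (\int[P]_w
    ((C0 * V)%:E + \sum_(k < K) ((C0 * C1)%:E * (err k w)%:E)))%E).
  apply: ge0_le_integral => //.
  - by move=> w _; apply: sume_ge0 => k _; rewrite lee_fin.
  - by apply: emeasurable_sum => k; apply/measurable_EFinP.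
  - apply: emeasurable_funD => //; apply: emeasurable_sum => k.
    by apply: emeasurable_funM => //; apply/measurable_EFinP.
  move=> w _; rewrite sumEFin; under [X in (_ <= _ + X)%E]eq_bigr do rewrite -EFinM.
  rewrite sumEFin -EFinD lee_fin; apply: le_trans (path w) _.
  by rewrite -mulr_sumr mulrDr mulrA.
rewrite integralD //; last 2 first.
- exact: finite_measure_integrable_cst.
- exact: integrable_sum.
rewrite integral_probability_cst integral_sum // mulrDr EFinD leeD2l //.
apply: (@le_trans _ _ (\sum_(k < K) (C0 * C1 * U)%:E)%E).
  apply: lee_sum => k _; rewrite integralZl // [leRHS]EFinM.
  by apply: lee_wpmul2l => //; rewrite lee_fin mulr_ge0.
by rewrite sumEFin lee_fin sumr_const card_ord -[leLHS]mulr_natl [leRHS]mulrA mulrCA.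
Qed.

Lemma bigmin_le_mean {R : realType} (K : nat) (a : nat -> \bar R) (eps : R) :
  (0 < K)%N -> (forall k, (0 <= a k)%E) -> (\sum_(k < K) a k <= (K%:R * eps)%:E)%E ->
  (\big[Order.min/+oo]_(k < K) a k <= eps%:E)%E.
Proof.
move=> K0 a0 suma.
have [k ak] : exists k : 'I_K, (a k <= eps%:E)%E.
  apply: contrapT => /forallNP all_gt.
  have {}all_gt (k : 'I_K) : (eps%:E < a k)%E by rewrite ltNge; apply/negP.
  have afin (k : 'I_K) : a k = (fine (a k))%:E.
    rewrite fineK // ge0_fin_numE //; apply: le_lt_trans (ltry (K%:R * eps)).
    by apply: le_trans suma; rewrite (bigD1 k) //= leeDl // sume_ge0.
  move: suma; under eq_bigr do rewrite afin.
  rewrite sumEFin lee_fin leNgt => /negP; apply.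
  have -> : K%:R * eps = \sum_(k < K) eps by rewrite sumr_const card_ord mulr_natl.
  apply: ltr_sum => [|k _]; last by rewrite -lte_fin -afin.
  by apply/hasP; exists (Ordinal K0) => //; rewrite mem_index_enum.
by apply: le_trans ak; apply: (@bigmin_le _ _ _ +oo%E k).
Qed.

(** Between the origin and a basis vector the lower bound by [mu / 2] exceeds the
    upper bound by [L / 2], so that there is no basis vector. *)
Lemma trivial_of_curvature {R : realType} {N n : nat} (e : rel 'I_N)
    (f_ : 'I_N -> 'cV[R]_n -> R) (r_ : 'I_N -> 'cV[R]_n -> \bar R) (L mu flow : R) :
  0 <= L -> L < mu -> assumption1 e L mu flow f_ r_ -> forall x : 'cV[R]_(N * n), x = 0.
Proof.
move=> L0 Lmu smooth x; apply/matrixP => l j; exfalso.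
have h1 := a1_lower_curvature smooth (delta_mx l 0) 0.
have h2 := descent_lemma L0 (a1_differentiable smooth) (a1_lipschitz smooth) (delta_mx l 0) 0.
have dd : dot (delta_mx l 0 - 0) (delta_mx l 0 - 0) = 1 :> R.
  rewrite subr0 /dot (bigD1 l) //= big1 => [|i il]; first by rewrite !mxE !eqxx mulr1 addr0.
  by rewrite !mxE (negPf il) mul0r.
by move: h1 h2; rewrite enorm_sq dd; lra.
Qed.

Theorem corollary1 (R : realType) (N : nat) (e : rel 'I_N)
    (he : connected_graph e) (hdeg : forall i, (1 <= degree e i)%N)
    (L mu kappa gamma c : R)
    (hL : 0 < L) (hmu : - L <= mu)
    (hc : 0 < c) (hkappa0 : 0 < kappa) (hgamma0 : 0 < gamma)
    (hkappa : - mu < kappa) (hgamma : 3 * L < gamma) :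
  exists tau abar : R, [/\ 0 < tau, 0 < abar <= c &
  forall alpha : R, 0 < alpha <= abar ->
  forall (n : nat) (q : 'I_N -> nat)
    (Sx : forall i, 'M[R]_(q i, n)) (Sy : forall i, 'cV[R]_(q i)),
  exists bbar : R, 0 < bbar <= 1 /\
  forall beta : R, 0 < beta < bbar ->
  exists C0 C1 : R, [/\ 0 < C0, 0 < C1 &
  forall (f_ : 'I_N -> 'cV[R]_n -> R) (r_ : 'I_N -> 'cV[R]_n -> \bar R)
    (flow : R) (zeta : forall i, 'cV[R]_(q i)),
  consensus_problem e f_ r_ ->
  assumption1 e L mu flow f_ r_ ->
  assumption2 Sx Sy zeta r_ ->
  forall (dX : 'I_N -> measure_display) (X : forall i, measurableType (dX i))
    (D : forall i, probability (X i) R)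
    (G : forall i, 'cV[R]_n -> X i -> 'cV[R]_n) (sigma : R),
  0 < sigma ->
  assumption3 f_ D G sigma ->
  forall eta : nat -> R,
  (forall k, 0 <= eta k <=
     Num.sqrt ((kappa + 2 * c + gamma - 3 * L) /
               (2 * (gamma - mu + 3 * L)))) ->
  forall (eps : R) (m K : nat) (x0 : 'cV[R]_(N * n)),
  0 < eps ->
  (1 <= m)%N -> (1 <= K)%N ->
  2 * N%:R * C0 * C1 * sigma ^+ 2 / eps <= m%:R ->
  ((2 * C0)%:E * (initial_potential e f_ r_ kappa c tau alpha x0 - flow%:E)
     * (eps^-1)%:E <= K%:R%:E)%E ->
  forall (d : measure_display) (T : measurableType d) (P : probability T R)
    (xi : nat -> forall i, 'I_m -> {RV P >-> X i})
    (x z : nat -> T -> 'cV[R]_(N * n))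
    (lambda : nat -> T -> 'cV[R]_(#|edges e| * n)),
  sppdm f_ r_ D G alpha beta gamma c kappa eta xi x0 x z lambda ->
  (\big[Order.min/+oo]_(k < K) 'E_P[fun w => Qgap f_ r_ (x k w) (lambda k.+1 w)]
     <= eps%:E)%E]].

Proof.
have [e_sym e_irr _] := he; have m0 : 0 < mu + kappa by lra.
have [muL|Lmu] := leP mu L; last first.
  exists 1, c; rewrite ltr01 hc lexx; split=> // alpha _ n q Sx Sy.
  exists 1; rewrite ltr01 lexx; split=> // beta _; exists 1, 1; rewrite ltr01; split=> //.
  move=> f_ r_ flow zeta prob smo poly dX X D G sigma _ _ eta _ eps m K x0 eps0 _ K0 _ _.
  move=> d T P xi x z lambda _.
  apply: le_trans (bigmin_le _ (Ordinal K0) _) _.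
  have -> : (fun w => Qgap f_ r_ (x (Ordinal K0) w) (lambda (Ordinal K0).+1 w)) = cst 0.
    apply/funext => w; have all0 := trivial_of_curvature (ltW hL) Lmu smo.
    by rewrite /Qgap (all0 (_ - _)) (all0 (x _ w)) mulmx0 !enorm0 expr0n addr0.
  by rewrite expectation_cst lee_fin ltW.
have den0 : 0 < 2 * (gamma - mu + 3 * L) by lra.
have num0 : 0 <= kappa + 2 * c + gamma - 3 * L by lra.
pose E := Num.sqrt ((kappa + 2 * c + gamma - 3 * L) / (2 * (gamma - mu + 3 * L))).
have EE : E ^+ 2 * (2 * (gamma - mu + 3 * L)) <= gamma + kappa + 2 * c - 3 * L.
  rewrite sqr_sqrtr; last by rewrite divr_ge0 // ltW.
  by rewrite divfK ?gt_eqF //; lra.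
have nA0 : 0 <= 2 * N%:R :> R by rewrite mulr_ge0.
have [tau [abar [tau0 abar_c desc]]] :=
  gap_descent nA0 hL muL hgamma hc hkappa0 m0 (sqrtr_ge0 _) EE.
exists tau, abar; split=> // alpha alphaP n q Sx Sy.
have [Ce CeP] := dual_error_bound e Sx Sy (ltW hL) muL hkappa0 m0.
have [bbar [bbarP {}desc]] := desc alpha alphaP Ce.
exists bbar; split=> // beta betaP; have [C0 [C1 [C00 C10 {}desc]]] := desc beta betaP.
exists C0, C1; split=> // f_ r_ flow zeta prob smo poly dX X D G sigma _ oracle eta etaE.
move=> eps m K x0 eps0 m_gt0 K_gt0 m_large K_large d T P xi x z lambda run.
pose gap k w := Qgap f_ r_ (x k w) (lambda k.+1 w).
pose err k w := enorm (minibatch G xi k (extrapolation eta x k w) w -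
  grad (fsum f_) (extrapolation eta x k w)) ^+ 2.
have path w : exists2 V : R, initial_potential e f_ r_ kappa c tau alpha x0 = V%:E &
    \sum_(k < K) gap k w <= C0 * (V - flow + C1 * \sum_(k < K) err k w).
  have [||||||V VE VP] := path_gap_sum (ltW hL) prob smo poly hc hkappa0 m0 (ltW tau0)
    C00 e_sym e_irr hdeg desc (CeP _ _ _ _ _ prob smo poly) etaE
    (x := fun k => x k w) (z := fun k => z k w) (lam := fun k => lambda k w)
    (v := fun k => minibatch G xi k (extrapolation eta x k w) w).
  - by rewrite (sppdm_x0 run); apply: (sppdm_x0_dom run).
  - by rewrite (sppdm_x0 run) (sppdm_z0 run).
  - by rewrite (sppdm_x0 run) (sppdm_lambda0 run).
  - by move=> k; apply: (sppdm_lambda run).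
  - by move=> k; apply: (sppdm_x run).
  - by move=> k; apply: (sppdm_z run).
  by exists V => //; rewrite -(sppdm_x0 run w).
have [V VE _] := path point.
have meas k := sppdm_measurable prob poly oracle hgamma0 hc hkappa0 e_sym e_irr run k.
have mx k : vector_measurable (x k) by case: (meas k).
have mgap k : measurable_fun setT (gap k).
  by apply: (measurable_Qgap prob smo poly) => //; case: (meas k.+1).
have merr k : measurable_fun setT (err k).
  have ms := vector_measurable_extrapolation eta mx k.
  have me : vector_measurable (fun w => minibatch G xi k (extrapolation eta x k w) w -
      grad (fsum f_) (extrapolation eta x k w)).
    apply: vector_measurableB; first exact: (vector_measurable_minibatch oracle).
    exact: vector_measurable_lipschitz ms (a1_lipschitz smo).
  by rewrite /err; under eq_fun do rewrite enorm_sq; apply: measurable_dot.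
have variance k := minibatch_variance oracle (a1_lipschitz smo) eta mx (sppdm_distribution run)
  (sppdm_independent run) k m_gt0.
have gap0 k w : 0 <= gap k w by rewrite addr_ge0 // sqr_ge0.
apply: (bigmin_le_mean (a := fun k => ('E_P[gap k])%E)) => // [k|].
  exact: expectation_ge0.
have sum_le := expected_sum_le (K := K) (gap := gap) (err := err) (V := V - flow)
  (ltW C00) (ltW C10) mgap merr gap0 (fun k w => sqr_ge0 _) _ variance.
apply: le_trans (sum_le _) _ => [w|].
  by have [V' V'E] := path w; move: V'E; rewrite VE => -[->].
move: K_large; rewrite VE -EFinB -!EFinM !lee_fin ler_pdivrMr // => K_large.
have m_pos : 0 < m%:R :> R by rewrite ltr0n.
have m_half : C0 * C1 * (N%:R * sigma ^+ 2 / m%:R) <= eps / 2.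
  move: m_large; rewrite ler_pdivrMr // => m_large.
  rewrite !mulrA ler_pdivrMr //; lra.
have := ler_wpM2l (ler0n R K) m_half; lra.
Qed.
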